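(* The space $\mathrm{Homeo}(M,\xi)$ equipped with the contact topology admits a left invariant metric that generates its topology.
   Context: Setting. $M$ is a closed (compact, without boundary), connected smooth manifold of dimension $2n+1$ with a cooriented contact structure $\xi=\ker\alpha$, where $\alpha$ is a fixed contact form, and $\nu_\alpha=\alpha\wedge(d\alpha)^n$. $\mathrm{Diff}(M,\xi)$ is the group of diffeomorphisms $\phi$ with $\phi^*\alpha=e^{g}\alpha$ for a smooth function $g$ on $M$. A smooth contact isotopy is a smooth isotopy $\Phi=\{\phi_t\}_{0\le t\le1}$ in $\mathrm{Diff}(M,\xi)$ with $\phi_0=\mathrm{id}$; if $\frac{d}{dt}\phi_t=X_t\circ\phi_t$, its Hamiltonian is $H_t=\alpha(X_t)$; this is a bijection onto smooth functions $H\colon[0,1]\times M\to\mathbb R$, and one writes $\Phi=\Phi_H=\{\phi_H^t\}$. Its conformal factor $h$ is defined by $(\phi_H^t)^*\alpha=e^{h_t}\alpha$, and $(\Phi_H,H,h)$ is a smooth contact dynamical system. Norms and metrics. For a function $H$ on $M$, $\|H\|=\max_M H-\min_M H+\left|\frac{1}{\int_M\nu_\alpha}\int_M H\,\nu_\alpha\right|$; for $H\colon[0,1]\times M\to\mathbb R$, $\|H\|_{(1,\infty)}=\int_0^1\|H_t\|\,dt$; $|h|=\max_{t,x}|h(t,x)|$. Fix a Riemannian distance $d$ on $M$; $\overline d(\phi,\psi)=\max_x d(\phi(x),\psi(x))+\max_x d(\phi^{-1}(x),\psi^{-1}(x))$ for homeomorphisms and $\overline d(\Phi,\Psi)=\max_t\overline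 d(\phi_t,\psi_t)$ for isotopies. A triple $(\Phi,H,h)$ of a continuous isotopy of homeomorphisms and functions $H,h\colon[0,1]\times M\to\mathbb R$ is a topological contact dynamical system if there are smooth contact dynamical systems $(\Phi_{H_i},H_i,h_i)$ with $\Phi_{H_i}\to\Phi$ uniformly, $h_i\to h$ uniformly, and $\|H-H_i\|_{(1,\infty)}\to0$ ($H\in L^1([0,1],C^0(M))$); one writes $\Phi=\Phi_H$. The set of these is $\mathcal{TCDS}(M,\alpha)$, with metric $d_\alpha((\Phi_H,H,h),(\Phi_F,F,f))=\overline d(\Phi_H,\Phi_F)+|h-f|+\|H-F\|_{(1,\infty)}$. $\mathrm{Homeo}(M,\xi)$ is the group (under composition) of time-one maps $\phi_H^1$ of topological contact dynamical systems. The contact topology on $\mathrm{Homeo}(M,\xi)$ is the quotient topology induced by the surjection $\mathrm{ev}_1\colon\mathcal{TCDS}(M,\alpha)\to\mathrm{Homeo}(M,\xi)$, $(\Phi_H,H,h)\mapsto\phi_H^1$, where $\mathcal{TCDS}(M,\alpha)$ has the metric topology of $d_\alpha$. *)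

(* Defs.v *)
From HB Require Import structures.
From mathcomp Require Import all_boot all_order all_algebra all_fingroup.
From mathcomp Require Import all_classical all_reals all_analysis.

Set Implicit Arguments.
Unset Strict Implicit.
Unset Printing Implicit Defensive.

Import Order.TTheory GRing.Theory Num.Theory.
Import numFieldNormedType.Exports.

Local Open Scope classical_set_scope.
Local Open Scope ring_scope.

Section Calculus.
Context {R : realType}.

Definition I01 : set R := `[0, 1].

(* C^k on an open set [U] of a finite-dimensional space: [f] is differentiable
   and [x |-> Df(x) v] is C^(k-1) for every fixed [v]. *)
Fixpoint Ck {V W : normedModType R} (k : nat) (U : set V) (f : V -> W) : Prop :=
  match k with
  | 0 => forall x, U x -> {for x, continuous f}
  | k'.+1 => (forall x, U x -> differentiable f x) /\
             forall v, Ck k' U (fun x => 'd f x v)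
  end.

Definition Cinfty {V W : normedModType R} (U : set V) (f : V -> W) : Prop :=
  forall k, Ck k U f.

(* Smoothness on an arbitrary set, e.g. one with boundary: locally, [f] is the
   restriction of a smooth function defined on an open set. *)
Definition smooth_on {V W : normedModType R} (A : set V) (f : V -> W) : Prop :=
  forall a, A a -> exists U (g : V -> W),
    [/\ open U, U a, Cinfty U g & forall x, A x -> U x -> g x = f x].

(* The (possibly one-sided) derivative at [t] of a curve on [0, 1] is [v]. *)
Definition has_velocity {V : normedModType R} (u : R -> V) (t : R) (v : V) :
    Prop :=
  ((s - t)^-1 *: (u s - u t)) @[s --> within I01 t^'] --> v.

(* Lebesgue integral over R^d of a nonnegative Borel function, written as an
   iterated integral. *)
Fixpoint integral_rV (d : nat) : ('rV[R]_d -> \bar R) -> \bar R :=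
  match d with
  | 0 => fun f => f 0
  | d'.+1 => fun f =>
      (\int[lebesgue_measure]_(t in [set: R])
        integral_rV (fun x : 'rV[R]_d' => f (row_mx t%:M x : 'rV[R]_(1 + d'))))%E
  end.

Definition pairing {d : nat} (a v : 'rV[R]_d) : R := (v *m a^T) 0 0.

End Calculus.

Section Manifold.
Context {R : realType} {d : nat}.

Record chart (M : ptopologicalType) := Chart {
  cdom : set M;
  ccod : set 'rV[R]_d;
  cmap : M -> 'rV[R]_d;
  cinv : 'rV[R]_d -> M;
  cdom_open : open cdom;
  ccod_open : open ccod;
  cmap_cod : forall p, cdom p -> ccod (cmap p);
  cinv_dom : forall x, ccod x -> cdom (cinv x);
  cmapK : forall p, cdom p -> cinv (cmap p) = p;
  cinvK : forall x, ccod x -> cmap (cinv x) = x;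
  cmap_continuous : forall p, cdom p -> {for p, continuous cmap};
  cinv_continuous : forall x, ccod x -> {for x, continuous cinv} }.

Definition overlap (M : ptopologicalType) (c c' : chart M) : set 'rV[R]_d :=
  [set x | ccod c x /\ cdom c' (cinv c x)].

Definition transition (M : ptopologicalType) (c c' : chart M) :
    'rV[R]_d -> 'rV[R]_d :=
  fun x => cmap c' (cinv c x).

Record smooth_structure (M : ptopologicalType) := SmoothStructure {
  atlas : set (chart M);
  atlas_cover : forall p : M, exists2 c, atlas c & cdom c p;
  atlas_compat : forall c c', atlas c -> atlas c' ->
    Cinfty (overlap c c') (transition c c') }.

Definition closed_connected (M : ptopologicalType) : Prop :=
  [/\ hausdorff_space M, compact [set: M] & connected [set: M]].

End Manifold.
Arguments chart R d M : clear implicits.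
Arguments smooth_structure R d M : clear implicits.

Section Tensors.
Context {R : realType} {d : nat} {M : ptopologicalType}.
Variable S : smooth_structure R d M.

(* Tensor fields are given by their coefficients in the charts of the atlas,
   subject to the usual transformation law. *)
Record one_form := OneForm {
  coef : chart R d M -> 'rV[R]_d -> 'rV[R]_d;
  coef_smooth : forall c, atlas S c -> Cinfty (ccod c) (coef c);
  coef_compat : forall c c', atlas S c -> atlas S c' ->
    forall x, overlap c c' x -> forall v,
      pairing (coef c x) v =
      pairing (coef c' (transition c c' x)) ('d (transition c c') x v) }.

Record riemannian_metric := RiemannianMetric {
  gram : chart R d M -> 'rV[R]_d -> 'M[R]_d;
  gram_smooth : forall c, atlas S c -> Cinfty (ccod c) (gram c);
  gram_sym : forall c x, atlas S c -> ccod c x -> (gram c x)^T = gram c x;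
  gram_pos : forall c x, atlas S c -> ccod c x -> forall v : 'rV[R]_d,
    v != 0 -> 0 < (v *m gram c x *m v^T) 0 0;
  gram_compat : forall c c', atlas S c -> atlas S c' ->
    forall x, overlap c c' x -> forall v w : 'rV[R]_d,
      (v *m gram c x *m w^T) 0 0 =
      ('d (transition c c') x v *m gram c' (transition c c' x)
        *m ('d (transition c c') x w)^T) 0 0 }.

Definition arc_length (g : riemannian_metric) (c : chart R d M)
    (u : R -> 'rV[R]_d) : R :=
  \int[lebesgue_measure]_(t in I01)
    Num.sqrt ((derive1 u t *m gram g c (u t) *m (derive1 u t)^T) 0 0).

(* [curve_length g p q L]: some piecewise smooth curve from [p] to [q] has
   length [L]; the curve is cut into smooth pieces each lying in one chart,
   where [u] is the coordinate expression of a piece. *)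
Inductive curve_length (g : riemannian_metric) : M -> M -> R -> Prop :=
| CurveNil p : curve_length g p p 0
| CurveCons c (u : R -> 'rV[R]_d) q L :
    atlas S c -> smooth_on (I01 : set R^o) (u : R^o -> 'rV[R]_d) ->
    (forall t, I01 t -> ccod c (u t)) ->
    curve_length g (cinv c (u 1)) q L ->
    curve_length g (cinv c (u 0)) q (arc_length g c u + L).

Definition riemannian_distance (g : riemannian_metric) (p q : M) : R :=
  inf [set L | curve_length g p q L].

Definition smooth_function (H : R -> M -> R) : Prop :=
  forall c, atlas S c ->
    smooth_on [set z : R^o * 'rV[R]_d | I01 z.1 /\ ccod c z.2]
      (fun z => H z.1 (cinv c z.2) : R^o).

Definition smooth_map (F : R -> M -> M) : Prop :=
  {within I01 `*` [set: M], continuous (fun z : R * M => F z.1 z.2)} /\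
  forall c c', atlas S c -> atlas S c' ->
    smooth_on [set z : R^o * 'rV[R]_d | [/\ I01 z.1, ccod c z.2 &
                                          cdom c' (F z.1 (cinv c z.2))]]
      (fun z => cmap c' (F z.1 (cinv c z.2))).

End Tensors.

Section ContactForm.
Context {R : realType} {n : nat} {M : ptopologicalType}.
Variable S : smooth_structure R n.*2.+1 M.
Variable alpha : one_form S.

Definition d_coef (c : chart R n.*2.+1 M) (x : 'rV[R]_(n.*2.+1))
    (i j : 'I_n.*2.+1) : R :=
  ('d (coef alpha c) x (delta_mx 0 i)) 0 j -
  ('d (coef alpha c) x (delta_mx 0 j)) 0 i.

(* (alpha /\ (d alpha)^n)(e_0, ..., e_2n) in the chart [c]; the factor 2^-n
   is the normalisation 1 / (1! 2! ... 2!) of the wedge product. *)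
Definition nu_coef (c : chart R n.*2.+1 M) (x : 'rV[R]_(n.*2.+1)) : R :=
  2 ^- n * \sum_(s : 'S_(n.*2.+1)) (-1) ^+ s * coef alpha c x 0 (s ord0) *
    \prod_(k < n) d_coef c x (s (inord k.*2.+1)) (s (inord k.*2.+2)).

Definition contact_form : Prop :=
  forall c x, atlas S c -> ccod c x -> nu_coef c x != 0.

(* [mu] is the Borel measure defined by the volume form [nu_alpha], [M] being
   oriented by [nu_alpha]: it has density [|nu_coef c|] in the chart [c]. *)
Definition volume_measure
    (mu : {finite_measure set (g_sigma_algebraType (@open M)) -> \bar R}) :
    Prop :=
  forall c, atlas S c -> forall A : set (g_sigma_algebraType (@open M)),
    measurable A -> A `<=` cdom c ->
    mu A = integral_rV
      (fun x => (\1_(cmap c @` (A : set M)) x * `|nu_coef c x|)%:E).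

End ContactForm.

Section Dynamics.
Context {R : realType} {n : nat} {M : ptopologicalType}.
Variable S : smooth_structure R n.*2.+1 M.
Variable alpha : one_form S.
Variable mu : {finite_measure set (g_sigma_algebraType (@open M)) -> \bar R}.
Variable g : riemannian_metric S.

(* A family of bijections of [M] with its family of inverses; only the times
   in [0, 1] matter, here and for all time-dependent functions below. *)
Record isotopy := Isotopy {
  fwd : R -> M -> M;
  bwd : R -> M -> M;
  fwdK : forall t, I01 t -> cancel (fwd t) (bwd t);
  bwdK : forall t, I01 t -> cancel (bwd t) (fwd t) }.

Record dynamical_system := DynamicalSystem {
  flow : isotopy;
  ham : R -> M -> R;
  conf : R -> M -> R }.

Definition conformal_factor (F : R -> M -> M) (h : R -> M -> R) : Prop :=
  forall c c' t x, atlas S c -> atlas S c' -> I01 t -> ccod c x ->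
    cdom c' (F t (cinv c x)) -> forall v,
    let f := fun y => cmap c' (F t (cinv c y)) in
    pairing (coef alpha c' (f x)) ('d f x v) =
    expR (h t (cinv c x)) * pairing (coef alpha c x) v.

(* H_t = alpha(X_t), where d/dt phi_t = X_t o phi_t. *)
Definition hamiltonian (F : R -> M -> M) (H : R -> M -> R) : Prop :=
  forall c t p, atlas S c -> I01 t -> cdom c (F t p) ->
    exists2 v, has_velocity (fun s => cmap c (F s p)) t v &
      H t (F t p) = pairing (coef alpha c (cmap c (F t p))) v.

Definition smooth_contact_system (s : dynamical_system) : Prop :=
  [/\ [/\ smooth_map S (fwd (flow s)), smooth_map S (bwd (flow s)) &
          fwd (flow s) 0 = id],
      smooth_function S (ham s) /\ hamiltonian (fwd (flow s)) (ham s) &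
      smooth_function S (conf s) /\
      conformal_factor (fwd (flow s)) (conf s)].

Definition mean (f : M -> R) : R :=
  (fine (mu setT))^-1 *
    \int[mu]_(x in setT) (f : g_sigma_algebraType (@open M) -> R) x.

Definition norm_C0 (f : M -> R) : R := sup (range f) - inf (range f) + `|mean f|.

Definition norm_1oo (H : R -> M -> R) : \bar R :=
  (\int[lebesgue_measure]_(t in I01) (norm_C0 (H t))%:E)%E.

Definition sup_norm (h : R -> M -> R) : R :=
  sup [set `|h z.1 z.2| | z in I01 `*` [set: M]].

Definition simple_path (s : R -> M -> R) : Prop :=
  exists N (A : 'I_N -> set R) (f : 'I_N -> M -> R),
    [/\ forall j, measurable (A j), forall j, continuous (f j) &
        forall t x, s t x = \sum_j \1_(A j) t * f j x].

(* Bochner measurability of the map [t |-> H t] from [0, 1] to C^0(M). *)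
Definition strongly_measurable (H : R -> M -> R) : Prop :=
  exists2 s : nat -> R -> M -> R, forall k, simple_path (s k) &
    forall t, I01 t -> forall e, 0 < e ->
      \forall k \near \oo, forall x, `|s k t x - H t x| < e.

(* Representatives of the elements of L^1([0, 1], C^0(M)). They are not
   identified up to null sets of times, so that [d_alpha] below is a
   pseudometric; this does not affect the quotient topology. *)
Definition L1_C0 (H : R -> M -> R) : Prop :=
  [/\ forall t, I01 t -> continuous (H t), strongly_measurable H &
      (norm_1oo H < +oo)%E].

Definition uniformly_to {T : Type} (dist : T -> T -> R)
    (F : nat -> R -> M -> T) (G : R -> M -> T) : Prop :=
  forall e, 0 < e -> \forall i \near \oo,
    forall t x, I01 t -> dist (F i t x) (G t x) < e.

Local Notation dist := (riemannian_distance g).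

Definition continuous_isotopy (Phi : isotopy) : Prop :=
  {within I01 `*` [set: M], continuous (fun z : R * M => fwd Phi z.1 z.2)} /\
  {within I01 `*` [set: M], continuous (fun z : R * M => bwd Phi z.1 z.2)}.

Definition TCDS : set dynamical_system := [set s |
  [/\ continuous_isotopy (flow s), L1_C0 (ham s) &
  exists si : nat -> dynamical_system,
  [/\ forall i, smooth_contact_system (si i),
      uniformly_to dist (fun i => fwd (flow (si i))) (fwd (flow s)),
      uniformly_to dist (fun i => bwd (flow (si i))) (bwd (flow s)),
      uniformly_to (fun a b => `|a - b|) (fun i => conf (si i)) (conf s) &
      norm_1oo (fun t x => ham s t x - ham (si i) t x) @[i --> \oo] --> 0%E]]].

Definition dbar_homeo (phi phiV psi psiV : M -> M) : R :=
  sup [set dist (phi x) (psi x) | x in [set: M]] +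
  sup [set dist (phiV x) (psiV x) | x in [set: M]].

Definition dbar (Phi Psi : isotopy) : R :=
  sup [set dbar_homeo (fwd Phi t) (bwd Phi t) (fwd Psi t) (bwd Psi t)
      | t in I01].

Definition d_alpha (s s' : dynamical_system) : R :=
  dbar (flow s) (flow s') + sup_norm (fun t x => conf s t x - conf s' t x) +
  fine (norm_1oo (fun t x => ham s t x - ham s' t x)).

Definition ev1 (s : dynamical_system) : M -> M := fwd (flow s) 1.

Definition contact_homeo : set (M -> M) := ev1 @` TCDS.

(* Open sets of a set [A] for a (pseudo)metric [delta] on [A]. *)
Definition metric_open {T : Type} (A : set T) (delta : T -> T -> R)
    (U : set T) : Prop :=
  U `<=` A /\ forall a, U a ->
    exists2 e, 0 < e & forall b, A b -> delta a b < e -> U b.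

(* The quotient topology of [ev1 : TCDS -> contact_homeo]. *)
Definition contact_open (V : set (M -> M)) : Prop :=
  V `<=` contact_homeo /\ metric_open TCDS d_alpha (TCDS `&` ev1 @^-1` V).

End Dynamics.

Definition metric_on {R : realType} {T : Type} (A : set T)
    (delta : T -> T -> R) : Prop :=
  [/\ forall a b, A a -> A b -> 0 <= delta a b,
      forall a b, A a -> A b -> (delta a b = 0 <-> a = b),
      forall a b, A a -> A b -> delta a b = delta b a &
      forall a b c, A a -> A b -> A c ->
        delta a c <= delta a b + delta b c].

Definition left_invariant {R : realType} {T : Type} (A : set (T -> T))
    (delta : (T -> T) -> (T -> T) -> R) : Prop :=
  forall f a b, A f -> A a -> A b -> delta (f \o a) (f \o b) = delta a b.

(* Main.v *)
Require Import Defs.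
From HB Require Import structures.
From mathcomp Require Import all_boot all_order all_algebra.
From mathcomp Require Import all_classical all_reals all_analysis.
From mathcomp Require Import measurable_realfun ring lra.

(* The triples (flow, Hamiltonian, conformal factor) form a group under
   (phi, H, h) (psi, K, k) = (phi o psi, H + (e^h K) o phi^-1, h o psi + k),
   and no general metrisation theorem is needed to make the quotient topology
   of the time-one maps metrisable.  Replace ||.|| by the equivalent norm
   J(H) = int sup_x |H_t| dt.  Then J(H # K) <= J(H) + e^|h| J(K), which makes
   the weight w = e^|h| + J(H) submultiplicative, so that
   N(s) = dbar(id, phi) + ln w is subadditive on the group, and
   N(s^-1) <= 2 N(s).  Hence, with rho(f, f') the infimum of N(s) over the
   systems s whose time-one map is f^-1 f', the function
   rho(f, f') + rho(f', f) is a left invariant metric.  It generates the contact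
   topology because N(t) -> 0 implies s t -> s, and b -> s implies
   N(s^-1 b) -> 0, in the topology of d_alpha.

   The conformal factors and flows are controlled by uniform continuity with
   respect to the Riemannian distance.  That this distance induces the topology
   of M is seen by testing curves against C^1 bump functions: their
   derivative is bounded by a multiple of the Riemannian norm, so they are
   Lipschitz for the distance. *)

Set Implicit Arguments.
Unset Strict Implicit.
Unset Printing Implicit Defensive.

Import Order.TTheory GRing.Theory Num.Theory.
Import numFieldNormedType.Exports.

Local Open Scope classical_set_scope.
Local Open Scope ring_scope.

(** * Calculus of C^k maps *)

Section Differentials.
Context {R : realType}.

Section LocalChange.
Context {V W : normedModType R}.
Implicit Types f g : V -> W.

(** Left translation by a system distorts [d_alpha], through moduli of continuity of its flow and
    conformal factor and through the factor e^h on Hamiltonians. Sizes, measured from the identity,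
    behave better, and a length depending on f^-1 f' alone is left invariant by construction. The
    sup norm is preferred to oscillation plus mean because composition with a homeomorphism
    preserves it and multiplication by e^h costs at most sup e^h; the two norms are equivalent
    because the total volume is positive. Definiteness survives the infimum since all competitors
    share one time-one map, whose displacement is at most N(s) for each of them.

    The bulk of the work is the closure of TCDS under product and inverse. The group law is first
    checked on smooth systems, in charts and with one-sided velocities at the times 0 and 1, and
    then passed to the limit. Limit Hamiltonians are only L^1 in time, so their compositions with
    converging flows are controlled by approximation with Hamiltonians continuous in time. *)

Lemma near_differentiable_diff f g x : {near x, f =1 g} ->
  differentiable f x ->
  differentiable g x /\ 'd g x = 'd f x :> (V -> W).
Proof.
move=> fg df.
have dg : g \o shift x = cst (g x) + 'd f x +o_ 0 id.
  apply/eqaddoP => e e0.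
  have /eqaddoP/(_ e e0) := diff_locally df.
  have : \forall h \near (0 : V), f (h + x) = g (h + x).
    move: fg; rewrite (near_shift 0 x).
    by apply: filterS => y; rewrite /= subr0.
  apply: filterS2 => h /= fgh.
  by rewrite !fctE /= fgh (nbhs_singleton fg).
(* ['d g x] is defined by choice, so it has to be identified through the uniqueness of the
   first-order expansion, which [g] shares with [f]. *)
have E : 'd g x = 'd f x :> (V -> W).
  by apply: diff_unique dg; exact: diff_continuous.
split=> //; apply/diff_locallyP; rewrite E; split => //.
exact: diff_continuous.
Qed.

Lemma near_differentiable f g x : {near x, f =1 g} ->
  differentiable f x -> differentiable g x.
Proof. by move=> fg /(near_differentiable_diff fg)[]. Qed.

Lemma near_diff f g x v : {near x, f =1 g} ->
  differentiable f x -> 'd g x v = 'd f x v.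
Proof. by move=> fg /(near_differentiable_diff fg)[_ ->]. Qed.

End LocalChange.

Lemma Ck_ext {V W : normedModType R} k (U : set V) (f g : V -> W) :
  open U -> (forall x, U x -> f x = g x) -> Ck k U f -> Ck k U g.
Proof.
move=> oU; elim: k f g => [|k IH] f g fg /=.
  move=> cf x Ux; have := cf x Ux; rewrite /prop_for /continuous_at.
  rewrite -fg//; apply: cvg_trans; apply: near_eq_cvg.
  by have := open_nbhs_nbhs (conj oU Ux); apply: filterS => y /fg.
have nfg x : U x -> {near x, f =1 g}.
  by move=> Ux; have := open_nbhs_nbhs (conj oU Ux); apply: filterS => y /fg.
move=> [df ddf]; split=> [x Ux|v].
  exact: near_differentiable (nfg x Ux) (df x Ux).
apply: IH (ddf v) => x Ux.
by apply/esym/near_diff; [exact: nfg|exact: df].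
Qed.

Lemma Ck_sub {V W : normedModType R} k (U U' : set V) (f : V -> W) :
  U' `<=` U -> Ck k U f -> Ck k U' f.
Proof.
move=> U'U; elim: k f => [|k IH] f /=; first by move=> cf x /U'U; exact: cf.
by move=> [df ddf]; split=> [x /U'U /df//|v]; apply: IH.
Qed.

Lemma Ck_pred {V W : normedModType R} k (U : set V) (f : V -> W) :
  Ck k.+1 U f -> Ck k U f.
Proof.
elim: k f => [|k IH] f [df ddf].
  by move=> x Ux; apply: differentiable_continuous; exact: df.
by split=> // v; apply: IH; exact: ddf.
Qed.

Lemma Ck_cst {V W : normedModType R} k (U : set V) (w : W) : Ck k U (cst w).
Proof.
elim: k w => [|k IH] w /=; first by move=> x _; exact: cst_continuous.
split=> [x _|v]; first exact: differentiable_cst.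
have -> : (fun x : V => 'd (cst w) x v) = cst 0.
  by apply/funext => x; rewrite diff_cst.
exact: IH.
Qed.

Lemma Ck_lin {V W : normedModType R} k (U : set V) (f : {linear V -> W}) :
  continuous f -> Ck k U f.
Proof.
case: k => [|k] cf /=; first by move=> x _; exact: cf.
split=> [x _|v]; first exact: linear_differentiable.
have -> : (fun x : V => 'd f x v) = cst (f v).
  by apply/funext => x; rewrite diff_lin.
exact: Ck_cst.
Qed.

Lemma Ck_add {V W : normedModType R} k (U : set V) (f g : V -> W) :
  open U -> Ck k U f -> Ck k U g -> Ck k U (fun x => f x + g x).
Proof.
move=> oU; elim: k f g => [|k IH] f g /=.
  by move=> cf cg x Ux; apply: continuousD; [exact: cf|exact: cg].
move=> [df ddf] [dg ddg]; split=> [x Ux|v].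
  by apply: differentiableD; [exact: df|exact: dg].
apply: Ck_ext (IH _ _ (ddf v) (ddg v)) => // x Ux.
exact/esym/(congr1 (@^~ v) (diffD (df x Ux) (dg x Ux))).
Qed.

Lemma Ck_sum {V W : normedModType R} k (U : set V) n (f : 'I_n -> V -> W) :
  open U -> (forall i, Ck k U (f i)) -> Ck k U (fun x => \sum_i f i x).
Proof.
move=> oU; elim: n f => [|n IH] f cf.
  have -> : (fun x => \sum_(i < 0) f i x) = cst 0.
    by apply/funext => x; rewrite big_ord0.
  exact: Ck_cst.
have -> : (fun x => \sum_(i < n.+1) f i x) =
    (fun x => f ord0 x + \sum_(i < n) f (lift ord0 i) x).
  by apply/funext => x; rewrite big_ord_recl.
by apply: Ck_add => //; apply: IH => i; exact: cf.
Qed.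


(** Registers scalar multiplication as a bilinear map, so that the product rule in [is_diff_scale]
    is the differential of a bilinear map composed with a pair. *)
Lemma scaler_is_bilinear (W : normedModType R) :
  bilinear_for
    (GRing.Scale.Law.clone _ _ *:%R _) (GRing.Scale.Law.clone _ _ *:%R _)
    (@GRing.scale R W : R^o -> W -> W).
Proof.
split=> [u'|u] a x y /=.
- by rewrite scalerDl scalerA.
- by rewrite scalerDr !scalerA mulrC.
Qed.
HB.instance Definition _ (W : normedModType R) :=
  bilinear_isBilinear.Build R R^o W W _ _ (@GRing.scale R W : R^o -> W -> W)
    (scaler_is_bilinear W).

Lemma is_diff_scale {V W : normedModType R} (a : V -> R^o) (f : V -> W) x :
  differentiable a x -> differentiable f x ->
  is_diff x (fun x => a x *: f x) (fun v => 'd a x v *: f x + a x *: 'd f x v).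
Proof.
move=> da df.
have cs : continuous (fun p : R^o * W => p.1 *: p.2) by exact: scale_continuous.
have dp := differentiable_pair da df.
have db : differentiable (fun p : R^o * W => p.1 *: p.2) (a x, f x).
  exact: (@differentiable_bilin _ _ _ _ (@GRing.scale R W : R^o -> W -> W)).
apply: DiffDef; first exact: (differentiable_comp dp db).
apply/funext => v.
have := congr1 (@^~ v) (diff_comp dp db).
rewrite /= (@diff_bilin _ _ _ _ (@GRing.scale R W : R^o -> W -> W))//=.
by rewrite diff_pair//= addrC.
Qed.

Lemma Ck_scale {V W : normedModType R} k (U : set V) (a : V -> R^o) (f : V -> W) :
  open U -> Ck k U a -> Ck k U f -> Ck k U (fun x => a x *: f x).
Proof.
move=> oU; elim: k a f => [|k IH] a f.
  move=> /= ca cf x Ux; apply: cvgZ; [exact: ca|exact: cf].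
move=> Ca Cf; have [da dda] := Ca; have [df ddf] := Cf.
split=> [x Ux|v]; first by have [] := is_diff_scale (da x Ux) (df x Ux).
apply: (@Ck_ext _ _ _ _ (fun x => 'd a x v *: f x + a x *: 'd f x v)) => //.
  move=> x Ux; have [_ dE] := is_diff_scale (da x Ux) (df x Ux).
  exact/esym/(congr1 (@^~ v) dE).
apply: Ck_add => //; apply: IH.
- exact: dda.
- exact: Ck_pred.
- exact: Ck_pred.
- exact: ddf.
Qed.

Lemma Ck_linear {V W X : normedModType R} k (U : set V) (l : {linear W -> X})
    (f : V -> W) :
  open U -> continuous l -> Ck k U f -> Ck k U (l \o f).
Proof.
move=> oU cl; elim: k f => [|k IH] f.
  by move=> cf x Ux; apply: continuous_comp; [exact: cf|exact: cl].
move=> [df ddf]; split=> [x Ux|v].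
  by apply: differentiable_comp; [exact: df|exact: linear_differentiable].
apply: Ck_ext (IH _ (ddf v)) => // x Ux /=.
rewrite (diff_comp (df x Ux) (linear_differentiable _ cl))/=.
by rewrite diff_lin.
Qed.

(** Finite dimension in the form that the chain rule needs. [Ck] controls x |-> Df(x) v for fixed v
    only, whereas D(g o f)(x) v = Dg(f x)(Df(x) v) has a moving direction; expanding Df(x) v in
    coordinates leaves scalar functions times derivatives of g in the fixed directions [e i]. *)
Definition coordinatized (V : normedModType R) : Prop :=
  exists N (e : 'I_N -> V) (l : 'I_N -> {linear V -> R^o}),
    (forall i, continuous (l i)) /\ forall v, v = \sum_i l i v *: e i.

Lemma Ck_comp {V W X : normedModType R} k (U : set V) (U' : set W)
    (g : W -> X) (f : V -> W) :
  coordinatized W -> open U -> (forall x, U x -> U' (f x)) ->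
  Ck k U f -> Ck k U' g -> Ck k U (g \o f).
Proof.
move=> [N [e [l [cl le]]]] oU fU; elim: k f g fU => [|k IH] f g fU.
  by move=> cf cg x Ux; apply: continuous_comp; [exact: cf|exact/cg/fU].
move=> Cf Cg; have [df ddf] := Cf; have [dg ddg] := Cg.
split=> [x Ux|v].
  by apply: differentiable_comp; [exact: df|exact/dg/fU].
apply: (@Ck_ext _ _ _ _
    (fun x => \sum_i (l i ('d f x v) : R^o) *: 'd g (f x) (e i))) => //.
  move=> x Ux; rewrite (diff_comp (df x Ux) (dg _ (fU _ Ux)))/=.
  rewrite [in RHS](le ('d f x v)) linear_sum/=; apply: eq_bigr => i _.
  by rewrite linearZ.
apply: Ck_sum => // i; apply: Ck_scale => //.
  exact: (@Ck_linear _ _ _ k U (l i) (fun x => 'd f x v) oU (cl i) (ddf v)).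
exact: (IH f (fun y => 'd g y (e i)) fU (Ck_pred Cf) (ddg _)).
Qed.

Lemma Ck_pair {V W X : normedModType R} k (U : set V) (f : V -> W) (g : V -> X) :
  open U -> Ck k U f -> Ck k U g -> Ck k U (fun x => (f x, g x)).
Proof.
move=> oU; elim: k f g => [|k IH] f g.
  by move=> /= cf cg x Ux; apply: cvg_pair; [exact: cf|exact: cg].
move=> [df ddf] [dg ddg]; split=> [x Ux|v].
  by apply: differentiable_pair; [exact: df|exact: dg].
apply: Ck_ext (IH _ _ (ddf v) (ddg v)) => // x Ux.
by rewrite (diff_pair (df x Ux) (dg x Ux)).
Qed.

Lemma coordinatized_scalar : coordinatized R^o.
Proof.
exists 1%N, (fun=> 1), (fun=> idfun); split=> [i x|v]; first exact: cvg_id.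
by rewrite big_ord1 /= [RHS]mulr1.
Qed.

Lemma coordinatized_rV d : coordinatized 'rV[R]_d.
Proof.
have lin (i : 'I_d) : linear (fun x : 'rV[R]_d => x 0 i : R^o).
  by move=> a u v; rewrite !mxE.
pose L i := GRing.isLinear.Build _ _ _ _ _ (lin i).
pose l i : {linear 'rV[R]_d -> R^o} := HB.pack (fun x : 'rV[R]_d => x 0 i : R^o) (L i).
exists d, (fun i => delta_mx 0 i), l; split=> [i|v]; first exact: coord_continuous.
exact: row_sum_delta.
Qed.

Lemma coordinatized_prod (V W : normedModType R) :
  coordinatized V -> coordinatized W -> coordinatized (V * W)%type.
Proof.
move=> [N [e [l [cl le]]]] [N' [e' [l' [cl' le']]]].
have linl i : linear (fun x : V * W => l i x.1 : R^o).
  by move=> a u v; rewrite /= linearP.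
have linr i : linear (fun x : V * W => l' i x.2 : R^o).
  by move=> a u v; rewrite /= linearP.
pose Ll i := GRing.isLinear.Build _ _ _ _ _ (linl i).
pose Lr i := GRing.isLinear.Build _ _ _ _ _ (linr i).
pose ll i : {linear (V * W)%type -> R^o} := HB.pack (fun x : V * W => l i x.1 : R^o) (Ll i).
pose lr i : {linear (V * W)%type -> R^o} := HB.pack (fun x : V * W => l' i x.2 : R^o) (Lr i).
exists (N + N')%N,
  (fun k : 'I_(N + N') => match fintype.split k return (V * W)%type with
            | inl i => (e i, 0) | inr j => (0, e' j) end),
  (fun k : 'I_(N + N') => match fintype.split k with inl i => ll i | inr j => lr j end); split.
  move=> k; case: (fintype.split k) => i x /=.
    by apply: (continuous_comp (f := fst)); [exact: cvg_fst|exact: cl].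
  by apply: (continuous_comp (f := snd)); [exact: cvg_snd|exact: cl'].
move=> [v w]; rewrite big_split_ord/=.
under eq_bigr do rewrite (unsplitK (inl _)).
under [X in _ = _ + X]eq_bigr do rewrite (unsplitK (inr _)).
rewrite {1}(le v) {1}(le' w) /=.
rewrite (_ : \sum_(i < N) _ = (\sum_i l i v *: e i, 0)); last first.
  elim/big_ind2 : _ => //= [x1 x2 y1 y2 -> ->|i _]; first by rewrite /GRing.add/= /add_pair/= addr0.
  by rewrite /GRing.scale/= /scale_pair/= scaler0.
rewrite (_ : \sum_(j < N') _ = (0, \sum_j l' j w *: e' j)); last first.
  elim/big_ind2 : _ => //= [x1 x2 y1 y2 -> ->|i _]; first by rewrite /GRing.add/= /add_pair/= addr0.
  by rewrite /GRing.scale/= /scale_pair/= scaler0.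
by rewrite /GRing.add/= /add_pair/= addr0 add0r.
Qed.

End Differentials.

(** * Riemannian length and distance *)

Section IntegralMeanValue.
Context {R : realType}.
Notation leb := (@lebesgue_measure R).

(** Compactness is used as a near covering whose parameter is the bound itself, tending to infinity.
    Neighbourhoods are relative to [K], so that [f] may be irregular outside it. *)
Lemma compact_locally_bounded {X : topologicalType} (K : set X) (f : X -> R) :
  compact K ->
  (forall x, K x -> exists B, \forall y \near x, K y -> f y <= B) ->
  exists B, forall x, K x -> f x <= B.
Proof.
move=> /compact_near_coveringP/near_covering_withinP cK lb.
have : \forall B \near (+oo : set_system R), K `<=` [set x | f x <= B].
  apply: (cK _ _ (fun B x => f x <= B)) => x Kx; have [B nB] := lb x Kx.
  exists ([set y | K y -> f y <= B], [set b | B <= b]) => /=.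
    by split => //; exists B; split=> [|y /ltW//]; rewrite num_real.
  by move=> [y b] /= [yB Bb] Ky; exact: le_trans (yB Ky) Bb.
by case/filter_ex => B KB; exists B.
Qed.

(** With F the primitive of [s], both K F + th and K F - th are nondecreasing because |th'| <= K s,
    and their values at 0 and 1 give the bound. Derivatives are taken at interior times, the end
    points being reached by continuity: a curve known on [0, 1] has no two-sided derivative
    there. *)
Lemma mean_value_integral (s th : R -> R) (K : R) :
  0 <= K -> leb.-integrable I01 (EFin \o s) ->
  {within I01, continuous th} ->
  (forall t, 0 < t < 1 -> [/\ {for t, continuous s}, derivable th t 1 &
     `|derive1 th t| <= K * s t]) ->
  `|th 1 - th 0| <= K * \int[leb]_(t in I01) s t.
Proof.
move=> K0 si cth hs.
pose F x := \int[leb]_(t in `[0, x]) s t.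
have F0 : F 0 = 0 by rewrite /F set_itv1 Rintegral_set1.
have F1 : F 1 = \int[leb]_(t in I01) s t by [].
have cF : {within `[0, 1], continuous F}.
  exact: (parameterized_integral_continuous ler01 si).
have dF t : 0 < t < 1 -> derivable F t 1 /\ derive1 F t = s t.
  move=> t01; have [cs _ _] := hs t t01; have /andP[t0 t1] := t01.
  exact: (@continuous_FTC1_closed _ s 0 t 1).
have mono (e : R) : `|e| <= 1 -> (K * F 0 + e * th 0) <= (K * F 1 + e * th 1).
  move=> e1; pose G := K *: F + e *: th.
  have dGE (t : R) : 0 < t < 1 -> is_derive t 1 G (K * s t + e * derive1 th t).
    move=> t01; have [_ dth _] := hs t t01; have [dFt FE] := dF t t01.
    have Fd : is_derive t 1 F (s t) by exact: (DeriveDef dFt (etrans (esym (derive1E F t)) FE)).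
    have thd : is_derive t 1 th (derive1 th t) by exact: (DeriveDef dth (esym (derive1E th t))).
    exact: (is_deriveD (is_deriveZ K Fd) (is_deriveZ e thd)).
  have dG t : t \in `]0, 1[%R -> derivable G t 1.
    by rewrite in_itv/= => /dGE[].
  have dG0 t : t \in `]0, 1[%R -> 0 <= derive1 G t.
    rewrite in_itv/= => t01; have [_ GE] := dGE t t01.
    have [_ _ b] := hs t t01; rewrite derive1E GE.
    rewrite -lerBlDr sub0r; apply: le_trans b.
    by rewrite (le_trans (ler_norm _))// normrN normrM ler_piMl.
  have cG : {within `[0, 1], continuous G}.
    move=> x; apply: continuousD; apply: continuousZl_tmp; [exact: cF|exact: cth].
  have := @ger0_derive1_le_cc _ G 0 1 dG dG0 cG 0 1.
  by rewrite !in_itv/= !lexx ler01 => /(_ isT isT isT).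
have := mono 1; have := mono (-1); rewrite normrN normr1 lexx => /(_ isT) h1 /(_ isT) h2.
rewrite -F1 ler_norml; move: h1 h2; rewrite F0; lra.
Qed.

(* The integral of a nonnegative function is a lower integral, hence monotone
   even when the functions are not measurable. *)
Lemma ge0_le_lower_integral d (T : measurableType d)
    (mu : {measure set T -> \bar R}) (D : set T) (f1 f2 : T -> \bar R) :
  (forall x, D x -> (0 <= f1 x)%E) -> (forall x, D x -> (f1 x <= f2 x)%E) ->
  (\int[mu]_(x in D) f1 x <= \int[mu]_(x in D) f2 x)%E.
Proof.
move=> f10 f12; rewrite !ge0_integralE//; last first.
  by move=> x Dx; exact: le_trans (f10 x Dx) (f12 x Dx).
apply: le_ereal_sup => _ [h /= hf1 <-]; exists h => // x.
exact: le_trans (hf1 x) (lee_restrict f12 x).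
Qed.

Lemma integral_I01_cst (C : R) : (\int[leb]_(t in I01) C%:E = C%:E)%E.
Proof.
rewrite integral_cst//=; last exact: measurable_itv.
by rewrite lebesgue_measure_itv/= lte_fin ltr01 sube0 mule1.
Qed.

Lemma Rintegral_I01_le (s : R -> R) (C : R) : 0 <= C ->
  (forall t, I01 t -> 0 <= s t <= C) ->
  \int[leb]_(t in I01) s t <= C.
Proof.
move=> C0 sC; rewrite /Rintegral -[leRHS]/(fine C%:E).
have le1 : (\int[leb]_(t in I01) (s t)%:E <= C%:E)%E.
  rewrite -[leRHS]integral_I01_cst.
  by apply: ge0_le_lower_integral => t It; rewrite lee_fin; case/andP: (sC t It).
have ge0 : (0 <= \int[leb]_(t in I01) (s t)%:E)%E.
  by apply: integral_ge0 => t It; rewrite lee_fin; case/andP: (sC t It).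
apply: fine_le => //; rewrite ge0_fin_numE//.
exact: le_lt_trans le1 (ltry _).
Qed.

Lemma I01_oo (t : R) : 0 < t < 1 -> I01 t.
Proof. by rewrite /I01/= in_itv/= => /andP[/ltW-> /ltW->]. Qed.

Lemma near_oo (t : R) : 0 < t < 1 -> \forall s \near t, 0 < (s : R) < 1.
Proof.
move=> t01; have := @interval_open R (BRight 0) (BLeft 1) isT isT.
rewrite openE => /(_ t); rewrite /= in_itv/= => /(_ t01).
by apply: filterS => s /=; rewrite in_itv.
Qed.

End IntegralMeanValue.

(** * Lengths of curves and functions with controlled differential *)

Section CurveLength.
Context {R : realType} {d : nat} {M : ptopologicalType}.
Variables (S : smooth_structure R d M) (g : riemannian_metric S).
Notation leb := (@lebesgue_measure R).

Lemma cvg_qform {T : Type} (F : set_system T) {FF : Filter F}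
    (G : T -> 'M[R]_d) (v w : T -> 'rV[R]_d) (G0 : 'M[R]_d) (v0 w0 : 'rV[R]_d) :
  G @ F --> G0 -> v @ F --> v0 -> w @ F --> w0 ->
  ((v x *m G x *m (w x)^T) 0 0 : R) @[x --> F] --> (v0 *m G0 *m w0^T) 0 0.
Proof.
have E (v1 w1 : 'rV[R]_d) (G1 : 'M[R]_d) : (v1 *m G1 *m w1^T) 0 0 =
    \sum_j (\sum_k v1 0 k * G1 k j) * w1 0 j.
  by rewrite mxE; apply: eq_bigr => j _; rewrite !mxE.
have ccoord m n (N : T -> 'M[R]_(m, n)) (N0 : 'M[R]_(m, n)) i j :
    N @ F --> N0 -> (N x i j : R) @[x --> F] --> N0 i j.
  move=> cN; apply: (cvg_comp N (fun A : 'M[R]_(m, n) => A i j : R) cN).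
  exact: coord_continuous.
move=> cG cv cw; rewrite E; under eq_fun do rewrite E.
apply: cvg_big => [|j _]; first exact: add_continuous.
apply: cvgM; last exact: ccoord.
apply: cvg_big => [|k _]; first exact: add_continuous.
by apply: cvgM; exact: ccoord.
Qed.

(** Outside [0, 1] the values of [u] are arbitrary, so [derive1 u] is meaningless at 0 and 1. The
    smooth local extension [u0] and its derivative [u1] replace them: both are continuous at [a],
    even at an end point, and agree with [u] and [derive1 u] at nearby interior times. *)
Lemma smooth_on_curve {V : normedModType R} (u : R -> V) a :
  smooth_on (I01 : set R^o) (u : R^o -> V) -> I01 a ->
  exists u0 u1 : R -> V, [/\ {for a, continuous u0}, {for a, continuous u1},
    u0 a = u a, \forall t \near a, I01 t -> u t = u0 t &
    \forall t \near a, 0 < (t : R) < 1 ->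
      [/\ differentiable (u : R^o -> V) t, u t = u0 t & derive1 u t = u1 t]].
Proof.
move=> su Ia; have [U [f [oU Ua Cf fu]]] := su a Ia.
exists f, (fun t => 'd (f : R^o -> V) t 1).
have nU : \forall t \near a, U t by exact: (open_nbhs_nbhs (conj oU Ua)).
split.
- by have := Cf 0%N; apply.
- by have [_ ddf] := Cf 1%N; have := ddf 1; apply.
- exact: fu.
- by apply: filterS nU => t Ut It; exact: esym (fu _ It Ut).
apply: filterS nU => t Ut t01.
have It : I01 t := I01_oo t01.
have [df _] := Cf 1%N; have dft := df t Ut.
have fnu : {near t, f =1 u}.
  have : \forall s \near t, U s by exact: (open_nbhs_nbhs (conj oU Ut)).
  move: (near_oo t01).
  apply: filterS2 => s s01 Us; apply: fu => //; exact: I01_oo.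
have dut := near_differentiable fnu dft.
split => //; first by rewrite fu.
exact: (etrans (derive1E' dut) (near_diff (1 : R) fnu dft)).
Qed.

Definition speed (c : chart R d M) (u : R -> 'rV[R]_d) (t : R) : R :=
  Num.sqrt ((derive1 u t *m gram g c (u t) *m (derive1 u t)^T) 0 0).

Lemma speed_ge0 c u t : 0 <= speed c u t.
Proof. exact: sqrtr_ge0. Qed.

Section Piece.
Variables (c : chart R d M) (u : R -> 'rV[R]_d).
Hypotheses (cS : atlas S c) (su : smooth_on (I01 : set R^o) (u : R^o -> 'rV[R]_d))
  (uc : forall t, I01 t -> ccod c (u t)).

Lemma speed_local a : I01 a -> exists w : R -> R, {for a, continuous w} /\
  \forall t \near a, 0 < (t : R) < 1 -> speed c u t = w t.
Proof.
move=> Ia; have [u0 [u1 [cu0 cu1 u0a _ near_u]]] := smooth_on_curve su Ia.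
exists (fun t => Num.sqrt ((u1 t *m gram g c (u0 t) *m (u1 t)^T) 0 0)); split.
  apply: (@continuous_comp _ _ _
    (fun t => (u1 t *m gram g c (u0 t) *m (u1 t)^T) 0 0) Num.sqrt).
    apply: cvg_qform => //.
    apply: (@continuous_comp _ _ _ u0 (gram g c)) => //.
    have := gram_smooth g cS 0%N; apply.
    by rewrite u0a; exact: uc.
  exact: sqrt_continuous.
by apply: filterS near_u => t H /H[_ ut u't]; rewrite /speed u't ut.
Qed.

Lemma speed_continuous t : 0 < t < 1 -> {for t, continuous (speed c u)}.
Proof.
move=> t01; have [w [cw sw]] := speed_local (I01_oo t01).
have E : {near t, w =1 speed c u}.
  by move: (near_oo t01); apply: filterS2 sw => s sw /sw ->.
rewrite /prop_for/continuous_at -(nbhs_singleton E).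
by apply: cvg_trans cw; exact: near_eq_cvg.
Qed.

Lemma speed_integrable : leb.-integrable I01 (EFin \o speed c u).
Proof.
have mI : measurable (I01 : set R) by exact: measurable_itv.
have [B HB] : exists B, forall t, I01 t -> (if 0 < t < 1 then speed c u t else 0) <= B.
  apply: compact_locally_bounded; first exact: segment_compact.
  move=> a Ia; have [w [cw sw]] := speed_local Ia.
  exists (`|w a| + 1).
  have : \forall t \near a, w t < `|w a| + 1.
    have wa : w a < `|w a| + 1 by rewrite (le_lt_trans (ler_norm _))// ltrDl.
    exact: (cvgr_lt _ cw _ wa).
  apply: filterS2 sw => t swt wB _; case: ifPn => [/swt->|_]; first exact: ltW.
  by rewrite addr_ge0.
apply: measurable_bounded_integrable => //.
- have E : leb (I01 : set R) = 1%E.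
    by rewrite /I01 lebesgue_measure_itv/= lte_fin ltr01 sube0.
  exact: (eq_ind_r (fun m => (m < +oo)%E) (ltry 1) E).
- have ms : measurable_fun (`]0, 1[%classic : set R) (speed c u).
    apply: open_continuous_measurable_fun; first exact: interval_open.
    by move=> t; rewrite inE/= in_itv/= => t01; exact: speed_continuous.
  exact: measurable_fun_itv_cc ms.
(* [B] bounds the speed at interior times. At 0 and 1 the speed is an uncontrolled number, which is
   simply added to the bound. *)
pose C := `|B| + speed c u 0 + speed c u 1.
exists C; split=> [|x Cx t It]; first exact: num_real.
rewrite /= ger0_norm ?speed_ge0//; apply: ltW; apply: le_lt_trans Cx; rewrite /C.
have := HB t It; case: ifPn => [_ h|t01 _].
  rewrite (le_trans h)// (le_trans (ler_norm _))// -addrA lerDl addr_ge0//; exact: speed_ge0.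
have := It; rewrite /I01/= in_itv/= => /andP[t0 t1].
have [->|t00] := eqVneq t 0.
  by rewrite -addrA addrCA lerDl addr_ge0// ?speed_ge0.
have [->|t11] := eqVneq t 1.
  by rewrite lerDr addr_ge0// ?speed_ge0.
by move: t01; rewrite !lt_neqAle t0 t1 eq_sym t00 t11.
Qed.

Lemma arc_length_ge0 : 0 <= arc_length g c u.
Proof. by apply: Rintegral_ge0 => t _; exact: speed_ge0. Qed.

End Piece.

(** Infinitesimal Lipschitz condition: the differential is bounded by K times the Riemannian norm.
    It is differentiability with a bound, and not C^1, because the mean value inequality integrates
    the speed rather than the derivative of [rho]. *)
Definition metric_lipschitz (rho : M -> R) (K : R) : Prop :=
  forall c x, atlas S c -> ccod c x ->
    differentiable (rho \o cinv c : 'rV[R]_d -> R^o) x /\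
    forall v, `|'d (rho \o cinv c : 'rV[R]_d -> R^o) x v| <=
      K * Num.sqrt ((v *m gram g c x *m v^T) 0 0).

Lemma metric_lipschitz_arc rho K c u : 0 <= K -> metric_lipschitz rho K ->
  atlas S c -> smooth_on (I01 : set R^o) (u : R^o -> 'rV[R]_d) ->
  (forall t, I01 t -> ccod c (u t)) ->
  `|rho (cinv c (u 1)) - rho (cinv c (u 0))| <= K * arc_length g c u.
Proof.
move=> K0 lrho cS su uc.
apply: (@mean_value_integral _ (speed c u) (fun t => rho (cinv c (u t)))) => //.
- exact: speed_integrable.
- apply/subspace_continuousP => a Ia.
  have [u0 [_ [cu0 _ u0a nu _]]] := smooth_on_curve su Ia.
  have [drho _] := lrho c (u a) cS (uc a Ia).
  have cr := differentiable_continuous drho.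
  have : (rho \o cinv c \o u0) t @[t --> within I01 (nbhs a)] --> rho (cinv c (u a)).
    apply: cvg_within_filter; rewrite -u0a in cr *.
    exact: continuous_comp cu0 cr.
  apply: cvg_trans; apply: near_eq_cvg.
  by apply: filterS nu => t h /h ut; rewrite /from_subspace /= ut.
move=> t t01; have It := I01_oo t01.
have [u0 [u1 [_ _ _ _ nu]]] := smooth_on_curve su It.
have [du _ _] := nbhs_singleton nu t01.
have [drho brho] := lrho c (u t) cS (uc t It).
have dc : differentiable ((rho \o cinv c) \o u : R^o -> R^o) t.
  exact: differentiable_comp.
split; first exact: speed_continuous.
  exact/derivable1_diffP.
have -> : derive1 (fun s => rho (cinv c (u s))) t =
    'd (rho \o cinv c : 'rV[R]_d -> R^o) (u t) (derive1 u t).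
  rewrite !derive1E'// [LHS](congr1 (@^~ 1) (diff_comp du drho)).
  by [].
exact: brho.
Qed.

Lemma metric_lipschitz_curve rho K p q L : 0 <= K -> metric_lipschitz rho K ->
  curve_length g p q L -> `|rho q - rho p| <= K * L.
Proof.
move=> K0 lrho; elim=> {p q L} [p|c u q L cS su uc _ IH].
  by rewrite subrr normr0 mulr0.
rewrite mulrDr [leRHS]addrC -(subrKA (rho (cinv c (u 1)))).
rewrite (le_trans (ler_normD _ _))// lerD//.
exact: metric_lipschitz_arc.
Qed.

Lemma curve_length_ge0 p q L : curve_length g p q L -> 0 <= L.
Proof.
elim=> {p q L} [//|c u q L cS su uc _ IH].
by rewrite addr_ge0// arc_length_ge0.
Qed.

Lemma curve_length_cat p q r L L' :
  curve_length g p q L -> curve_length g q r L' -> curve_length g p r (L + L').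
Proof.
elim=> {p q L} [p|c u q L cS su uc _ IH] h; first by rewrite add0r.
by rewrite -addrA; apply: CurveCons => //; exact: IH.
Qed.

End CurveLength.

(** * Bump functions on R^d *)

Section Bump.
Context {R : realType}.

(** Squaring removes the kink of the positive part, which yields a differentiable cut-off by
    elementary means; at 0 the difference quotient is at most |h|. *)
Lemma is_derive_sqr_pos (s : R) :
  is_derive s (1 : R) (fun s : R => Num.max 0 s ^+ 2) (2 * Num.max 0 s).
Proof.
have [s0|s0|->] := ltgtP s 0.
- rewrite mulr0.
  apply: (@near_eq_is_derive _ _ _ (cst 0)).
    have : \forall t \near s, t < 0 by exact: (cvgr_lt s (@cvg_id _ (nbhs s)) 0 s0).
    by apply: filterS => t t0; rewrite max_l ?ltW// expr0n.
- apply: (@near_eq_is_derive _ _ _ (fun t : R => t ^+ 2)).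
    have : \forall t \near s, 0 < t by exact: (cvgr_gt s (@cvg_id _ (nbhs s)) 0 s0).
    by apply: filterS => t t0; rewrite max_r ?ltW.
  apply: (is_derive_eq (@is_deriveX R R id 2 s 1 1 (is_derive_id s 1))).
  by rewrite expr1 /GRing.scale/= mulr1.
rewrite mulr0.
have L : h^-1 *: ((fun t : R => Num.max 0 t ^+ 2) (h *: (1:R) + 0) -
   (fun t : R => Num.max 0 t ^+ 2) 0) @[h --> 0^'] --> (0 : R).
  apply/cvgr0Pnorm_lt => e e0.
  exists e => // h; rewrite /= sub0r normrN => he h0.
  rewrite maxxx expr0n subr0 addr0 /GRing.scale/= mulr1.
  apply: le_lt_trans he; rewrite normrM normfV -ler_pdivlMl ?invr_gt0 ?normr_gt0//.
  rewrite invrK -expr2 ger0_norm ?sqr_ge0// -[leRHS]real_normK ?num_real//.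
  have [h1|h1] := leP h 0; first by rewrite expr0n sqr_ge0.
  by rewrite normr_id gtr0_norm.
by apply: DeriveDef; [apply/cvg_ex; exists 0; exact: L|exact/cvg_lim].
Qed.

End Bump.

Section BumpRV.
Context {R : realType} {d : nat}.
Implicit Types (x v : 'rV[R]_d).

Lemma normr_coord_le v i : `|v 0 i| <= `|v|.
Proof.
rewrite [leRHS](mx_normrE v); exact: (le_bigmax _ (fun ij => `|v ij.1 ij.2|) (0, i)).
Qed.

Lemma rV_norm_lt v (r : R) : 0 < r -> (forall i, `|v 0 i| < r) -> `|v| < r.
Proof.
move=> r0 vr; have [v0|/mx_norm_neq0[[i j] /= E]] := eqVneq (mx_norm v) 0.
  by rewrite /Num.norm/= v0.
by rewrite /Num.norm/= E (ord1 i).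
Qed.

Lemma is_diff_sum (V : normedModType R) n (f df : 'I_n -> V -> R^o) (z : V) :
  (forall i, is_diff z (f i) (df i)) ->
  is_diff z (fun y => \sum_i f i y : R^o) (fun w => \sum_i df i w).
Proof.
elim: n f df => [|n IH] f df H.
  have -> : (fun y => \sum_(i < 0) f i y) = cst 0.
    by apply/funext => y; rewrite big_ord0.
  have -> : (fun y => \sum_(i < 0) df i y) = 0.
    by apply/funext => y; rewrite big_ord0.
  exact: is_diff_cst.
have -> : (fun y => \sum_(i < n.+1) f i y) =
    f ord0 + (fun y => \sum_(i < n) f (lift ord0 i) y).
  by apply/funext => y; rewrite big_ord_recl.
have -> : (fun y => \sum_(i < n.+1) df i y) =
    df ord0 + (fun y => \sum_(i < n) df (lift ord0 i) y).
  by apply/funext => y; rewrite big_ord_recl.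
by apply: is_diffD; apply: IH.
Qed.

Lemma is_diff_coord x i :
  is_diff x (fun y => y 0 i : R^o) (fun w : 'rV[R]_d => w 0 i : R^o).
Proof.
have lin : linear (fun y : 'rV[R]_d => y 0 i : R^o) by move=> a u w; rewrite !mxE.
pose L := GRing.isLinear.Build _ _ _ _ _ lin.
pose l : {linear 'rV[R]_d -> R^o} := HB.pack (fun y : 'rV[R]_d => y 0 i : R^o) L.
have cl : continuous l by exact: coord_continuous.
apply: DiffDef; first exact: (linear_differentiable x cl).
exact: (diff_lin x cl).
Qed.

Lemma is_diff_sqr (V : normedModType R) (f df : V -> R) (z : V) :
  is_diff z f df ->
  is_diff z (fun y => f y ^+ 2 : R) (fun w => 2 * f z * df w).
Proof.
move=> fE; have -> : (fun y => f y ^+ 2) = f ^+ 2 by [].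
apply: (is_diff_eq (@is_diffX _ _ _ _ 1 _ fE)).
by apply/funext => w; rewrite expr1.
Qed.

(** The bump is the squared positive part of r^2 minus the squared Euclidean distance to [x0]. The
    norm of row vectors is the maximum norm, which is the smaller one: where it reaches r, so does
    the Euclidean norm, and the bump vanishes. *)
Lemma bump_rV (x0 : 'rV[R]_d) (r : R) : 0 < r ->
  exists (b : 'rV[R]_d -> R^o) (C : R), [/\ 0 <= C, 0 < b x0,
    forall x, r <= `|x - x0| -> b x = 0 &
    forall x, differentiable b x /\ forall v, `|'d b x v| <= C * `|v|].
Proof.
move=> r0.
pose h x : R^o := r ^+ 2 - \sum_i (x 0 i - x0 0 i) ^+ 2.
pose dh x v : R^o := - \sum_i (2 * (x 0 i - x0 0 i) * v 0 i).
have hE x : is_diff x h (dh x).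
  have s_diff : is_diff x (fun y => \sum_i (y 0 i - x0 0 i) ^+ 2 : R^o)
      (fun v => \sum_i (2 * (x 0 i - x0 0 i)) * v 0 i).
    apply: is_diff_sum => i.
    have c_diff : is_diff x (fun y => y 0 i - x0 0 i : R^o) (fun w => w 0 i : R^o).
      apply: (is_diff_eq
        (is_diffB (is_diff_coord x i) (is_diff_cst (x0 0 i : R^o) x))).
      by rewrite subr0.
    exact: is_diff_sqr.
  apply: (is_diff_eq (is_diffB (is_diff_cst (r ^+ 2 : R^o) x) s_diff)).
  by rewrite sub0r.
pose sq (s : R) : R := Num.max 0 s ^+ 2.
have bE x : is_diff x ((sq : R^o -> R^o) \o h) (fun v => 2 * Num.max 0 (h x) * dh x v).
  have [dsq sqE] : derivable sq (h x) 1 /\ 'D_1 sq (h x) = 2 * Num.max 0 (h x).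
    by have [] := is_derive_sqr_pos (h x).
  have dsq' : is_diff (h x) (sq : R^o -> R^o) (fun t => t * (2 * Num.max 0 (h x))).
    have dd := (derivable1_diffP sq (h x)).1 dsq.
    apply: DiffDef => //.
    by rewrite diff1E// derive1E sqE.
  apply: (is_diff_eq (is_diff_comp (hE x) dsq')).
  by apply/funext => v; rewrite /= mulrC.
have h_le x : h x <= r ^+ 2.
  by rewrite /h gerBl sumr_ge0// => i _; rewrite sqr_ge0.
have h_far x i : r <= `|x 0 i - x0 0 i| -> h x <= 0.
  move=> ri; rewrite /h subr_le0 (bigD1 i)//= -[leLHS]addr0 lerD//.
    by rewrite -[leRHS]real_normK ?num_real// lerXn2r// nnegrE ?ltW.
  by apply: sumr_ge0 => j _; rewrite sqr_ge0.
have C0 : 0 <= 2 * r *+ d by apply: mulrn_wge0; apply: mulr_ge0 => //; exact: ltW.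
have rr0 : 0 <= 2 * r ^+ 2 by rewrite mulr_ge0// sqr_ge0.
(* 2 r^2 bounds the derivative 2 max(0, h) of the square, and 2 r d bounds |dh v| / |v| where h > 0,
   since there each coordinate of x - x0 is below r. *)
exists ((sq : R^o -> R^o) \o h), (2 * r ^+ 2 * (2 * r *+ d)); split.
- exact: mulr_ge0.
- rewrite /= /sq /h big1 ?subr0; last by move=> i _; rewrite subrr expr0n.
  by rewrite max_r ?sqr_ge0// !exprn_gt0.
- move=> x rx; rewrite /= /sq max_l ?expr0n//.
  apply: contrapT => /negP; rewrite -ltNge => h0.
  suff : `|x - x0| < r by rewrite ltNge rx.
  apply: rV_norm_lt => // i; rewrite !mxE ltNge; apply/negP => /h_far.
  by rewrite leNgt h0.
move=> x; have [db dbE] := bE x; split=> // v; rewrite dbE.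
have [h0|h0] := leP (h x) 0.
  by rewrite mulr0 mul0r normr0 mulr_ge0// mulr_ge0.
rewrite normrM -[leRHS]mulrA ler_pM//.
  rewrite ger0_norm; last by apply: mulr_ge0 => //; exact: ltW.
  by apply: ler_wpM2l => //; exact: h_le.
rewrite /dh normrN (le_trans (ler_norm_sum _ _ _))//.
have -> : 2 * r *+ d * `|v| = \sum_(i < d) (2 * r * `|v|).
  by rewrite sumr_const card_ord mulrnAl.
apply: ler_sum => i _; rewrite normrM ler_pM ?normr_coord_le//.
rewrite normrM ger0_norm// ler_pM2l// leNgt; apply/negP => /ltW/h_far.
by rewrite leNgt h0.
Qed.

End BumpRV.

(** * Riemannian norms in charts, and bumps on the manifold *)

Section MetricBump.
Context {R : realType} {d : nat} {M : ptopologicalType}.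
Variables (S : smooth_structure R d M) (g : riemannian_metric S).

Lemma qformZ (G : 'M[R]_d) (a : R) (v : 'rV[R]_d) :
  ((a *: v) *m G *m (a *: v)^T) 0 0 = a ^+ 2 * (v *m G *m v^T) 0 0.
Proof.
by rewrite linearZ/= -!scalemxAl -scalemxAr !mxE/= mulrA -expr2.
Qed.

(** On the compact unit sphere the form at [x0] is positive, so near [x0] it lies between m and 1/m
    for all small m. The near covering has the pair (x, m) as parameter, with m tending to 0 from
    the right; homogeneity extends the bounds from the sphere to all vectors. *)
Lemma gram_bounds c x0 : atlas S c -> ccod c x0 ->
  exists m r : R, [/\ 0 < m, 0 < r & forall x, `|x - x0| < r -> ccod c x /\
    forall v : 'rV[R]_d, m * `|v| ^+ 2 <= (v *m gram g c x *m v^T) 0 0 <= m^-1 * `|v| ^+ 2].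
Proof.
move=> cS cx0; pose Sph := [set v : 'rV[R]_d | `|v| = 1].
have cSph : compact Sph.
  apply: bounded_closed_compact.
    by exists 1; split=> [|y y1 v /= ->]; [exact: num_real|exact: ltW].
  have -> : Sph = (fun v : 'rV[R]_d => `|v|) @^-1` [set 1] by [].
  apply: closed_comp; last exact: closed_eq.
  by move=> x _; exact: norm_continuous.
pose Q x (v : 'rV[R]_d) : R := (v *m gram g c x *m v^T) 0 0.
have cG : {for x0, continuous (gram g c)} by have := gram_smooth g cS 0%N; apply.
have : filter_prod (nbhs x0) (0 : R)^'+
    [set p | Sph `<=` [set v | p.2 <= Q p.1 v <= p.2^-1]].
  have /compact_near_coveringP cc := cSph.
  apply: (cc _ (filter_prod (nbhs x0) (0 : R)^'+)
    (fun (p : 'rV[R]_d * R) v => p.2 <= Q p.1 v <= p.2^-1) _) => v Sv.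
  have v0 : v != 0 by rewrite -normr_gt0 Sv.
  have q0 : 0 < Q x0 v by exact: gram_pos.
  have FF : Filter (filter_prod (nbhs v) (nbhs x0)).
    by apply: filter_prod_filter; exact: nbhs_filter.
  have cQ : Q p.2 p.1 @[p --> filter_prod (nbhs v) (nbhs x0)] --> Q x0 v.
    apply: cvg_qform.
    - apply: (cvg_comp snd (gram g c) _ cG); exact: cvg_snd.
    - exact: cvg_fst.
    - exact: cvg_fst.
  have [A [nA nB] AB] : filter_prod (nbhs v) (nbhs x0)
      [set p | Q x0 v / 2 < Q p.2 p.1 < Q x0 v + 1].
    have h1 : Q x0 v / 2 < Q x0 v by rewrite ltr_pdivrMr// mulr_natr mulr2n ltrDr.
    have h2 : Q x0 v < Q x0 v + 1 by rewrite ltrDl.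
    have n1 := @cvgr_gt _ _ _ FF _ _ cQ _ h1.
    have n2 := @cvgr_lt _ _ _ FF _ _ cQ _ h2.
    apply: (@filterS _ _ FF _ _ _ (@filterI _ _ FF _ _ n1 n2)).
    by move=> p [? ?]; apply/andP.
  have Qp : 0 < Q x0 v + 1 by rewrite addr_gt0.
  exists (A.1, [set p | A.2 p.1 /\ [/\ 0 < p.2, p.2 <= Q x0 v / 2 & p.2 <= (Q x0 v + 1)^-1]]).
    split=> //=; exists (A.2, [set e : R | [/\ 0 < e, e <= Q x0 v / 2 & e <= (Q x0 v + 1)^-1]]).
      split=> //=.
      have e1 : 0 < Q x0 v / 2 by rewrite divr_gt0.
      have e2 : 0 < (Q x0 v + 1)^-1 by rewrite invr_gt0.
      have := nbhs_right_gt (0 : R); have := nbhs_right_le e1; have := nbhs_right_le e2.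
      by apply: filterS3 => e.
    by move=> [x e] /= [].
  move=> [w [x e]] /= [Aw [Ax [e0 e1 e2]]].
  have /andP[h1 h2] : Q x0 v / 2 < Q x w < Q x0 v + 1 by apply: (AB (w, x)).
  rewrite (le_trans e1 (ltW h1))/= (le_trans (ltW h2))//.
  by rewrite -[leLHS]invrK lef_pV2// posrE invr_gt0.
move=> [[A B] /= [nA nB] AB].
have [m [Bm m0]] : exists m, B m /\ 0 < m.
  by apply: (@filter_ex _ (0 : R)^'+); apply: filterI => //; exact: nbhs_right_gt.
have : nbhs x0 (A `&` ccod c).
  by apply: filterI => //; apply: open_nbhs_nbhs; split=> //; exact: ccod_open.
move=> /nbhs_ballP[r /= r0 rA]; exists m, r; split=> // x xr.
have [Ax cx] : (A `&` ccod c) x by apply: rA; rewrite -ball_normE /= distrC.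
split=> // v; have [->|v0] := eqVneq v 0.
  by rewrite normr0 expr0n !mulr0 !mul0mx mxE lexx.
have nv : 0 < `|v| by rewrite normr_gt0.
have Sw : Sph (`|v|^-1 *: v) by rewrite /Sph/= normrZ normfV normr_id mulVf ?gt_eqF.
have := AB (x, m) (conj Ax Bm) _ Sw; rewrite /= /Q qformZ => /andP[h1 h2].
have vv : 0 < `|v| ^+ 2 by rewrite exprn_gt0.
move: h1 h2; rewrite exprVn ler_pdivlMl// mulrC => ->.
by rewrite ler_pdivrMl// [_ * m^-1]mulrC => ->.
Qed.

(** A coordinate bump extended by zero. In the chart [c] its differential is at most C |v|, and |v|
    is at most m^(-1/2) times the Riemannian norm, whence K = C / sqrt m; invariance of the metric
    under transition maps carries the bound to the other charts. *)
Lemma metric_lipschitz_bump (hM : hausdorff_space M) p (U : set M) : nbhs p U ->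
  exists (rho : M -> R) (K : R), [/\ 0 <= K, metric_lipschitz g rho K, 0 < rho p &
    forall q, rho q != 0 -> U q].
Proof.
move=> nU; have [c cS cp] := atlas_cover S p.
pose x0 := cmap c p; have cx0 : ccod c x0 by exact: cmap_cod.
have [m [r1 [m0 r10 gb]]] := gram_bounds cS cx0.
have : nbhs x0 (cinv c @^-1` U).
  by apply: (cinv_continuous cx0); rewrite /x0 cmapK.
move=> /nbhs_ballP[r2 /= r20 r2U].
pose r := Num.min r1 r2 / 2.
have r0 : 0 < r by rewrite divr_gt0// lt_min r10 r20.
have rr : r < Num.min r1 r2 by rewrite /r ltr_pdivrMr// mulr_natr mulr2n ltrDr lt_min r10 r20.
have [rr1 rr2] : r < r1 /\ r < r2 by move: rr; rewrite lt_min => /andP.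
have [b [C [C0 bx0 bfar bE]]] := bump_rV x0 r0.
pose rho q := if pselect (cdom c q) then b (cmap c q) else 0.
(* Compact in a Hausdorff space, hence closed: the zero extension vanishes on a whole neighbourhood
   of each point outside [Kc], in particular where the chart [c] ends. *)
pose Kc := cinv c @` [set x | `|x - x0| <= r].
have cod x : `|x - x0| <= r -> ccod c x.
  by move=> xr; have [] := gb x (le_lt_trans xr rr1).
have cKc : closed Kc.
  apply: compact_closed => //; apply: continuous_compact.
    apply: continuous_in_subspaceT => x; rewrite inE/= => xr.
    exact: cinv_continuous (cod _ xr).
  apply: bounded_closed_compact.
    exists (r + `|x0|); split=> [|y yr x /= xr]; first exact: num_real.
    apply: ltW; apply: le_lt_trans yr; rewrite -(subrK x0 x).
    by rewrite (le_trans (ler_normD _ _))// lerD2r.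
  have -> : [set x : 'rV[R]_d | `|x - x0| <= r] = closed_ball_ Num.norm x0 r.
    by apply/funext => x; apply/propext; rewrite /closed_ball_ /= distrC.
  exact: closed_closed_ball_.
have rho0 q : ~ Kc q -> rho q = 0.
  move=> nK; rewrite /rho; case: pselect => // cq; apply: bfar; rewrite leNgt.
  apply/negP => /ltW qr; apply: nK; exists (cmap c q) => //; exact: cmapK.
exists rho, (C / Num.sqrt m); split.
- by rewrite divr_ge0// sqrtr_ge0.
- move=> c1 x c1S c1x; set f := rho \o cinv c1.
  have [cq|ncq] := pselect (cdom c (cinv c1 x)).
    have ox : overlap c1 c x by [].
    have near_ov : \forall y \near x, cdom c (cinv c1 y).
      apply: (cinv_continuous c1x).
      by apply: open_nbhs_nbhs; split=> //; exact: cdom_open.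
    have fE : {near x, b \o transition c1 c =1 f}.
      apply: filterS near_ov => y cy /=; rewrite /f/= /rho.
      by case: pselect.
    have dt : differentiable (transition c1 c) x.
      by have [dt _] := atlas_compat c1S cS 1%N; exact: dt.
    have [db bb] := bE (transition c1 c x).
    have dbt := differentiable_comp dt db.
    have [df dfE] := near_differentiable_diff fE dbt.
    split; [exact: df|move=> v].
    have E : 'd (f : _ -> R^o) x v = 'd b (transition c1 c x) ('d (transition c1 c) x v).
      exact: etrans (congr1 (@^~ v) dfE) (congr1 (@^~ v) (diff_comp dt db)).
    rewrite [X in `|X|]E.
    have yc : ccod c (transition c1 c x) by exact: cmap_cod.
    have [yr|yr] := leP `|transition c1 c x - x0| r.
      rewrite (le_trans (bb _))// -mulrA ler_wpM2l//.
      rewrite (gram_compat g c1S cS ox).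
      have [_ gg] := gb _ (le_lt_trans yr rr1).
      have /andP[g1 _] := gg ('d (transition c1 c) x v).
      set w := 'd _ x v in g1 *.
      rewrite ler_pdivlMl ?sqrtr_gt0//.
      have <- : Num.sqrt (m * `|w| ^+ 2) = Num.sqrt m * `|w|.
        by rewrite sqrtrM ?ltW// sqrtr_sqr normr_id.
      exact: ler_wsqrtr g1.
    have b0 : {near transition c1 c x, cst 0 =1 b}.
      have cn : {for transition c1 c x, continuous (fun y : 'rV[R]_d => `|y - x0|)}.
        apply: continuous_comp; last exact: norm_continuous.
        have ci : {for transition c1 c x, continuous (fun y : 'rV[R]_d => y)}.
          exact: cvg_id.
        have cx : {for transition c1 c x, continuous (fun _ : 'rV[R]_d => x0)}.
          exact: (@cst_continuous _ _ x0).
        exact: continuousB ci cx.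
      have nr := @cvgr_gt _ _ _ (nbhs_filter _) _ _ cn _ yr.
      by apply: filterS nr => y yr'; rewrite bfar// ltW.
    rewrite (near_diff _ b0 (differentiable_cst _ _)) diff_cst normr0.
    by rewrite mulr_ge0 ?sqrtr_ge0// divr_ge0 ?sqrtr_ge0.
  have fE : {near x, cst 0 =1 f}.
    have : nbhs (cinv c1 x) (~` Kc).
      apply: open_nbhs_nbhs; split; first exact: closed_openC.
      by move=> [y yr yE]; apply: ncq; rewrite -yE; apply/cinv_dom/cod.
    move=> /(cinv_continuous c1x) nK.
    by apply: (@filterS _ _ (nbhs_filter x) _ _ _ nK) => y /= /rho0 <-.
  have [df dfE] := near_differentiable_diff fE (differentiable_cst (0 : R^o) x).
  split; [exact: df|move=> v].
  have E : 'd (f : _ -> R^o) x v = 0.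
    exact: etrans (congr1 (@^~ v) dfE) (congr1 (@^~ v) (diff_cst _ _)).
  rewrite [X in `|X|]E normr0.
  by rewrite mulr_ge0 ?sqrtr_ge0// divr_ge0 ?sqrtr_ge0.
- by rewrite /rho; case: pselect.
move=> q rq; have [[x xr <-]|/rho0 h] := pselect (Kc q); last by rewrite h eqxx in rq.
by apply: r2U; rewrite -ball_normE/= distrC; exact: le_lt_trans rr2.
Qed.

End MetricBump.

(** * The Riemannian distance and the topology of M *)

Section RiemannianDistance.
Context {R : realType} {d : nat} {M : ptopologicalType}.
Variables (S : smooth_structure R d M) (g : riemannian_metric S).
Hypothesis hM : closed_connected M.
Notation dist := (riemannian_distance g).

(** A straight segment stays in the coordinate ball by convexity, and its Riemannian speed is at
    most m^(-1/2) |y - x|. *)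
Lemma segment_curve c x0 : atlas S c -> ccod c x0 ->
  exists C r : R, [/\ 0 <= C, 0 < r & forall x y, `|x - x0| < r -> `|y - x0| < r ->
    exists2 L, curve_length g (cinv c x) (cinv c y) L & L <= C * `|y - x|].
Proof.
move=> cS cx0; have [m [r [m0 r0 gb]]] := gram_bounds g cS cx0.
exists (Num.sqrt m^-1), r; split=> //.
move=> x y xr yr; pose u (t : R) : 'rV[R]_d := x + t *: (y - x).
have u0 : u 0 = x by rewrite /u scale0r addr0.
have u1 : u 1 = y by rewrite /u scale1r subrKC.
have ur t : I01 t -> `|u t - x0| < r.
  rewrite /I01/= in_itv/= => /andP[t0 t1].
  have -> : u t - x0 = (1 - t) *: (x - x0) + t *: (y - x0).
    by apply/rowP => i; rewrite !mxE; ring.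
  rewrite (le_lt_trans (ler_normD _ _))// !normrZ (ger0_norm t0) ger0_norm ?subr_ge0//.
  pose B := Num.max `|x - x0| `|y - x0|.
  have : (1 - t) * `|x - x0| + t * `|y - x0| <= (1 - t) * B + t * B.
    by rewrite lerD// ler_wpM2l ?subr_ge0// le_max lexx ?orbT.
  move=> /le_lt_trans; apply; rewrite -mulrDl subrK mul1r.
  by rewrite /B gt_max xr.
have su : smooth_on (I01 : set R^o) (u : R^o -> 'rV[R]_d).
  move=> a Ia; exists setT, u; split=> //; first exact: openT.
  move=> k; apply: Ck_add; [exact: openT|exact: Ck_cst|].
  apply: Ck_scale; [exact: openT| |exact: Ck_cst].
  by apply: (@Ck_lin _ _ _ k setT idfun) => z; exact: cvg_id.
have du t : derive1 u t = y - x.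
  have uE : is_diff (t : R^o) (u : R^o -> 'rV[R]_d) (fun h => h *: (y - x)).
    apply: (is_diff_eq (is_diffD (is_diff_cst x (t : R^o)) (is_diff_scalel t (y - x)))).
    by rewrite add0r.
  have [du duE] := uE.
  exact: etrans (derive1E' du) (etrans (congr1 (@^~ (1 : R)) duE) (scale1r _)).
exists (arc_length g c u + 0).
  have := @CurveCons _ _ _ _ g c u (cinv c y) 0 cS su; rewrite u0 u1; apply.
  - by move=> t It; have [] := gb _ (ur t It).
  - exact: CurveNil.
rewrite addr0; apply: Rintegral_I01_le; first by rewrite mulr_ge0 ?sqrtr_ge0.
move=> t It; rewrite sqrtr_ge0 du /=.
have [_ gg] := gb _ (ur t It); have /andP[_ h] := gg (y - x).
have <- : Num.sqrt (m^-1 * `|y - x| ^+ 2) = Num.sqrt m^-1 * `|y - x|.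
  by rewrite sqrtrM ?invr_ge0 ?ltW// sqrtr_sqr normr_id.
exact: ler_wsqrtr h.
Qed.

(** The points reachable from [p] form an open and closed set, because coordinate balls are joined
    by segments. Without this the infimum defining the distance could be the default value of [inf]
    on the empty set. *)
Lemma curve_length_exists p q : exists L, curve_length g p q L.
Proof.
have [_ _ cM] := hM; pose A := [set q | exists L, curve_length g p q L].
have chain (a : M) : exists2 W, nbhs a W & forall b b', W b -> W b' ->
    exists L, curve_length g b b' L.
  have [c cS ca] := atlas_cover S a.
  have [C [r [_ r0 H]]] := segment_curve cS (cmap_cod ca).
  exists (cdom c `&` cmap c @^-1` [set x | `|x - cmap c a| < r]).
    apply: filterI; first by apply: open_nbhs_nbhs; split=> //; exact: cdom_open.
    apply: (cmap_continuous ca).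
    have := nbhsx_ballx (cmap c a) _ r0; apply: filterS => y.
    by rewrite -ball_normE /= distrC.
  move=> b b' [cb br] [cb' br'].
  by have [L HL _] := H _ _ br br'; exists L; rewrite -(cmapK cb) -(cmapK cb').
suff : A = setT by move=> AT; have : A q by rewrite AT.
apply: cM.
- by exists p; exists 0; exact: CurveNil.
- exists A; last by rewrite setTI.
  rewrite openE => a [L HL]; have [W nW HW] := chain a.
  have Wa := nbhs_singleton nW.
  apply: filterS nW => b Wb; have [L' HL'] := HW a b Wa Wb.
  by exists (L + L'); exact: curve_length_cat HL HL'.
exists A; last by rewrite setTI.
move=> a clA; have [W nW HW] := chain a.
have [b [[L HL] Wb]] := clA W nW.
have [L' HL'] := HW b a Wb (nbhs_singleton nW).
by exists (L + L'); exact: curve_length_cat HL HL'.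
Qed.

Lemma has_inf_curve p q : has_inf [set L | curve_length g p q L].
Proof.
split; first exact: curve_length_exists.
by exists 0 => L /curve_length_ge0.
Qed.

Lemma rdist_ge0 p q : 0 <= dist p q.
Proof.
apply: lb_le_inf; first exact: curve_length_exists.
by move=> L /curve_length_ge0.
Qed.

Lemma rdist_le p q L : curve_length g p q L -> dist p q <= L.
Proof. by move=> HL; apply: ge_inf => //; have [] := has_inf_curve p q. Qed.

Lemma rdist_refl p : dist p p = 0.
Proof.
by apply/eqP; rewrite eq_le rdist_ge0 andbT; apply: rdist_le; exact: CurveNil.
Qed.

Lemma rdist_triangle q p r : dist p r <= dist p q + dist q r.
Proof.
rewrite -lerBlDr; apply: lb_le_inf; first exact: curve_length_exists.
move=> L HL; rewrite lerBlDr -lerBlDl; apply: lb_le_inf.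
  exact: curve_length_exists.
move=> L' HL'; rewrite lerBlDl; apply: rdist_le; exact: curve_length_cat HL HL'.
Qed.

Lemma rdist_lipschitz rho K p q : 0 <= K -> metric_lipschitz g rho K ->
  `|rho q - rho p| <= K * dist p q.
Proof.
move=> K0 lrho; have [K00|Kn0] := eqVneq K 0.
  have [L HL] := curve_length_exists p q.
  have := metric_lipschitz_curve K0 lrho HL.
  by rewrite K00 !mul0r.
have Kp : 0 < K by rewrite lt_neqAle eq_sym Kn0.
rewrite -ler_pdivrMl//; apply: lb_le_inf; first exact: curve_length_exists.
by move=> L HL; rewrite ler_pdivrMl//; exact: metric_lipschitz_curve HL.
Qed.

(** Take a Lipschitz bump [rho] supported in [U]: a point where it exceeds half its value at [p] is
    far from all its zeros. Uniformity in the centre [a] near [p] is the form that the compactness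
    argument of [uniform_modulus] consumes. *)
Lemma rdist_ball_nbhs (p : M) U : nbhs p U -> exists2 e, 0 < e &
  \forall a \near p, forall b, dist a b < e -> U b.
Proof.
move=> nU; have [hMh _ _] := hM.
have [rho [K [K0 lrho rhop rhoU]]] := metric_lipschitz_bump g hMh nU.
exists (rho p / 2 / (K + 1)).
  by rewrite !divr_gt0// ltr_wpDl.
have crho : {for p, continuous rho}.
  have [c cS cp] := atlas_cover S p.
  have [dr _] := lrho c _ cS (cmap_cod cp).
  have cr := differentiable_continuous dr.
  have cc : {for p, continuous ((rho \o cinv c) \o cmap c)}.
    exact: continuous_comp (cmap_continuous cp) cr.
  have E : {near p, (rho \o cinv c) \o cmap c =1 rho}.
    have : \forall q \near p, cdom c q.
      by apply: open_nbhs_nbhs; split=> //; exact: cdom_open.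
    by apply: filterS => q cq; rewrite /= cmapK.
  rewrite /prop_for/continuous_at -(nbhs_singleton E).
  by apply: cvg_trans cc; exact: near_eq_cvg.
have nr : \forall a \near p, rho p / 2 < rho a.
  apply: (@cvgr_gt _ _ _ (nbhs_filter p) _ _ crho).
  by rewrite ltr_pdivrMr// mulr_natr mulr2n ltrDr.
apply: filterS nr => a ra b ab; apply: rhoU; apply/negP => /eqP rb0.
have := rdist_lipschitz a b K0 lrho; rewrite rb0 sub0r normrN gtr0_norm; last first.
  by apply: lt_trans ra; rewrite divr_gt0.
apply/negP; rewrite -ltNge; apply: lt_trans ra.
move: ab; rewrite ltr_pdivlMr ?ltr_wpDl// mulrDr mulr1; apply: le_lt_trans.
by rewrite mulrC lerDl rdist_ge0.
Qed.

Lemma rdist_nbhs_small (p : M) e : 0 < e -> exists2 W, nbhs p W &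
  forall a b, W a -> W b -> dist a b < e.
Proof.
move=> e0; have [c cS cp] := atlas_cover S p.
have [C [r [C0 r0 H]]] := segment_curve cS (cmap_cod cp).
pose s := Num.min r (e / 2 / (C + 1)).
have s0 : 0 < s by rewrite lt_min r0 !divr_gt0// ltr_wpDl.
exists (cdom c `&` cmap c @^-1` [set x | `|x - cmap c p| < s]).
  apply: filterI; first by apply: open_nbhs_nbhs; split=> //; exact: cdom_open.
  apply: (cmap_continuous cp).
  have := nbhsx_ballx (cmap c p) _ s0; apply: filterS => y.
  by rewrite -ball_normE /= distrC.
move=> a b [ca /=]; rewrite lt_min => /andP[ar ae] [cb /=].
rewrite lt_min => /andP[br be].
have [L HL Lle] := H _ _ ar br.
rewrite -(cmapK ca) -(cmapK cb); apply: le_lt_trans (rdist_le HL) _.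
apply: le_lt_trans Lle _.
have : `|cmap c b - cmap c a| < e / (C + 1).
  rewrite -(subrKA (cmap c p)) (le_lt_trans (ler_normD _ _))//.
  by rewrite [X in _ + X]distrC (splitr (e / (C + 1))) mulrAC ltrD.
rewrite ltr_pdivlMr ?ltr_wpDl//; apply: le_lt_trans.
by rewrite mulrC ler_wpM2l// lerDl.
Qed.

End RiemannianDistance.

(** * Uniform continuity of time-dependent maps *)

Section TimeDependentMaps.
Context {R : realType} {M : ptopologicalType}.

Definition time_continuous {T : topologicalType} (F : R -> M -> T) : Prop :=
  {within I01 `*` [set: M], continuous (fun z : R * M => F z.1 z.2)}.

Lemma time_continuousP {T : topologicalType} (F : R -> M -> T) :
  time_continuous F <-> forall t p, I01 t -> forall W, nbhs (F t p) W ->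
    exists A B, [/\ nbhs t A, nbhs p B &
      forall s q, I01 s -> A s -> B q -> W (F s q)].
Proof.
split=> [/subspace_continuousP cF t p It W nW|H].
  have [[A B] /= [nA nB] AB] := cF (t, p) (conj It I) W nW.
  by exists A, B; split=> // s q Is As Bq; exact: (AB (s, q) (conj As Bq) (conj Is I)).
apply/subspace_continuousP => -[t p] [/= It _] W nW.
have [A [B [nA nB AB]]] := H t p It W nW.
by exists (A, B) => //= -[s q] [/= As Bq] [/= Is _]; exact: AB.
Qed.

Lemma time_continuous_section {T : topologicalType} (F : R -> M -> T) t :
  time_continuous F -> I01 t -> continuous (F t).
Proof.
move=> /time_continuousP cF It p W nW; have [A [B [nA nB AB]]] := cF t p It W nW.
by apply: filterS nB => q Bq; exact: AB (nbhs_singleton nA) Bq.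
Qed.

Lemma time_continuous_static {T : topologicalType} (f : M -> T) :
  continuous f -> time_continuous (fun=> f).
Proof.
move=> cf; apply/time_continuousP => t p _ W nW.
by exists setT, (f @^-1` W); split=> //; [exact: filterT|exact: cf].
Qed.

Lemma time_continuous_comp {T : topologicalType} (F : R -> M -> T) (G : R -> M -> M) :
  time_continuous F -> time_continuous G -> time_continuous (fun t => F t \o G t).
Proof.
move=> /time_continuousP cF /time_continuousP cG.
apply/time_continuousP => t p It W nW.
have [A [B [nA nB AB]]] := cF t (G t p) It W nW.
have [A' [B' [nA' nB' AB']]] := cG t p It B nB.
exists (A `&` A'), B'; split=> //; first exact: filterI.
by move=> s q Is [As A's] B'q; apply: AB => //; exact: AB'.
Qed.

Lemma time_continuous_app {T U : topologicalType} (f : T -> U) (F : R -> M -> T) :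
  continuous f -> time_continuous F -> time_continuous (fun t => f \o F t).
Proof.
move=> cf cF z; exact: (continuous_comp (cF z) (cf _)).
Qed.

Lemma time_continuousD (F G : R -> M -> R) :
  time_continuous F -> time_continuous G -> time_continuous (fun t x => F t x + G t x).
Proof. by move=> cF cG z; apply: continuousD; [exact: cF|exact: cG]. Qed.

Lemma time_continuousM (F G : R -> M -> R) :
  time_continuous F -> time_continuous G -> time_continuous (fun t x => F t x * G t x).
Proof. by move=> cF cG z; apply: continuousM; [exact: cF|exact: cG]. Qed.

Lemma time_continuousN (F : R -> M -> R) :
  time_continuous F -> time_continuous (fun t x => - F t x).
Proof. by move=> cF z; apply: continuousN; exact: cF. Qed.

Lemma compact_I01M : compact [set: M] -> compact (I01 `*` [set: M] : set (R * M)).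
Proof. by move=> cM; apply: compact_setX => //; exact: segment_compact. Qed.

Lemma time_continuous_bounded (F : R -> M -> R) : compact [set: M] ->
  time_continuous F -> exists B, forall t x, I01 t -> `|F t x| <= B.
Proof.
move=> /compact_I01M cK /time_continuousP cF.
have [B HB] : exists B, forall z : R * M, (I01 `*` [set: M]) z -> `|F z.1 z.2| <= B.
  apply: (compact_locally_bounded cK) => -[t p] [/= It _].
  have [A [B [nA nB AB]]] := cF t p It _ (nbhsx_ballx (F t p) 1 ltr01).
  exists (`|F t p| + 1); exists (A, B) => //= -[s q] [/= As Bq] [/= Is _].
  have := AB s q Is As Bq; rewrite -ball_normE/= => h.
  rewrite -lerBlDl; apply: le_trans (ltW h); rewrite distrC; exact: lerB_dist.
by exists B => t x It; exact: (HB (t, x)).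
Qed.

Lemma uniform_limit_continuous (F : nat -> R -> M -> R) (G : R -> M -> R) :
  (forall i, time_continuous (F i)) ->
  uniformly_to (fun a b => `|a - b|) F G -> time_continuous G.
Proof.
move=> cF FG; apply/time_continuousP => t p It W /nbhs_ballP[e /= e0 eW].
have e3 : 0 < e / 3 by rewrite divr_gt0.
have [i Fi] := filter_ex (FG _ e3).
have /time_continuousP/(_ t p It _ (nbhsx_ballx (F i t p) _ e3)) := cF i.
move=> [A [B [nA nB AB]]]; exists A, B; split=> // s q Is As Bq; apply: eW.
have h1 := Fi t p It; have h2 := Fi s q Is.
have := AB s q Is As Bq; rewrite -!ball_normE/= => h3.
have -> : G t p - G s q =
    - (F i t p - G t p) + (F i t p - F i s q) + (F i s q - G s q) by ring.
rewrite (le_lt_trans (ler_normD _ _))// (le_lt_trans (lerD (ler_normD _ _) (lexx _)))//.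
rewrite normrN; have : e = e / 3 + e / 3 + e / 3 by field.
lra.
Qed.

End TimeDependentMaps.

(** * Uniform continuity for the Riemannian distance *)

Section Modulus.
Context {R : realType} {d : nat} {M : ptopologicalType}.
Variables (S : smooth_structure R d M) (g : riemannian_metric S).
Hypothesis hM : closed_connected M.
Notation dist := (riemannian_distance g).

Lemma uniform_modulus {T : topologicalType} (D : T -> T -> R) (F : R -> M -> T) e :
  (forall u : T, exists2 W, nbhs u W & forall v w, W v -> W w -> D v w < e) ->
  time_continuous F ->
  exists2 del, 0 < del & forall t s a b, I01 t -> I01 s ->
    `|t - s| < del -> dist a b < del -> D (F t a) (F s b) < e.
Proof.
move=> HD /time_continuousP cF; have [_ cM _] := hM.
pose P (del : R) (z : R * M) := forall s b, I01 s -> `|z.1 - s| < del ->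
  dist z.2 b < del -> D (F z.1 z.2) (F s b) < e.
have /compact_near_coveringP/near_covering_withinP cK := @compact_I01M R M cM.
have : \forall del \near (0 : R)^'+, (I01 `*` [set: M]) `<=` P del.
  apply: (cK _ (0 : R)^'+ P) => -[t p] [/= It _].
  have [W nW HW] := HD (F t p).
  have [A [B [nA nB AB]]] := cF t p It W nW.
  have [e1 e10 HB] := rdist_ball_nbhs g hM nB.
  move: nA => /nbhs_ballP[e2 /= e20 HA].
  have e22 : 0 < e2 / 2 by rewrite divr_gt0.
  exists ((ball t (e2 / 2)) `*` [set a | B a /\ forall b, dist a b < e1 -> B b],
          [set del | del <= e1 /\ del <= e2 / 2]) => /=.
    split.
      exists (ball t (e2 / 2), [set a | B a /\ forall b, dist a b < e1 -> B b]).
        by split=> /=; [exact: nbhsx_ballx|exact: filterI].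
      by move=> [].
    by apply: filterI; exact: nbhs_right_le.
  move=> [[t' a] del] /= [[tt' [Ba Bb]] [d1 d2]] [It' _] s b Is t's ab /=.
  apply: HW; apply: AB => //.
  - apply: HA; apply: le_ball tt'; by rewrite ler_pdivrMr// mulr_natr mulr2n lerDr ltW.
  - apply: HA; move: tt'; rewrite -!ball_normE /= => tt'.
    rewrite -(subrKA t') (le_lt_trans (ler_normD _ _))// (splitr e2) ltrD//.
    exact: lt_le_trans t's d2.
  - by apply: Bb; exact: lt_le_trans ab d1.
move=> H; have [del [del0 Hd]] : exists del, 0 < del /\ (I01 `*` [set: M]) `<=` P del.
  by apply: (@filter_ex _ (0 : R)^'+); apply: filterI => //; exact: nbhs_right_gt.
by exists del => // t s a b It Is; exact: (Hd (t, a)).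
Qed.

Lemma abs_small e (u : R) : 0 < e ->
  exists2 W, nbhs u W & forall v w, W v -> W w -> `|v - w| < e.
Proof.
move=> e0; have e2 : 0 < e / 2 by rewrite divr_gt0.
exists (ball u (e / 2)); first exact: nbhsx_ballx.
move=> v w; rewrite -!ball_normE /= => uv uw.
by rewrite -(subrKA u) (le_lt_trans (ler_normD _ _))// (splitr e) ltrD// distrC.
Qed.

Lemma modulus_map (G : R -> M -> M) e : time_continuous G -> 0 < e ->
  exists2 del, 0 < del & forall t s a b, I01 t -> I01 s ->
    `|t - s| < del -> dist a b < del -> dist (G t a) (G s b) < e.
Proof. by move=> cG e0; apply: uniform_modulus => // u; exact: rdist_nbhs_small. Qed.

Lemma modulus_fun (h : R -> M -> R) e : time_continuous h -> 0 < e ->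
  exists2 del, 0 < del & forall t s a b, I01 t -> I01 s ->
    `|t - s| < del -> dist a b < del -> `|h t a - h s b| < e.
Proof.
by move=> ch e0; apply: (uniform_modulus (D := fun a b => `|a - b|)) => // u;
  exact: abs_small.
Qed.

Lemma rdist_bounded : exists2 D, 0 <= D & forall a b, dist a b <= D.
Proof.
have [_ cM _] := hM; pose p : M := point.
have [B1 HB1] : exists B, forall x, [set: M] x -> dist p x <= B.
  apply: (compact_locally_bounded cM) => x _.
  have [W nW HW] := rdist_nbhs_small g hM x ltr01.
  have Wx := nbhs_singleton nW.
  exists (dist p x + 1); apply: filterS nW => y Wy _.
  by rewrite (le_trans (rdist_triangle g hM x _ _))// lerD2l ltW// HW.
have [B2 HB2] : exists B, forall x, [set: M] x -> dist x p <= B.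
  apply: (compact_locally_bounded cM) => x _.
  have [W nW HW] := rdist_nbhs_small g hM x ltr01.
  have Wx := nbhs_singleton nW.
  exists (1 + dist x p); apply: filterS nW => y Wy _.
  by rewrite (le_trans (rdist_triangle g hM x _ _))// lerD2r ltW// HW.
have Bdd a b : dist a b <= B2 + B1.
  by rewrite (le_trans (rdist_triangle g hM p _ _))// lerD// ?HB2 ?HB1.
by exists (B2 + B1) => //; exact: le_trans (rdist_ge0 g hM p p) (Bdd p p).
Qed.

Lemma rdist_eq0 p q : (forall e, 0 < e -> dist p q < e) -> p = q.
Proof.
move=> pq; have [hMh _ _] := hM; apply/esym/hMh => A B nA nB.
have [e e0 H] := rdist_ball_nbhs g hM nB.
by exists q; split; [exact: nbhs_singleton|exact: (nbhs_singleton H) _ (pq e e0)].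
Qed.

End Modulus.

(** * Norms of time-dependent functions *)

Section MeanNorm.
Context {R : realType} {M : ptopologicalType}.
Variable mu : {finite_measure set (g_sigma_algebraType (@open M)) -> \bar R}.
Hypotheses (cM : compact [set: M]) (mu_gt0 : (0 < mu setT)%E).

Definition sup_abs (f : M -> R) : R := sup (range (fun x => `|f x|)).

Lemma compact_continuous_bounded (f : M -> R) : continuous f ->
  exists B, forall x, `|f x| <= B.
Proof.
move=> cf; have [B HB] := @time_continuous_bounded R M (fun=> f) cM
  (time_continuous_static cf).
by exists B => x; apply: (HB 0); rewrite /I01/= in_itv/= lexx ler01.
Qed.

Lemma sup_abs_ge (f : M -> R) x : continuous f -> `|f x| <= sup_abs f.
Proof.
move=> /compact_continuous_bounded[B HB]; apply: ub_le_sup; last by exists x.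
by exists B => _ [y _ <-].
Qed.

Lemma sup_abs_le (f : M -> R) B : (forall x, `|f x| <= B) -> sup_abs f <= B.
Proof.
move=> HB; apply: ge_sup; first by exists `|f point|; exists point.
by move=> _ [y _ <-].
Qed.

(** For unbounded [f] the supremum is its default value 0, so [path_norm] always integrates a
    nonnegative function. *)
Lemma sup_abs_ge0 (f : M -> R) : 0 <= sup_abs f.
Proof.
have [[B HB]|nB] := pselect (exists B, forall x, `|f x| <= B).
  rewrite (le_trans (normr_ge0 (f point)))//; apply: ub_le_sup; last by exists point.
  by exists B => _ [y _ <-].
rewrite /sup_abs sup_out//; apply/not_andP; right => -[B HB]; apply: nB.
by exists B => x; apply: HB; exists x.
Qed.

Lemma continuous_borel (f : M -> R) : continuous f ->
  measurable_fun setT (f : g_sigma_algebraType (@open M) -> R).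
Proof.
move=> cf; apply: (measurability _ (RGenOpens.measurableE R)).
move=> _ [_ [a [b ->] <-]]; rewrite setTI; apply: sub_sigma_algebra.
apply: open_comp => //; exact: interval_open.
Qed.

Let cint (f : M -> R) : continuous f ->
  mu.-integrable setT (EFin \o (f : g_sigma_algebraType (@open M) -> R)).
Proof.
move=> cf; apply: measurable_bounded_integrable => //.
- by rewrite -ge0_fin_numE//; exact: fin_num_measure.
- exact: continuous_borel.
have [B HB] := compact_continuous_bounded cf.
by exists B; split=> [|y By x _]; [exact: num_real|exact: le_trans (HB x) (ltW By)].
Qed.

Let muT : 0 < fine (mu setT).
Proof.
apply: fine_gt0; rewrite mu_gt0/= -ge0_fin_numE//; exact: fin_num_measure.
Qed.

Lemma mean_le (f : M -> R) B : continuous f -> (forall x, f x <= B) -> mean mu f <= B.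
Proof.
move=> cf fB; rewrite /mean ler_pdivrMl// mulrC -Rintegral_cst//.
by apply: le_Rintegral => //; [exact: cint|exact: (cint (@cst_continuous _ _ B))].
Qed.

Lemma mean_ge (f : M -> R) B : continuous f -> (forall x, B <= f x) -> B <= mean mu f.
Proof.
move=> cf fB; rewrite /mean ler_pdivlMl// mulrC -Rintegral_cst//.
by apply: le_Rintegral => //; [exact: (cint (@cst_continuous _ _ B))|exact: cint].
Qed.

(** The mean lies between the infimum and the supremum, so |f x - mean| is at most the oscillation.
    Positivity of the total volume enters through these bounds on the mean. *)
Lemma sup_abs_le_norm_C0 (f : M -> R) : continuous f -> sup_abs f <= norm_C0 mu f.
Proof.
move=> cf; apply: sup_abs_le => x.
have lef y : f y <= sup (range f).
  apply: ub_le_sup; last by exists y.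
  by exists (sup_abs f) => _ [z _ <-]; exact: le_trans (ler_norm _) (sup_abs_ge z cf).
have gef y : inf (range f) <= f y.
  apply: ge_inf; last by exists y.
  exists (- sup_abs f) => _ [z _ <-].
  by have := sup_abs_ge z cf; rewrite ler_norml => /andP[].
have m1 := mean_le cf lef; have m2 := mean_ge cf gef.
have := ler_norm (mean mu f); have := ler_norm (- mean mu f).
rewrite normrN /norm_C0; have := lef x; have := gef x.
rewrite ler_norml; lra.
Qed.

(** The oscillation contributes 2 to the constant and the mean 1. *)
Lemma norm_C0_le (f : M -> R) : continuous f -> norm_C0 mu f <= 3 * sup_abs f.
Proof.
move=> cf; have Hf x := sup_abs_ge x cf.
have h1 : sup (range f) <= sup_abs f.
  apply: ge_sup; first by exists (f point); exists point.
  by move=> _ [y _ <-]; exact: le_trans (ler_norm _) (Hf y).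
have h2 : - sup_abs f <= inf (range f).
  apply: lb_le_inf; first by exists (f point); exists point.
  move=> _ [y _ <-]; have := Hf y; rewrite ler_norml; by case/andP.
have h3 : `|mean mu f| <= sup_abs f.
  rewrite ler_norml mean_le//; last by move=> x; exact: le_trans (ler_norm _) (Hf x).
  by rewrite mean_ge// => x; have := Hf x; rewrite ler_norml => /andP[].
rewrite /norm_C0; lra.
Qed.

Lemma norm_C0_ge0 (f : M -> R) : continuous f -> 0 <= norm_C0 mu f.
Proof. by move=> cf; exact: le_trans (sup_abs_ge0 f) (sup_abs_le_norm_C0 cf). Qed.

End MeanNorm.

(** * Simple paths of continuous functions *)

Section StronglyMeasurable.
Context {R : realType} {M : ptopologicalType}.
Notation leb := (@lebesgue_measure R).

(** The sets [A j] of a simple path may overlap, so times are sorted by their full pattern of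
    memberships; there are finitely many patterns, each on a measurable set. This makes arbitrary
    functionals of a simple path measurable, in particular its sup norm. *)
Lemma measurable_fun_pattern N (A : 'I_N -> set R) (Phi : {ffun 'I_N -> bool} -> R) :
  (forall j, measurable (A j)) ->
  measurable_fun setT (fun t : R => Phi [ffun j => t \in A j]).
Proof.
move=> mA; pose B (b : {ffun 'I_N -> bool}) : set R := [set t | [ffun j => t \in A j] = b].
have mB b : measurable (B b).
  have -> : B b = \bigcap_(j in [set: 'I_N]) (if b j then A j else ~` A j).
    apply/seteqP; split=> t /= H.
      move=> j _; have /ffunP/(_ j) : [ffun j => t \in A j] = b := H; rewrite ffunE => <-.
      by case: ifPn => [/set_mem//|/negP tA /mem_set].
    apply/ffunP => j; rewrite ffunE; have := H j I.
    by case: (b j) => [/mem_set//|tA]; apply/negbTE/negP => /set_mem.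
  apply: fin_bigcap_measurable; first exact: finite_finset.
  by move=> j _; case: (b j) => //; exact: measurableC.
have -> : (fun t : R => Phi [ffun j => t \in A j]) =
    (fun t => \sum_b Phi b * \1_(B b) t).
  apply/funext => t; rewrite (bigD1 [ffun j => t \in A j])//= big1 ?addr0.
    by rewrite indicE mem_set ?mulr1.
  move=> b /eqP nb; rewrite indicE memNset ?mulr0// => tb.
  exact: (nb (esym tb)).
apply: measurable_sum => b.
by apply: measurable_funM => //; exact: measurable_indic.
Qed.

Lemma simple_path_measurable (Psi : (M -> R) -> R) (s : R -> M -> R) :
  simple_path s -> measurable_fun setT (fun t => Psi (s t)).
Proof.
move=> [N [A [f [mA _ sE]]]].
have -> : (fun t => Psi (s t)) =
    (fun t => (fun b : {ffun 'I_N -> bool} => Psi (fun x => \sum_j (b j)%:R * f j x))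
      [ffun j => t \in A j]).
  apply/funext => t; congr Psi; apply/funext => x; rewrite sE.
  by apply: eq_bigr => j _; rewrite indicE ffunE.
exact: (measurable_fun_pattern
  (fun b : {ffun 'I_N -> bool} => Psi (fun x => \sum_j (b j)%:R * f j x))).
Qed.

Lemma simple_path_continuous (s : R -> M -> R) t : simple_path s -> continuous (s t).
Proof.
move=> [N [A [f [_ cf sE]]]]; have -> : s t = (fun x => \sum_j \1_(A j) t * f j x).
  by apply/funext => x; rewrite sE.
move=> x; apply: cvg_big => [|j _]; first exact: add_continuous.
by apply: cvgM; [exact: cvg_cst|exact: cf].
Qed.

Lemma simple_path0 : simple_path (fun (_ : R) (_ : M) => 0 : R).
Proof.
exists 0%N, (fun=> set0), (fun _ _ => 0); split=> // [j|t x].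
- exact: cst_continuous.
- by rewrite big_ord0.
Qed.

Lemma simple_pathD (s s' : R -> M -> R) : simple_path s -> simple_path s' ->
  simple_path (fun t x => s t x + s' t x).
Proof.
move=> [N [A [f [mA cf sE]]]] [N' [A' [f' [mA' cf' sE']]]].
exists (N + N')%N,
  (fun k => match fintype.split k with inl i => A i | inr i => A' i end),
  (fun k => match fintype.split k with inl i => f i | inr i => f' i end).
split=> [k|k|t x]; [by case: (fintype.split k)|by case: (fintype.split k)|].
rewrite sE sE' big_split_ord/=; congr (_ + _); apply: eq_bigr => i _.
  by rewrite (unsplitK (inl _)).
by rewrite (unsplitK (inr _)).
Qed.

Lemma simple_path_sum N (s : 'I_N -> R -> M -> R) : (forall i, simple_path (s i)) ->
  simple_path (fun t x => \sum_i s i t x).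
Proof.
elim: N s => [|N IH] s H.
  have -> : (fun t x => \sum_(i < 0) s i t x) = (fun _ _ => 0).
    by apply/funext => t; apply/funext => x; rewrite big_ord0.
  exact: simple_path0.
have -> : (fun t x => \sum_(i < N.+1) s i t x) =
    (fun t x => s ord0 t x + \sum_(i < N) s (lift ord0 i) t x).
  by apply/funext => t; apply/funext => x; rewrite big_ord_recl.
by apply: simple_pathD => //; exact: IH.
Qed.

Lemma simple_path_modify (E : set R) (a : M -> R) (psi : M -> M) s :
  measurable E -> continuous a -> continuous psi -> simple_path s ->
  simple_path (fun t x => \1_E t * (a x * s t (psi x))).
Proof.
move=> mE ca cpsi [N [A [f [mA cf sE]]]].
exists N, (fun j => E `&` A j), (fun j x => a x * f j (psi x)); split=> [j|j|t x].
- exact: measurableI.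
- by move=> x; apply: cvgM; [exact: ca|apply: (continuous_comp (cpsi x)); exact: cf].
rewrite sE !mulr_sumr; apply: eq_bigr => j _; rewrite indicI /=; ring.
Qed.

End StronglyMeasurable.

(** * The L^1(C^0) norm built on the sup norm *)

Section TamePaths.
Context {R : realType} {M : ptopologicalType}.
Hypothesis cM : compact [set: M].
Notation leb := (@lebesgue_measure R).

(** [L1_C0] without its integrability clause, which is tracked separately as finiteness of
    [path_norm]. *)
Definition tame (H : R -> M -> R) : Prop :=
  (forall t, I01 t -> continuous (H t)) /\ strongly_measurable H.

Lemma tameD (H F : R -> M -> R) : tame H -> tame F -> tame (fun t x => H t x + F t x).
Proof.
move=> [cH [s ss sH]] [cF [s' ss' sF]]; split.
  by move=> t It x; apply: continuousD; [exact: cH|exact: cF].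
exists (fun k t x => s k t x + s' k t x) => [k|t It e e0]; first exact: simple_pathD.
have e2 : 0 < e / 2 by rewrite divr_gt0.
have := sF t It _ e2; have := sH t It _ e2; apply: filterS2 => k h1 h2 x.
by rewrite opprD addrACA (le_lt_trans (ler_normD _ _))// (splitr e) ltrD.
Qed.

(** The sup norm is 1-Lipschitz for uniform distance in space, so t |-> |H_t| is a pointwise limit
    of measurable functions coming from simple paths. The triangle inequality for [path_norm] rests
    on this, lower integrals not being additive in general. *)
Lemma sup_abs_measurable (H : R -> M -> R) : tame H ->
  measurable_fun I01 (fun t => sup_abs (H t)).
Proof.
move=> [cH [s ss sH]].
apply: (@measurable_fun_cvg _ _ _ _ (fun k t => sup_abs (s k t))).
  by move=> k; apply: measurable_funS (simple_path_measurable (@sup_abs R M) (ss k)).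
move=> t It; apply/cvgrPdist_le => e e0.
apply: filterS (sH t It e e0) => k Hk.
have h1 : sup_abs (H t) <= sup_abs (s k t) + e.
  apply: sup_abs_le => x.
  have h := sup_abs_ge cM x (@simple_path_continuous _ _ _ t (ss k)); have := Hk x.
  rewrite distrC -[X in _ -> `|X| <= _](subrK (s k t x)) => h'.
  by rewrite (le_trans (ler_normD _ _))// addrC lerD// ltW.
have h2 : sup_abs (s k t) <= sup_abs (H t) + e.
  apply: sup_abs_le => x; have h := sup_abs_ge cM x (cH t It); have := Hk x.
  rewrite -[X in _ -> `|X| <= _](subrK (H t x)) => h'.
  by rewrite (le_trans (ler_normD _ _))// addrC lerD// ltW.
rewrite ler_norml; lra.
Qed.

(** The norm J of the overview. *)
Definition path_norm (H : R -> M -> R) : \bar R :=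
  (\int[leb]_(t in I01) (sup_abs (H t))%:E)%E.

Lemma path_norm_ge0 H : (0 <= path_norm H)%E.
Proof. by apply: integral_ge0 => t _; rewrite lee_fin sup_abs_ge0. Qed.

Lemma path_norm_le_cst H B : (forall t x, I01 t -> `|H t x| <= B) ->
  (path_norm H <= B%:E)%E.
Proof.
move=> HB; rewrite -integral_I01_cst; apply: ge0_le_lower_integral => t It.
  by rewrite lee_fin sup_abs_ge0.
by rewrite lee_fin; apply: sup_abs_le => x; exact: HB.
Qed.

Lemma path_normD H F : tame H -> tame F ->
  (path_norm (fun t x => H t x + F t x)%R <= path_norm H + path_norm F)%E.
Proof.
move=> tH tF; rewrite /path_norm -ge0_integralD//.
- apply: ge0_le_lower_integral => t It; first by rewrite lee_fin sup_abs_ge0.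
  rewrite -EFinD lee_fin; apply: sup_abs_le => x.
  rewrite (le_trans (ler_normD _ _))// lerD//; apply: sup_abs_ge => //.
    by case: tH => cH _; exact: cH.
  by case: tF => cF _; exact: cF.
- exact: measurable_itv.
- by move=> t _; rewrite lee_fin sup_abs_ge0.
- by apply/measurable_EFinP; exact: sup_abs_measurable.
- by move=> t _; rewrite lee_fin sup_abs_ge0.
- by apply/measurable_EFinP; exact: sup_abs_measurable.
Qed.

(** Since [y] may differ from [x], the estimate covers composition with a time-dependent map as well
    as multiplication by a bounded function. *)
Lemma path_norm_scale H F C : 0 <= C -> tame F ->
  (forall t, I01 t -> forall x, exists y, `|H t x| <= C * `|F t y|) ->
  (path_norm H <= C%:E * path_norm F)%E.
Proof.
move=> C0 tF HF; rewrite /path_norm -ge0_integralZl//.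
- apply: ge0_le_lower_integral => t It; first by rewrite lee_fin sup_abs_ge0.
  rewrite -EFinM lee_fin; apply: sup_abs_le => x.
  have [y /le_trans] := HF t It x; apply; apply: ler_wpM2l => //.
  by apply: sup_abs_ge => //; case: tF => cF _; exact: cF.
- exact: measurable_itv.
- by apply/measurable_EFinP; exact: sup_abs_measurable.
- by move=> t _; rewrite lee_fin sup_abs_ge0.
Qed.

Lemma path_norm_eq H F : (forall t, I01 t -> H t = F t) -> path_norm H = path_norm F.
Proof. by move=> HF; apply: eq_integral => t /set_mem It; rewrite HF. Qed.

Section Norm1oo.
Variable mu : {finite_measure set (g_sigma_algebraType (@open M)) -> \bar R}.
Hypothesis mu_gt0 : (0 < mu setT)%E.

Lemma path_norm_le_norm_1oo H : (forall t, I01 t -> continuous (H t)) ->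
  (path_norm H <= norm_1oo mu H)%E.
Proof.
move=> cH; apply: ge0_le_lower_integral => t It; rewrite lee_fin ?sup_abs_ge0//.
exact: sup_abs_le_norm_C0 (cH t It).
Qed.

Lemma norm_1oo_ge0 H : (forall t, I01 t -> continuous (H t)) -> (0 <= norm_1oo mu H)%E.
Proof.
by move=> cH; exact: le_trans (path_norm_ge0 H) (path_norm_le_norm_1oo cH).
Qed.

Lemma norm_1oo_le_path_norm H : tame H -> (norm_1oo mu H <= 3%:E * path_norm H)%E.
Proof.
move=> tH; have [cH _] := tH; rewrite /path_norm -ge0_integralZl//.
- apply: ge0_le_lower_integral => t It.
    by rewrite lee_fin; exact: norm_C0_ge0 (cH t It).
  by rewrite -EFinM lee_fin; exact: norm_C0_le (cH t It).
- exact: measurable_itv.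
- by apply/measurable_EFinP; exact: sup_abs_measurable.
- by move=> t _; rewrite lee_fin sup_abs_ge0.
Qed.

Lemma L1_C0P H : L1_C0 mu H <-> tame H /\ (path_norm H < +oo)%E.
Proof.
split=> [[cH sH H1]|[[cH sH] H1]].
  by split=> //; exact: le_lt_trans (path_norm_le_norm_1oo cH) H1.
split=> //; apply: le_lt_trans (norm_1oo_le_path_norm (conj cH sH)) _.
by rewrite lte_mul_pinfty.
Qed.

End Norm1oo.

End TamePaths.

(** * Products and compositions of measurable paths *)

Section TameComposition.
Context {R : realType} {d : nat} {M : ptopologicalType}.
Variables (S : smooth_structure R d M) (g : riemannian_metric S).
Hypothesis hM : closed_connected M.
Notation dist := (riemannian_distance g).

Let cM : compact [set: M]. Proof. by case: hM. Qed.

(* The simple approximations freeze [a] and [psi] at the left end of each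
   interval [[m / (k + 1), (m + 1) / (k + 1)[]. *)
Lemma tame_twist (F a : R -> M -> R) (psi : R -> M -> M) :
  tame F -> time_continuous a -> time_continuous psi ->
  tame (fun t x => a t x * F t (psi t x)).
Proof.
move=> [cF [s ss sF]] ca cpsi; split.
  move=> t It x; apply: cvgM; first exact: (time_continuous_section ca It).
  apply: continuous_comp; first exact: (time_continuous_section cpsi It).
  exact: cF.
have [B HB] := time_continuous_bounded cM ca.
have B0 : 0 <= B.
  by apply: le_trans (HB 0 point _); rewrite // /I01/= in_itv/= lexx ler01.
pose tm (k m : nat) : R := m%:R / k.+1%:R.
pose E k m : set R := `[tm k m, tm k m.+1[%classic.
have tmI k m : (m < k.+2)%N -> I01 (tm k m).
  move=> mk; rewrite /I01/= in_itv/= divr_ge0//= ler_pdivrMr// mul1r ler_nat.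
  by rewrite -ltnS.
(* There are k + 2 intervals because t = 1 belongs to the one that starts at 1; all left end points
   still lie in [0, 1]. *)
pose s' k t x := \sum_(m < k.+2) \1_(E k m) t * (a (tm k m) x * s k t (psi (tm k m) x)).
exists s' => [k|t It e e0].
  apply: simple_path_sum => m; apply: simple_path_modify.
  - exact: measurable_itv.
  - exact: time_continuous_section ca (tmI _ _ (ltn_ord m)).
  - exact: time_continuous_section cpsi (tmI _ _ (ltn_ord m)).
  - exact: ss.
have [BF HBF] : exists B, forall x, `|F t x| <= B.
  exact: compact_continuous_bounded (cF t It).
have BF0 : 0 <= BF by exact: le_trans (HBF point).
have e1 : 0 < e / 3 / (B + 1) by rewrite !divr_gt0// ltr_wpDl.
have e2 : 0 < e / 3 / (BF + 1) by rewrite !divr_gt0// ltr_wpDl.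
have [d1 d10 Hd1] := modulus_fun g hM ca e2.
have [d2 d20 Hd2] := modulus_fun g hM (time_continuous_static (cF t It)) e1.
have [d3 d30 Hd3] := modulus_map g hM cpsi d20.
have nk : \forall k \near \oo, k.+1%:R^-1 < Num.min d1 d3.
  have : Num.min d1 d3 > 0 by rewrite lt_min d10.
  by move=> m0; exact: (near_infty_natSinv_lt (PosNum m0)).
have := sF t It _ e1; apply: filterS2 nk => k; rewrite lt_min => /andP[kd1 kd3] Hs x.
have /andP[t0 t1] : 0 <= t <= 1 by move: It; rewrite /I01/= in_itv.
pose m := Num.truncn (t * k.+1%:R).
have tk0 : 0 <= t * k.+1%:R by rewrite mulr_ge0.
have /andP[mt tm1] := truncn_itv tk0.
have mk : (m < k.+2)%N.
  by rewrite ltnS -(@ler_nat R) (le_trans mt)// ler_piMl.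
have Em : E k m t by rewrite /E/= in_itv/= ler_pdivrMr// ltr_pdivlMr// mt.
have En n : n != m -> ~ E k n t.
  rewrite /E/= in_itv/= ler_pdivrMr// ltr_pdivlMr// => nm /andP[h1 h2].
  have h3 : (m < n.+1)%N by rewrite -(@ltr_nat R); exact: le_lt_trans mt h2.
  have h4 : (n < m.+1)%N by rewrite -(@ltr_nat R); exact: le_lt_trans h1 tm1.
  by move: nm; rewrite eqn_leq -ltnS h4 -ltnS h3.
have -> : s' k t x = a (tm k m) x * s k t (psi (tm k m) x).
  rewrite /s' (bigD1 (Ordinal mk))//= big1 ?addr0.
    by rewrite indicE mem_set ?mul1r.
  move=> i im; rewrite indicE memNset ?mul0r//; exact: En.
have ttm : `|tm k m - t| < k.+1%:R^-1.
  rewrite distrC ger0_norm; last by rewrite subr_ge0 ler_pdivrMr.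
  rewrite ltrBlDr addrC -[X in _ + X]mul1r -mulrDl ltr_pdivlMr//.
  by rewrite natr1.
have Im := tmI _ _ mk.
set y := psi (tm k m) x; set am := a (tm k m) x.
have r0 z : dist z z = 0 := rdist_refl g hM z.
have h1 : `|am| * `|s k t y - F t y| <= B * (e / 3 / (B + 1)).
  by rewrite ler_pM// ?HB// ltW.
have h2 : `|am - a t x| * `|F t y| <= (e / 3 / (BF + 1)) * BF.
  by rewrite ler_pM// ltW// Hd1// ?r0//; exact: lt_trans ttm kd1.
have h3 : `|a t x| * `|F t y - F t (psi t x)| <= B * (e / 3 / (B + 1)).
  rewrite ler_pM// ?HB// ltW// (Hd2 t t)// ?subrr ?normr0//.
  by apply: Hd3 => //; rewrite ?r0//; exact: lt_trans ttm kd3.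
have B1 : B * (e / 3 / (B + 1)) < e / 3.
  by rewrite mulrCA -[ltRHS]mulr1 ltr_pM2l ?divr_gt0// ltr_pdivrMr ?ltr_wpDl// mul1r ltrDl.
have B2 : (e / 3 / (BF + 1)) * BF < e / 3.
  by rewrite -mulrA -[ltRHS]mulr1 ltr_pM2l ?divr_gt0// mulrC ltr_pdivrMr ?ltr_wpDl// mul1r ltrDl.
have -> : am * s k t y - a t x * F t (psi t x) = am * (s k t y - F t y) +
   (am - a t x) * F t y + a t x * (F t y - F t (psi t x)) by ring.
rewrite (le_lt_trans (ler_normD _ _))// (le_lt_trans (lerD (ler_normD _ _) (lexx _)))//.
rewrite !normrM; have : e = e / 3 + e / 3 + e / 3 by field.
lra.
Qed.

Lemma tame_cst (c : R) : tame (fun _ (_ : M) => c).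
Proof.
split; first by move=> t _; exact: cst_continuous.
exists (fun _ _ _ => c) => [k|t It e e0]; last by apply: nearW => k x; rewrite subrr normr0.
exists 1%N, (fun=> setT), (fun _ _ => c); split=> // [j|t x].
- exact: cst_continuous.
- by rewrite big_ord1 indicE in_setT mul1r.
Qed.

(** [H] is the constant path 1 twisted by [H], so the freezing argument of [tame_twist] applies. *)
Lemma tame_continuous (H : R -> M -> R) : time_continuous H -> tame H.
Proof.
move=> cH; have := tame_twist (tame_cst 1) cH (time_continuous_static (fun x => @cvg_id _ _)).
by under [X in tame X]eq_fun do under eq_fun do rewrite mulr1.
Qed.

Lemma tameM (F a : R -> M -> R) : tame F -> time_continuous a ->
  tame (fun t x => a t x * F t x).
Proof.
by move=> tF ca; exact: tame_twist tF ca (time_continuous_static (fun x => @cvg_id _ _)).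
Qed.

Lemma tame_comp (F : R -> M -> R) (psi : R -> M -> M) : tame F -> time_continuous psi ->
  tame (fun t x => F t (psi t x)).
Proof.
move=> tF cpsi.
have := tame_twist tF (time_continuous_static (@cst_continuous _ _ (1 : R))) cpsi.
by under [X in tame X]eq_fun do under eq_fun do rewrite mul1r.
Qed.

Lemma tameN (F : R -> M -> R) : tame F -> tame (fun t x => - F t x).
Proof.
move=> tF; have := tameM tF (time_continuous_static (@cst_continuous _ _ (-1 : R))).
by under [X in tame X]eq_fun do under eq_fun do rewrite mulN1r.
Qed.

Lemma tameB (F G : R -> M -> R) : tame F -> tame G -> tame (fun t x => F t x - G t x).
Proof. by move=> tF tG; apply: tameD => //; exact: tameN. Qed.

End TameComposition.

(** * Positivity of the contact volume *)

Section PositiveVolume.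
Context {R : realType}.
Notation leb := (@lebesgue_measure R).

Lemma integral_rV_ge0 d (f : 'rV[R]_d -> \bar R) : (forall x, (0 <= f x)%E) ->
  (0 <= integral_rV f)%E.
Proof.
elim: d f => [|d IH] f f0 /=; first exact: f0.
by apply: integral_ge0 => t _; exact: IH.
Qed.

(** Each outer integral is bounded below on an interval of length 2r, of which only a factor r is
    kept. The nested integrals are compared as lower integrals. *)
Lemma integral_rV_box d (f : 'rV[R]_d -> \bar R) (x0 : 'rV[R]_d) (r e : R) :
  0 < r -> 0 <= e -> (forall x, (0 <= f x)%E) ->
  (forall x : 'rV[R]_d, (forall i, `|x 0 i - x0 0 i| < r) -> (e%:E <= f x)%E) ->
  ((e * r ^+ d)%:E <= integral_rV f)%E.
Proof.
move=> r0 e0; elim: d f x0 => [|d IH] f x0 f0 fe.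
  by rewrite expr0 mulr1 /=; apply: fe => -[].
pose A : set R := `]x0 0 ord0 - r, x0 0 ord0 + r[%classic.
have mA : measurable A by exact: measurable_itv.
have lebA : leb A = (r + r)%:E.
  rewrite /A lebesgue_measure_itv/= lte_fin ltrBlDr -addrA ltrDl addr_gt0//.
  by rewrite -EFinB; congr EFin; ring.
apply: (@le_trans _ _ (\int[leb]_(t in A) (e * r ^+ d)%:E)%E).
  rewrite integral_cst//= lebA -EFinM lee_fin exprSr mulrA ler_wpM2l//.
    by rewrite mulr_ge0// exprn_ge0// ltW.
  by rewrite lerDl ltW.
rewrite /= integral_mkcond; apply: ge0_le_lower_integral => t _.
  by apply: erestrict_ge0 => s _; rewrite lee_fin mulr_ge0// exprn_ge0// ltW.
rewrite /patch; case: ifPn => [/set_mem|_]; last exact: integral_rV_ge0.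
rewrite /A/= in_itv/= => /andP[t1 t2].
apply: (IH _ (rsubmx (x0 : 'rV[R]_(1 + d)))) => // x xx0; apply: fe => i.
case: (split_ordP (i : 'I_(1 + d))) => j ->.
  rewrite [X in `|X - _|](_ : _ = t); last first.
    by rewrite [LHS](row_mxEl (t%:M : 'M[R]_1) x) mxE (ord1 j) eqxx mulr1n.
  rewrite (_ : lshift d j = ord0); last by apply/val_inj; rewrite /= (ord1 j).
  by rewrite ltr_norml; lra.
rewrite [X in `|X - _|](_ : _ = x 0 j); last exact: (row_mxEr (t%:M : 'M[R]_1) x).
by have := xx0 j; rewrite mxE.
Qed.

Context {n : nat} {M : ptopologicalType}.
Variables (S : smooth_structure R n.*2.+1 M) (alpha : one_form S).

Lemma nu_coef_continuous c x : atlas S c -> ccod c x ->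
  {for x, continuous (nu_coef alpha c : 'rV[R]_(n.*2.+1) -> R)}.
Proof.
move=> cS cx; rewrite /prop_for /continuous_at.
have ccoord (F : 'rV[R]_(n.*2.+1) -> 'rV[R]_(n.*2.+1)) i :
    {for x, continuous F} -> (F y 0 i : R) @[y --> x] --> F x 0 i.
  move=> cF; apply: (cvg_comp F (fun A : 'rV[R]_(n.*2.+1) => A 0 i : R) cF).
  exact: coord_continuous.
have gen (F : set_system 'rV[R]_(n.*2.+1)) (FF : Filter F) :
    (forall i, (coef alpha c y 0 i : R) @[y --> F] --> coef alpha c x 0 i) ->
    (forall i j, d_coef alpha c y i j @[y --> F] --> d_coef alpha c x i j) ->
    nu_coef alpha c y @[y --> F] --> nu_coef alpha c x.
  move=> h0 h1; apply: cvgM; first exact: cvg_cst.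
  apply: cvg_big => [|s _]; first exact: add_continuous.
  apply: cvgM; first by apply: cvgM; [exact: cvg_cst|exact: h0].
  by apply: cvg_big => [|k _]; [exact: mul_continuous|exact: h1].
have c0 : {for x, continuous (coef alpha c)} by exact: (coef_smooth alpha cS 0%N).
have [_ c1] := coef_smooth alpha cS 1%N.
apply: (gen _ (nbhs_filter x)) => [i|i j]; first exact: ccoord.
have cij k l : {for x, continuous (fun y => 'd (coef alpha c) y (delta_mx 0 k) 0 l : R)}.
  apply: (ccoord (fun y => 'd (coef alpha c) y (delta_mx 0 k))); exact: (c1 _ x cx).
exact: continuousB (cij i j) (cij j i).
Qed.

(** By the contact condition the density is nonzero at one point; by continuity it stays above half
    its absolute value there on a coordinate box, whose volume is then positive. *)
Lemma volume_gt0 (mu : {finite_measure set (g_sigma_algebraType (@open M)) -> \bar R}) :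
  contact_form alpha -> volume_measure alpha mu -> (0 < mu setT)%E.
Proof.
move=> halpha hmu; have [c cS cp] := atlas_cover S point.
have mdom : measurable (cdom c : set (g_sigma_algebraType (@open M))).
  by apply: sub_sigma_algebra; exact: cdom_open.
apply: (@lt_le_trans _ _ (mu (cdom c))); last first.
  by apply: le_measure; rewrite ?inE//; exact: measurableT.
rewrite (hmu c cS _ mdom)//.
pose x0 := cmap c point; have cx0 : ccod c x0 by exact: cmap_cod.
have nu0 : 0 < `|nu_coef alpha c x0| by rewrite normr_gt0; exact: halpha.
have cnu := nu_coef_continuous cS cx0.
have cn : {for x0, continuous (fun x => `|nu_coef alpha c x| : R)}.
  by apply: (continuous_comp cnu); exact: norm_continuous.
have e0 : `|nu_coef alpha c x0| / 2 < `|nu_coef alpha c x0|.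
  by rewrite ltr_pdivrMr// mulr_natr mulr2n ltrDr.
have n1 := @cvgr_gt _ _ _ (nbhs_filter x0) _ _ cn _ e0.
have n2 : nbhs x0 (ccod c) by apply: open_nbhs_nbhs; split=> //; exact: ccod_open.
have /nbhs_ballP[r r0' Hr] := @filterI _ _ (nbhs_filter x0) _ _ n1 n2.
have r0 : 0 < r := r0'.
pose e := `|nu_coef alpha c x0| / 2.
have ee : 0 < e by rewrite divr_gt0.
apply: (@lt_le_trans _ _ (e * r ^+ n.*2.+1)%:E).
  by rewrite lte_fin mulr_gt0// exprn_gt0.
set f := (X in integral_rV X).
have f0 x : (0 <= f x)%E.
  by rewrite /f lee_fin; apply: mulr_ge0; [rewrite indicE ler0n|exact: normr_ge0].
apply: (@integral_rV_box n.*2.+1 f x0 r e r0 (ltW ee) f0) => x xr.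
have [h1 cx] : e < `|nu_coef alpha c x| /\ ccod c x.
  apply: Hr; rewrite -ball_normE /= distrC; apply: rV_norm_lt => // i.
  by rewrite !mxE.
rewrite lee_fin indicE mem_set ?mul1r ?ltW//.
by exists (cinv c x); [exact: cinv_dom|exact: cinvK].
Qed.

End PositiveVolume.

(** * Convergence of products and compositions *)

Section Convergence.
Context {R : realType} {d : nat} {M : ptopologicalType}.
Variables (S : smooth_structure R d M) (g : riemannian_metric S).
Hypothesis hM : closed_connected M.
Notation dist := (riemannian_distance g).
Notation udist := (fun a b : R => `|a - b|).

Let cM : compact [set: M]. Proof. by case: hM. Qed.

(** Convergence to 0 of nonnegative extended reals, written with upper bounds alone, so that it
    passes to smaller sequences and to sums without finiteness conditions. *)
Definition vanishing (u : nat -> \bar R) : Prop :=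
  forall e : R, 0 < e -> \forall i \near \oo, (u i <= e%:E)%E.

Lemma vanishing_cvg (u : nat -> \bar R) : (forall i, (0 <= u i)%E) ->
  vanishing u -> u @ \oo --> 0%E.
Proof.
move=> u0 vu; have fin i : (u i <= 1%:E)%E -> u i \is a fin_num.
  by move=> ui; rewrite ge0_fin_numE//; exact: le_lt_trans ui (ltry _).
apply/fine_cvgP; split; first by apply: filterS (vu 1 ltr01) => i; exact: fin.
apply/cvgr0Pnorm_le => e e0.
apply: filterS2 (vu e e0) (vu 1 ltr01) => i ui /fin ufin.
by rewrite /= ger0_norm ?fine_ge0// -lee_fin fineK.
Qed.

Lemma cvg_vanishing (u : nat -> \bar R) : u @ \oo --> 0%E -> vanishing u.
Proof.
move=> /fine_cvgP[fu /cvgr0Pnorm_le cu] e e0.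
apply: filterS2 fu (cu e e0) => i ui ue; rewrite -(fineK ui) lee_fin.
exact: le_trans (ler_norm _) ue.
Qed.

Lemma vanishing_le (u v : nat -> \bar R) : (forall i, (u i <= v i)%E) ->
  vanishing v -> vanishing u.
Proof. by move=> uv vv e e0; apply: filterS (vv e e0) => i; exact: le_trans. Qed.

Lemma vanishing_near (u v : nat -> \bar R) : (\forall i \near \oo, (u i <= v i)%E) ->
  vanishing v -> vanishing u.
Proof. by move=> uv vv e e0; apply: filterS2 uv (vv e e0) => i; exact: le_trans. Qed.

Lemma vanishingD (u v : nat -> \bar R) : vanishing u -> vanishing v ->
  vanishing (fun i => u i + v i)%E.
Proof.
move=> vu vv e e0; have e2 : 0 < e / 2 by rewrite divr_gt0.
apply: filterS2 (vu _ e2) (vv _ e2) => i ui vi.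
by rewrite (splitr e) EFinD leeD.
Qed.

Lemma vanishingZ (u : nat -> \bar R) (C : R) : 0 <= C -> (forall i, (0 <= u i)%E) ->
  vanishing u -> vanishing (fun i => C%:E * u i)%E.
Proof.
move=> C0 u0 vu e e0; have e2 : 0 < e / (C + 1) by rewrite divr_gt0// ltr_wpDl.
apply: filterS (vu _ e2) => i ui.
apply: (@le_trans _ _ (C%:E * (e / (C + 1))%:E)%E).
  by apply: lee_wpmul2l => //; rewrite lee_fin.
rewrite -EFinM lee_fin mulrCA -[leRHS]mulr1 (ler_wpM2l (ltW e0))//.
by rewrite ler_pdivrMr ?ltr_wpDl// mul1r lerDl.
Qed.

Lemma vanishing_exp (h : R -> M -> R) (hi : nat -> R -> M -> R) :
  time_continuous h -> uniformly_to udist hi h ->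
  uniformly_to udist (fun i t x => expR (hi i t x)) (fun t x => expR (h t x)).
Proof.
move=> ch hih e e0; have [B HB] := time_continuous_bounded cM ch.
have e1 : 0 < e / expR B by rewrite divr_gt0// expR_gt0.
have /cvgrPdist_lt/(_ _ e1) := @continuous_expR R 0.
rewrite expR0 => /nbhs_ballP[del /= del0 Hd].
apply: filterS (hih del del0) => i hi_del t x It.
have -> : expR (hi i t x) - expR (h t x) = expR (h t x) * (expR (hi i t x - h t x) - 1).
  by rewrite mulrBr mulr1 -expRD subrKC.
rewrite normrM gtr0_norm ?expR_gt0//.
have h1 : `|expR (hi i t x - h t x) - 1| < e / expR B.
  by rewrite distrC; apply: Hd; rewrite -ball_normE/= sub0r normrN; exact: hi_del.
have h2 : expR (h t x) <= expR B by rewrite ler_expR (le_trans (ler_norm _))// HB.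
apply: (@le_lt_trans _ _ (expR B * `|expR (hi i t x - h t x) - 1|)).
  by rewrite ler_wpM2r.
by rewrite mulrC -ltr_pdivlMr// expR_gt0.
Qed.

(** The intermediate term is F o psi_i: the uniform convergence of F_i handles one side, and the
    modulus of the limit F handles the other. *)
Lemma uniformly_to_comp {T : Type} (D : T -> T -> R) (F : R -> M -> T)
    (Fi : nat -> R -> M -> T) (psi : R -> M -> M) (psii : nat -> R -> M -> M) :
  (forall u v w, D u w <= D u v + D v w) ->
  (forall e, 0 < e -> exists2 del, 0 < del & forall t s a b, I01 t -> I01 s ->
    `|t - s| < del -> dist a b < del -> D (F t a) (F s b) < e) ->
  uniformly_to D Fi F -> uniformly_to dist psii psi ->
  uniformly_to D (fun i t => Fi i t \o psii i t) (fun t => F t \o psi t).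
Proof.
move=> Dtri mF FiF psiipsi e e0; have e2 : 0 < e / 2 by rewrite divr_gt0.
have [del del0 Hd] := mF _ e2.
apply: filterS2 (FiF _ e2) (psiipsi _ del0) => i h1 h2 t x It /=.
rewrite (le_lt_trans (Dtri _ (F t (psii i t x)) _))// (splitr e) ltrD//.
  exact: h1.
by apply: Hd => //; rewrite ?subrr ?normr0//; exact: h2.
Qed.

Lemma uniformly_to_comp_fun (F : R -> M -> R) (Fi : nat -> R -> M -> R)
    (psi : R -> M -> M) (psii : nat -> R -> M -> M) :
  time_continuous F -> uniformly_to udist Fi F -> uniformly_to dist psii psi ->
  uniformly_to udist (fun i t => Fi i t \o psii i t) (fun t => F t \o psi t).
Proof.
move=> cF; apply: uniformly_to_comp => [u v w|e e0]; first exact: ler_distD.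
exact: modulus_fun.
Qed.

Lemma uniformly_to_comp_map (F : R -> M -> M) (Fi : nat -> R -> M -> M)
    (psi : R -> M -> M) (psii : nat -> R -> M -> M) :
  time_continuous F -> uniformly_to dist Fi F -> uniformly_to dist psii psi ->
  uniformly_to dist (fun i t => Fi i t \o psii i t) (fun t => F t \o psi t).
Proof.
move=> cF; apply: uniformly_to_comp => [u v w|e e0]; first exact: rdist_triangle.
exact: modulus_map.
Qed.

Lemma uniformly_toD (F G : R -> M -> R) (Fi Gi : nat -> R -> M -> R) :
  uniformly_to udist Fi F -> uniformly_to udist Gi G ->
  uniformly_to udist (fun i t x => Fi i t x + Gi i t x) (fun t x => F t x + G t x).
Proof.
move=> FiF GiG e e0; have e2 : 0 < e / 2 by rewrite divr_gt0.
apply: filterS2 (FiF _ e2) (GiG _ e2) => i h1 h2 t x It.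
rewrite opprD addrACA (le_lt_trans (ler_normD _ _))// (splitr e) ltrD//.
  exact: h1.
exact: h2.
Qed.

Lemma uniformly_toN (F : R -> M -> R) (Fi : nat -> R -> M -> R) :
  uniformly_to udist Fi F -> uniformly_to udist (fun i t x => - Fi i t x) (fun t x => - F t x).
Proof.
move=> FiF e e0; apply: filterS (FiF _ e0) => i h t x It.
by rewrite -opprD normrN; exact: h.
Qed.

Lemma vanishing_mul (F a : R -> M -> R) (Fi ai : nat -> R -> M -> R) :
  tame F -> (path_norm F < +oo)%E -> time_continuous a ->
  (forall i, tame (Fi i)) -> (forall i, time_continuous (ai i)) ->
  uniformly_to udist ai a ->
  vanishing (fun i => path_norm (fun t x => F t x - Fi i t x)) ->
  vanishing (fun i => path_norm (fun t x => a t x * F t x - ai i t x * Fi i t x)).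
Proof.
move=> tF Foo ca tFi cai aia FiF; have [B HB] := time_continuous_bounded cM ca.
have B0 : 0 <= B.
  by apply: le_trans (HB 0 point _); rewrite // /I01/= in_itv/= lexx ler01.
have tFFi i : tame (fun t x => F t x - Fi i t x) by exact: (tameB g hM).
have caai i : time_continuous (fun t x => a t x - ai i t x).
  by apply: time_continuousD => //; exact: time_continuousN.
pose N := fine (path_norm F).
have NE : path_norm F = N%:E by rewrite fineK// ge0_fin_numE// path_norm_ge0.
have N0 : 0 <= N by rewrite -lee_fin -NE path_norm_ge0.
have v2 : vanishing (fun i => path_norm (fun t x => (a t x - ai i t x) * F t x)).
  move=> e e0; have e1 : 0 < e / (N + 1) by rewrite divr_gt0// ltr_wpDl.
  apply: filterS (aia _ e1) => i h.
  apply: (@le_trans _ _ ((e / (N + 1))%:E * path_norm F)%E).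
    apply: path_norm_scale => //; first exact: ltW.
    move=> t It x; exists x; rewrite normrM ler_wpM2r// distrC ltW//; exact: h.
  rewrite NE -EFinM lee_fin mulrAC -mulrA -[leRHS]mulr1 (ler_wpM2l (ltW e0))//.
  by rewrite ler_pdivrMr ?ltr_wpDl// mul1r lerDl.
apply: vanishing_near (vanishingD
  (vanishingZ (addr_ge0 B0 ler01) (fun i => path_norm_ge0 _) FiF) v2).
apply: filterS (aia _ ltr01) => i h.
rewrite (@path_norm_eq _ _ _ (fun t x => ai i t x * (F t x - Fi i t x) +
   (a t x - ai i t x) * F t x)); last first.
  by move=> t _; apply/funext => x; ring.
apply: le_trans (path_normD cM _ _) _.
- exact: (tameM g hM).
- exact: (tameM g hM).
apply: leeD => //; apply: path_norm_scale => //; first by rewrite addr_ge0.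
move=> t It x; exists x; rewrite normrM ler_wpM2r//.
rewrite -(subrK (a t x) (ai i t x)) addrC (le_trans (ler_normD _ _))// lerD ?HB//.
by apply: ltW; exact: h.
Qed.

(* [F] itself is not continuous in time, so it is first replaced by a fixed
   [Fi j], to which uniform continuity applies. *)
Lemma vanishing_comp (F : R -> M -> R) (Fi : nat -> R -> M -> R)
    (psi : R -> M -> M) (psii : nat -> R -> M -> M) :
  tame F -> (forall i, time_continuous (Fi i)) ->
  time_continuous psi -> (forall i, time_continuous (psii i)) ->
  uniformly_to dist psii psi ->
  vanishing (fun i => path_norm (fun t x => F t x - Fi i t x)) ->
  vanishing (fun i => path_norm (fun t x => F t (psi t x) - Fi i t (psii i t x))).
Proof.
move=> tF cFi cpsi cpsii psi_cvg FiF e e0.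
have tFi i := tame_continuous g hM (cFi i).
have tFFi i : tame (fun t x => F t x - Fi i t x) by exact: (tameB g hM).
have e4 : 0 < e / 4 by rewrite divr_gt0.
have [j Hj] := filter_ex (FiF _ e4).
have [del del0 Hd] := modulus_fun g hM (cFi j) e4.
apply: filterS2 (FiF _ e4) (psi_cvg _ del0) => i h1 h2.
rewrite (@path_norm_eq _ _ _ (fun t x => ((F t (psii i t x) - Fi i t (psii i t x)) +
   (F t (psi t x) - Fi j t (psi t x))) + (- (F t (psii i t x) - Fi j t (psii i t x)) +
   (Fi j t (psi t x) - Fi j t (psii i t x))))); last first.
  by move=> t _; apply/funext => x; ring.
have t1 := tame_comp g hM (tFFi i) (cpsii i).
have t2 := tame_comp g hM (tFFi j) cpsi.
have t3 := tameN g hM (tame_comp g hM (tFFi j) (cpsii i)).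
have t4 := tameB g hM (tame_comp g hM (tFi j) cpsi) (tame_comp g hM (tFi j) (cpsii i)).
apply: le_trans (path_normD cM (tameD t1 t2) (tameD t3 t4)) _.
have -> : (e%:E = (e / 4 + e / 4)%:E + (e / 4 + e / 4)%:E)%E.
  by rewrite -EFinD; congr EFin; field.
have le_comp k (H : R -> M -> R) (c : R -> M -> M) :
    (forall t x, `|H t x| = `|F t (c t x) - Fi k t (c t x)|) ->
    (path_norm (fun t x => F t x - Fi k t x)%R <= (e / 4)%:E)%E ->
    (path_norm H <= (e / 4)%:E)%E.
  move=> HE /(le_trans _); apply; rewrite -[leRHS]mul1e.
  by apply: path_norm_scale => // t It x; exists (c t x); rewrite mul1r HE.
apply: leeD.
  apply: le_trans (path_normD cM t1 t2) _; rewrite EFinD; apply: leeD.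
    by apply: (le_comp i _ (psii i)).
  by apply: (le_comp j _ psi).
apply: le_trans (path_normD cM t3 t4) _; rewrite EFinD; apply: leeD.
  by apply: (le_comp j _ (psii i)) => // t x; rewrite normrN.
apply: path_norm_le_cst => t x It; rewrite distrC ltW//.
by apply: Hd => //; rewrite ?subrr ?normr0//; exact: h2.
Qed.

End Convergence.

(** * Smooth contact systems *)

Section SmoothOn.
Context {R : realType}.

Lemma smooth_on_local {V W : normedModType R} (A : set V) (f : V -> W) :
  (forall a, A a -> exists2 U, nbhs a U & smooth_on (A `&` U) f) -> smooth_on A f.
Proof.
move=> H a Aa; have [U nU sU] := H a Aa.
have [U1 [g [oU1 U1a Cg gf]]] := sU a (conj Aa (nbhs_singleton nU)).
exists (U1 `&` U°), g; split.
- by apply: openI => //; exact: open_interior.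
- by split.
- by move=> k; apply: Ck_sub (Cg k) => x [].
- by move=> x Ax [U1x /interior_subset Ux]; apply: gf.
Qed.

Lemma smooth_on_ext {V W : normedModType R} (A : set V) (f f' : V -> W) :
  (forall x, A x -> f x = f' x) -> smooth_on A f -> smooth_on A f'.
Proof.
move=> ff' sf a Aa; have [U [g [oU Ua Cg gf]]] := sf a Aa.
by exists U, g; split=> // x Ax Ux; rewrite gf// ff'.
Qed.

Lemma smooth_on_sub {V W : normedModType R} (A B : set V) (f : V -> W) :
  A `<=` B -> smooth_on B f -> smooth_on A f.
Proof.
move=> AB sf a /AB Ba; have [U [g [oU Ua Cg gf]]] := sf a Ba.
by exists U, g; split=> // x /AB; exact: gf.
Qed.

Lemma Cinfty_smooth_on {V W : normedModType R} (A : set V) (f : V -> W) :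
  Cinfty setT f -> smooth_on A f.
Proof. by move=> Cf a _; exists setT, f; split=> //; exact: openT. Qed.

Lemma smooth_on_comp {V W X : normedModType R} (A : set V) (B : set W)
    (f : V -> W) (g : W -> X) : coordinatized W ->
  (forall x, A x -> B (f x)) -> smooth_on A f -> smooth_on B g ->
  smooth_on A (g \o f).
Proof.
move=> cW AB sf sg a Aa; have [U [f1 [oU Ua Cf f1f]]] := sf a Aa.
have [U' [g1 [oU' U'a Cg g1g]]] := sg (f a) (AB a Aa).
exists (U `&` f1 @^-1` U'), (g1 \o f1); split.
- rewrite openE => x [Ux U'x]; apply: filterI.
    exact: (open_nbhs_nbhs (conj oU Ux)).
  by apply: (Cf 0%N x Ux); exact: (open_nbhs_nbhs (conj oU' U'x)).
- by split=> //; rewrite /= f1f.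
- move=> k; apply: (Ck_comp (U' := U')) => //.
  + rewrite openE => x [Ux U'x]; apply: filterI.
      exact: (open_nbhs_nbhs (conj oU Ux)).
    by apply: (Cf 0%N x Ux); exact: (open_nbhs_nbhs (conj oU' U'x)).
  + by move=> x [].
  + by apply: Ck_sub (Cf k) => x [].
move=> x Ax [Ux U'x] /=; rewrite f1f//; apply: g1g; first exact: AB.
by rewrite -f1f.
Qed.

Lemma smooth_on_pair {V W X : normedModType R} (A : set V) (f : V -> W) (g : V -> X) :
  smooth_on A f -> smooth_on A g -> smooth_on A (fun x => (f x, g x)).
Proof.
move=> sf sg a Aa; have [U [f1 [oU Ua Cf f1f]]] := sf a Aa.
have [U' [g1 [oU' U'a Cg g1g]]] := sg a Aa.
exists (U `&` U'), (fun x => (f1 x, g1 x)); split.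
- exact: openI.
- by [].
- move=> k; apply: Ck_pair; first exact: openI.
    by apply: Ck_sub (Cf k) => x [].
  by apply: Ck_sub (Cg k) => x [].
- by move=> x Ax [Ux U'x]; rewrite f1f// g1g.
Qed.

Lemma smooth_onD {V W : normedModType R} (A : set V) (f g : V -> W) :
  smooth_on A f -> smooth_on A g -> smooth_on A (fun x => f x + g x).
Proof.
move=> sf sg a Aa; have [U [f1 [oU Ua Cf f1f]]] := sf a Aa.
have [U' [g1 [oU' U'a Cg g1g]]] := sg a Aa.
exists (U `&` U'), (fun x => f1 x + g1 x); split.
- exact: openI.
- by [].
- move=> k; apply: Ck_add; first exact: openI.
    by apply: Ck_sub (Cf k) => x [].
  by apply: Ck_sub (Cg k) => x [].
- by move=> x Ax [Ux U'x]; rewrite f1f// g1g.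
Qed.

Lemma smooth_on_scale {V W : normedModType R} (A : set V) (f : V -> R^o) (g : V -> W) :
  smooth_on A f -> smooth_on A g -> smooth_on A (fun x => f x *: g x).
Proof.
move=> sf sg a Aa; have [U [f1 [oU Ua Cf f1f]]] := sf a Aa.
have [U' [g1 [oU' U'a Cg g1g]]] := sg a Aa.
exists (U `&` U'), (fun x => f1 x *: g1 x); split.
- exact: openI.
- by [].
- move=> k; apply: Ck_scale; first exact: openI.
    by apply: Ck_sub (Cf k) => x [].
  by apply: Ck_sub (Cg k) => x [].
- by move=> x Ax [Ux U'x]; rewrite f1f// g1g.
Qed.

Lemma smooth_on_cst {V W : normedModType R} (A : set V) (w : W) :
  smooth_on A (fun=> w).
Proof. by apply: Cinfty_smooth_on => k; exact: Ck_cst. Qed.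

Lemma Cinfty_expR : Cinfty setT (@expR R : R^o -> R^o).
Proof.
have dexp (x : R) : is_diff (x : R^o) (@expR R : R^o -> R^o) (fun h => h * expR x).
  have dd := (derivable1_diffP (@expR R) x).1 (@derivable_expR R x).
  apply: DiffDef => //; rewrite diff1E//; apply/funext => h.
  by rewrite derive1E (congr1 (@^~ x) (@derive_expR R)).
elim=> [|k IH]; first by move=> x _; exact: continuous_expR.
split=> [x _|v]; first by have [] := dexp x.
have -> : (fun x : R^o => 'd (@expR R : R^o -> R^o) x v) = (fun x : R^o => v *: (expR x : R^o)).
  by apply/funext => x; have [_ ->] := dexp x.
by apply: Ck_scale; [exact: openT|exact: (@Ck_cst _ R^o R^o)|].
Qed.

Lemma smooth_on_fst {V W : normedModType R} (A : set (V * W)) :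
  smooth_on A (fun z : V * W => z.1).
Proof.
apply: Cinfty_smooth_on => k.
have lin : linear (fun z : V * W => z.1) by [].
pose L := GRing.isLinear.Build _ _ _ _ _ lin.
pose l : {linear (V * W)%type -> V} := HB.pack (fun z : V * W => z.1) L.
by apply: (@Ck_lin _ _ _ k setT l) => z; exact: cvg_fst.
Qed.

Lemma smooth_on_snd {V W : normedModType R} (A : set (V * W)) :
  smooth_on A (fun z : V * W => z.2).
Proof.
apply: Cinfty_smooth_on => k.
have lin : linear (fun z : V * W => z.2) by [].
pose L := GRing.isLinear.Build _ _ _ _ _ lin.
pose l : {linear (V * W)%type -> W} := HB.pack (fun z : V * W => z.2) L.
by apply: (@Ck_lin _ _ _ k setT l) => z; exact: cvg_snd.
Qed.

End SmoothOn.

(** * Smooth maps and functions in charts *)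

Section SmoothMaps.
Context {R : realType} {d : nat} {M : ptopologicalType}.
Variable S : smooth_structure R d M.

Lemma smooth_function_continuous (H : R -> M -> R) : smooth_function S H -> time_continuous H.
Proof.
move=> sH; apply/time_continuousP => t p It W nW; have [c cS cp] := atlas_cover S p.
have Htp : [set z : R^o * 'rV[R]_d | I01 z.1 /\ ccod c z.2] (t, cmap c p).
  by split=> //; exact: cmap_cod.
have [U [f [oU Ua Cf fH]]] := sH c cS _ Htp.
have fE : f (t, cmap c p) = H t p by rewrite fH//= cmapK.
have nU : nbhs (t : R^o, cmap c p) (f @^-1` W `&` U).
  apply: filterI; last exact: (open_nbhs_nbhs (conj oU Ua)).
  by apply: (Cf 0%N _ Ua); rewrite fE.
have [[A B] /= [nA nB] AB] := nU.
exists A, (cdom c `&` cmap c @^-1` B); split=> //.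
  apply: filterI; first by apply: open_nbhs_nbhs; split=> //; exact: cdom_open.
  exact: (cmap_continuous cp).
move=> s q Is As [cq Bq]; have [Wf Us] := AB (s, cmap c q) (conj As Bq).
have := fH (s, cmap c q); rewrite /= cmapK// => <- //.
by split=> //; exact: cmap_cod.
Qed.

Lemma smooth_map_continuous (F : R -> M -> M) : smooth_map S F -> time_continuous F.
Proof. by case. Qed.

(** The implication on the time lets this be a full neighbourhood in R x R^d: at the times 0 and 1
    nothing is known of [F] on the outer side. *)
Lemma near_chart_domain (F : R -> M -> M) (c c' : chart R d M) t x :
  time_continuous F -> I01 t -> ccod c x -> cdom c' (F t (cinv c x)) ->
  nbhs ((t : R^o), x) [set z : R^o * 'rV[R]_d | I01 z.1 ->
    ccod c z.2 /\ cdom c' (F z.1 (cinv c z.2))].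
Proof.
move=> /time_continuousP cF It cx c'x.
have nc' : nbhs (F t (cinv c x)) (cdom c').
  by apply: open_nbhs_nbhs; split=> //; exact: cdom_open.
have [A [B [nA nB AB]]] := cF t _ It _ nc'.
exists (A, ccod c `&` cinv c @^-1` B).
  split=> //=; apply: filterI; last exact: (cinv_continuous cx).
  by apply: open_nbhs_nbhs; split=> //; exact: ccod_open.
by move=> [s y] [/= As [cy By]] Is; split=> //; exact: AB.
Qed.

Let coordRV : coordinatized (R^o * 'rV[R]_d)%type.
Proof. by apply: coordinatized_prod; [exact: coordinatized_scalar|exact: coordinatized_rV]. Qed.

(** Reads F o G through an intermediate chart [c']. A general target [X] serves both the composition
    of two maps, where [F] is already followed by a chart, and that of a function with a map. *)
Lemma smooth_on_chart_comp {X : normedModType R} (G : R -> M -> M) (F : R -> M -> X)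
    (c c' : chart R d M) (B : set (R^o * 'rV[R]_d)) :
  smooth_map S G -> atlas S c -> atlas S c' ->
  smooth_on B (fun z => F z.1 (cinv c' z.2)) ->
  smooth_on [set z : R^o * 'rV[R]_d | [/\ I01 z.1, ccod c z.2,
      cdom c' (G z.1 (cinv c z.2)) & B (z.1, cmap c' (G z.1 (cinv c z.2)))]]
    (fun z => F z.1 (G z.1 (cinv c z.2))).
Proof.
move=> [_ sG] cS c'S sF; set A := [set z | _].
pose f (z : R^o * 'rV[R]_d) : R^o * 'rV[R]_d := (z.1, cmap c' (G z.1 (cinv c z.2))).
have sf : smooth_on A f.
  apply: smooth_on_pair; first exact: smooth_on_fst.
  by apply: smooth_on_sub (sG c c' cS c'S) => z [].
have AB z : A z -> B (f z) by move=> [].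
apply: smooth_on_ext (smooth_on_comp coordRV AB sf sF) => z [Iz cz c'z _] /=.
by rewrite cmapK.
Qed.

Lemma smooth_map_comp (F G : R -> M -> M) : smooth_map S F -> smooth_map S G ->
  smooth_map S (fun t => F t \o G t).
Proof.
move=> sF sG; have cF := smooth_map_continuous sF; have cG := smooth_map_continuous sG.
split; first exact: time_continuous_comp cF cG.
move=> c c' cS c'S; apply: smooth_on_local => -[t x] [/= It cx c'x].
have [c1 c1S c1x] := atlas_cover S (G t (cinv c x)).
exists [set z : R^o * 'rV[R]_d | I01 z.1 -> ccod c z.2 /\ cdom c1 (G z.1 (cinv c z.2))].
  exact: near_chart_domain.
have sF1 := sF.2 c1 c' c1S c'S.
apply: smooth_on_sub (smooth_on_chart_comp (F := fun t q => cmap c' (F t q)) sG cS c1S sF1).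
move=> [s y] [[/= Is cy c'y] /(_ Is)[_ c1y]]; split=> //; split=> //=.
  exact: cmap_cod.
by rewrite cmapK.
Qed.

Lemma smooth_function_comp (H : R -> M -> R) (G : R -> M -> M) :
  smooth_function S H -> smooth_map S G -> smooth_function S (fun t => H t \o G t).
Proof.
move=> sH sG; have cG := smooth_map_continuous sG.
move=> c cS; apply: smooth_on_local => -[t x] [/= It cx].
have [c1 c1S c1x] := atlas_cover S (G t (cinv c x)).
exists [set z : R^o * 'rV[R]_d | I01 z.1 -> ccod c z.2 /\ cdom c1 (G z.1 (cinv c z.2))].
  exact: near_chart_domain.
have sH1 := sH c1 c1S.
apply: smooth_on_sub (smooth_on_chart_comp (F := fun t q => H t q : R^o) sG cS c1S sH1).
move=> [s y] [[/= Is cy] /(_ Is)[_ c1y]]; split=> //; split=> //=.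
exact: cmap_cod.
Qed.

Lemma smooth_functionD (H F : R -> M -> R) : smooth_function S H -> smooth_function S F ->
  smooth_function S (fun t x => H t x + F t x).
Proof. by move=> sH sF c cS; apply: smooth_onD; [exact: sH|exact: sF]. Qed.

Lemma smooth_functionM (H F : R -> M -> R) : smooth_function S H -> smooth_function S F ->
  smooth_function S (fun t x => H t x * F t x).
Proof. by move=> sH sF c cS; apply: smooth_on_scale; [exact: sH|exact: sF]. Qed.

Lemma smooth_function_cst (a : R) : smooth_function S (fun _ _ => a).
Proof. by move=> c cS; exact: smooth_on_cst. Qed.

Lemma smooth_functionN (H : R -> M -> R) : smooth_function S H ->
  smooth_function S (fun t x => - H t x).
Proof.
move=> sH; have := smooth_functionM (smooth_function_cst (-1)) sH.
by under [X in smooth_function _ X]eq_fun do under eq_fun do rewrite mulN1r.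
Qed.

Lemma smooth_function_exp (H : R -> M -> R) : smooth_function S H ->
  smooth_function S (fun t x => expR (H t x)).
Proof.
move=> sH c cS.
have sexp : smooth_on setT (@expR R : R^o -> R^o) by apply: Cinfty_smooth_on; exact: Cinfty_expR.
exact: (smooth_on_comp coordinatized_scalar (fun _ _ => I) (sH c cS) sexp).
Qed.

Lemma smooth_map_id : smooth_map S (fun=> id).
Proof.
split; first exact: (time_continuous_static (fun x => @cvg_id _ _)).
move=> c c' cS c'S; set A := [set z | _].
have so : smooth_on (overlap c c') (transition c c').
  move=> x ox; exists (overlap c c'), (transition c c'); split=> //.
    rewrite openE => y [cy c'y]; apply: filterI.
      by apply: open_nbhs_nbhs; split=> //; exact: ccod_open.
    apply: (cinv_continuous cy); apply: open_nbhs_nbhs; split=> //; exact: cdom_open.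
  exact: (atlas_compat cS c'S).
have AB (z : R^o * 'rV[R]_d) : A z -> overlap c c' z.2 by move=> [].
have sn : smooth_on A (fun z : R^o * 'rV[R]_d => z.2) by exact: smooth_on_snd.
exact: smooth_on_ext (fun z _ => erefl) (smooth_on_comp (coordinatized_rV d) AB sn so).
Qed.

End SmoothMaps.

(** * One-sided velocities of curves on [0, 1] *)

Section Velocity.
Context {R : realType}.

(** A step of at most 1/2, to the right if t <= 1/2 and to the left otherwise, remains in [0, 1].
    Properness makes velocities unique, also at the end points. *)
Lemma within_I01_proper (t : R) : I01 t -> ProperFilter (within I01 t^').
Proof.
rewrite /I01/= in_itv/= => /andP[t0 t1].
apply: Build_ProperFilter_ex => P; rewrite /within/= => /nbhs_ballP[e /= e0 HP].
pose del := Num.min (e / 2) 2^-1.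
have del0 : 0 < del by rewrite lt_min divr_gt0//=.
have del2 : del <= 2^-1 by rewrite /del ge_min lexx orbT.
have dele : del < e.
  by rewrite gt_min ltr_pdivrMr// mulr_natr mulr2n ltrDr e0.
have h2 : (2 : R)^-1 + 2^-1 = 1 by field.
have [t2|t2] := leP t 2^-1.
  exists (t + del); apply: HP.
  - by rewrite -ball_normE/= opprD addNKr normrN gtr0_norm.
  - by rewrite -subr_eq0 addrAC subrr add0r gt_eqF.
  - rewrite /I01/= in_itv/=; apply/andP; split; lra.
exists (t - del); apply: HP.
- by rewrite -ball_normE/= opprB addrC subrK gtr0_norm.
- by rewrite -subr_eq0 addrAC subrr add0r oppr_eq0 gt_eqF.
- rewrite /I01/= in_itv/=; apply/andP; split; lra.
Qed.

Lemma near_within_punctured (t : R) (P : set R) :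
  (\forall s \near t, I01 s -> P s) -> within I01 t^' P.
Proof. by move=> nP; apply: filterS nP => s + _ Is; exact. Qed.

Section OneCurve.
Context {V : normedModType R}.
Implicit Types (u : R -> V) (t : R) (v : V).

Lemma has_velocity_unique u t v v' : I01 t ->
  has_velocity u t v -> has_velocity u t v' -> v = v'.
Proof.
move=> It; have FF := within_I01_proper It.
exact: (@cvg_unique V (@norm_hausdorff R V) _ _).
Qed.

Lemma has_velocity_near u u' t v : I01 t -> (\forall s \near t, I01 s -> u s = u' s) ->
  has_velocity u t v -> has_velocity u' t v.
Proof.
move=> It uu'; have FF := within_I01_proper It.
apply: cvg_trans; apply: near_eq_cvg; apply: near_within_punctured.
have ut := nbhs_singleton uu' It.
by apply: filterS uu' => s us Is; rewrite (us Is) ut.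
Qed.

Lemma has_velocity_cst (w : V) t : I01 t -> has_velocity (fun=> w) t 0.
Proof.
move=> It; have FF := within_I01_proper It.
rewrite /has_velocity; under eq_fun do rewrite subrr scaler0.
exact: cvg_cst.
Qed.

Lemma has_velocity_cvg u t v : I01 t -> has_velocity u t v ->
  u s @[s --> within I01 t^'] --> u t.
Proof.
move=> It uv; have FF := within_I01_proper It.
have ids : s @[s --> within I01 t^'] --> t.
  by move=> W nW; apply: near_within_punctured; apply: filterS nW.
have h : (s - t) *: ((s - t)^-1 *: (u s - u t)) + u t @[s --> within I01 t^'] -->
    (t - t) *: v + u t.
  apply: cvgD; last exact: cvg_cst.
  by apply: cvgZ => //; apply: cvgB => //; exact: cvg_cst.
rewrite subrr scale0r add0r in h; apply: cvg_trans h; apply: near_eq_cvg.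
have : t^' [set s | s != t] by exact: withinT.
apply: filterS => s st _; rewrite scalerA divff ?scale1r ?subrK//.
by rewrite subr_eq0.
Qed.

End OneCurve.

(** Time becomes a coordinate, so that the velocity of s |-> f (s, u s) falls under the plain chain
    rule. *)
Lemma has_velocity_time {V : normedModType R} (u : R -> V) t v : I01 t ->
  has_velocity u t v ->
  has_velocity (fun s => (s, u s) : R^o * V) t (1, v).
Proof.
move=> It uv; have FF := within_I01_proper It.
have h1 : (s - t)^-1 * (s - t) @[s --> within I01 t^'] --> (1 : R).
  have c1 : (fun=> 1 : R) @ within I01 t^' --> (1 : R) by exact: cvg_cst.
  apply: cvg_trans c1; apply: near_eq_cvg.
  have : t^' [set s | s != t] by exact: withinT.
  by apply: filterS => s st _; rewrite mulVf// subr_eq0.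
exact: (cvg_pair h1 uv).
Qed.

(** The remainder of [f] is o(|u s - u t|) and the difference quotient of [u] is eventually below
    |v| + 1, so the remainder divided by s - t tends to 0 along the one-sided filter. *)
Lemma has_velocity_comp {V W : normedModType R} (u : R -> V) (f : V -> W) t v :
  I01 t -> differentiable f (u t) -> has_velocity u t v ->
  has_velocity (f \o u) t ('d f (u t) v).
Proof.
move=> It df uv; have FF := within_I01_proper It.
have cu := has_velocity_cvg It uv.
have cd : 'd f (u t) ((s - t)^-1 *: (u s - u t)) @[s --> within I01 t^'] -->
    'd f (u t) v.
  apply: (cvg_comp (fun s => (s - t)^-1 *: (u s - u t)) ('d f (u t)) uv).
  exact: diff_continuous.
apply/cvgrPdist_lt => e e0.
pose K := `|v| + 1; have K0 : 0 < K by rewrite ltr_wpDl.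
have eK : 0 < e / 2 / K by rewrite !divr_gt0.
have e2 : 0 < e / 2 by rewrite divr_gt0.
have /eqaddoP/(_ _ eK) := diff_locally df => no.
have n1 : \forall s \near within I01 t^',
    `|f (u s) - (f (u t) + 'd f (u t) (u s - u t))| <= e / 2 / K * `|u s - u t|.
  have c0 : u s - u t @[s --> within I01 t^'] --> (0 : V).
    by rewrite -(subrr (u t)); apply: cvgB => //; exact: cvg_cst.
  apply: (@filterS _ (within I01 t^') _ _ _ _ (c0 _ no)) => s /=.
  by rewrite !fctE /= subrK.
have n2 : \forall s \near within I01 t^', `|(s - t)^-1 *: (u s - u t)| < K.
  have cn : `|(s - t)^-1 *: (u s - u t)| @[s --> within I01 t^'] --> `|v|.
    exact: cvg_norm.
  by apply: (@cvgr_lt _ _ _ _ _ _ cn); rewrite ltrDl.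
have /cvgrPdist_lt/(_ _ e2) n3 := cd.
near=> s; rewrite /= -(subrKA ('d f (u t) ((s - t)^-1 *: (u s - u t)))).
rewrite (le_lt_trans (ler_normD _ _))// (splitr e) ltr_leD//; first by near: s.
rewrite linearZ/= -scalerBr -normrN -scalerN opprB.
have -> : f (u s) - f (u t) - 'd f (u t) (u s - u t) =
  f (u s) - (f (u t) + 'd f (u t) (u s - u t)) by rewrite opprD addrA.
rewrite normrZ.
have h1 : `|f (u s) - (f (u t) + 'd f (u t) (u s - u t))| <= e / 2 / K * `|u s - u t|.
  by near: s.
have h2 : `|(s - t)^-1 *: (u s - u t)| < K by near: s.
apply: (@le_trans _ _ (e / 2 / K * `|(s - t)^-1 *: (u s - u t)|)).
  by rewrite normrZ mulrCA ler_wpM2l.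
by rewrite -[leRHS](divfK (lt0r_neq0 K0)) ler_wpM2l// ltW.
Unshelve. all: by end_near. Qed.

End Velocity.

(** * Group operations on isotopies and systems *)

Section Isotopies.
Context {R : realType} {M : ptopologicalType}.
Implicit Types (Phi Psi : @isotopy R M) (s : @dynamical_system R M).

Definition id_isotopy : @isotopy R M :=
  Isotopy (fun t (_ : I01 t) => @erefl M : cancel id id) (fun t _ => @erefl M).

Definition comp_isotopy Phi Psi : @isotopy R M :=
  @Isotopy R M (fun t => fwd Phi t \o fwd Psi t) (fun t => bwd Psi t \o bwd Phi t)
    (fun t It => can_comp (fwdK Phi It) (fwdK Psi It))
    (fun t It => can_comp (bwdK Psi It) (bwdK Phi It)).

Definition inv_isotopy Phi : @isotopy R M :=
  @Isotopy R M (bwd Phi) (fwd Phi) (bwdK Phi) (fwdK Phi).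

Definition id_system : @dynamical_system R M :=
  DynamicalSystem id_isotopy (fun _ _ => 0) (fun _ _ => 0).

Definition comp_system s s' : @dynamical_system R M :=
  DynamicalSystem (comp_isotopy (flow s) (flow s'))
    (fun t x => ham s t x +
       expR (conf s t (bwd (flow s) t x)) * ham s' t (bwd (flow s) t x))
    (fun t x => conf s t (fwd (flow s') t x) + conf s' t x).

(** The solution (K, k) of the group law: H + (e^h K) o phi^-1 = 0 and h o phi^-1 + k = 0. *)
Definition inv_system s : @dynamical_system R M :=
  DynamicalSystem (inv_isotopy (flow s))
    (fun t x => - (expR (- conf s t x) * ham s t (fwd (flow s) t x)))
    (fun t x => - conf s t (bwd (flow s) t x)).

End Isotopies.

(** * Products and inverses of smooth contact systems *)

Section SmoothSystems.
Context {R : realType} {n : nat} {M : ptopologicalType}.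
Variables (S : smooth_structure R n.*2.+1 M) (alpha : one_form S).
Notation rV := 'rV[R]_(n.*2.+1).
Implicit Types (F G : R -> M -> M) (c : chart R n.*2.+1 M) (t : R) (v w : rV).

Lemma pairingD (a v w : rV) : pairing a (v + w) = pairing a v + pairing a w.
Proof. by rewrite /pairing mulmxDl mxE. Qed.

Lemma pairing0 (a : rV) : pairing a 0 = 0.
Proof. by rewrite /pairing mul0mx mxE. Qed.

Lemma smooth_map_rep F c c' t x : smooth_map S F -> atlas S c -> atlas S c' ->
  I01 t -> ccod c x -> cdom c' (F t (cinv c x)) ->
  exists f : R^o * rV -> rV, differentiable f (t, x) /\
    nbhs ((t : R^o), x) [set z : R^o * rV | I01 z.1 -> f z = cmap c' (F z.1 (cinv c z.2))].
Proof.
move=> sF cS c'S It cx c'x; have [cF sFc] := sF.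
have [U [f [oU Ua Cf fE]]] := sFc c c' cS c'S (t, x) (And3 It cx c'x).
exists f; split; first by have [df _] := Cf 1%N; exact: df.
have nU : nbhs ((t : R^o), x) U by exact: open_nbhs_nbhs.
apply: filterS2 nU (near_chart_domain cF It cx c'x) => z Uz Hz Iz.
by apply: fE => //; have [] := Hz Iz.
Qed.

Lemma differentiable_slice (f : R^o * rV -> rV) t x : differentiable f (t, x) ->
  is_diff x (fun y => f (t, y)) (fun v => 'd f (t, x) (0, v)).
Proof.
move=> df.
have dp : is_diff x (fun y : rV => (t : R^o, y)) (fun v => (0, v)).
  apply: (is_diff_eq (is_diff_pair (is_diff_cst (t : R^o) x) (is_diff_id x))).
  by [].
have dF : is_diff ((fun y : rV => (t : R^o, y)) x) f ('d f (t, x)).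
  exact: differentiableP.
exact: (is_diff_comp dp dF).
Qed.

Lemma smooth_map_slice F c c' t x : smooth_map S F -> atlas S c -> atlas S c' ->
  I01 t -> ccod c x -> cdom c' (F t (cinv c x)) ->
  differentiable (fun y => cmap c' (F t (cinv c y))) x.
Proof.
move=> sF cS c'S It cx c'x; have [f [df fE]] := smooth_map_rep sF cS c'S It cx c'x.
have [dfs _] := differentiable_slice df.
apply: near_differentiable dfs.
have [[A B] /= [nA nB] AB] := fE.
by apply: filterS nB => y By; exact: (AB (t, y) (conj (nbhs_singleton nA) By) It).
Qed.

Lemma velocity_of_composition F c c' t (y : R -> rV) w : smooth_map S F ->
  atlas S c -> atlas S c' -> I01 t -> ccod c (y t) -> cdom c' (F t (cinv c (y t))) ->
  has_velocity y t w ->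
  exists2 v, has_velocity (fun s => cmap c' (F s (cinv c (y t)))) t v &
    has_velocity (fun s => cmap c' (F s (cinv c (y s)))) t
      (v + 'd (fun x => cmap c' (F t (cinv c x))) (y t) w).
Proof.
move=> sF cS c'S It cy c'y yw; have FF := within_I01_proper It.
have [f [df fE]] := smooth_map_rep sF cS c'S It cy c'y.
have [dfs dfsE] := differentiable_slice df.
have near_slice : {near y t, (fun x => f (t, x)) =1 (fun x => cmap c' (F t (cinv c x)))}.
  have [[A B] /= [nA nB] AB] := fE.
  by apply: filterS nB => x Bx; exact: (AB (t, x) (conj (nbhs_singleton nA) Bx) It).
have curve (z : R -> rV) v : z t = y t -> has_velocity z t v ->
    has_velocity (fun s => cmap c' (F s (cinv c (z s)))) t ('d f (t, y t) (1, v)).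
  move=> zy zv.
  have dfz : differentiable f (t : R^o, z t) by rewrite zy.
  have := has_velocity_comp It dfz (has_velocity_time It zv).
  rewrite zy; apply: cvg_trans; apply: near_eq_cvg.
  have cz := has_velocity_cvg It zv; rewrite zy in cz.
  have ct : (s : R^o) @[s --> within I01 t^'] --> (t : R^o).
    by move=> W nW; apply: near_within_punctured; apply: filterS nW.
  have nI : within I01 t^' I01 by exact: withinT.
  apply: (@filterS2 _ (within I01 t^') _ _ _ _ _ (cvg_pair ct cz fE) nI) => s /= Hs Is.
  by have /= Ht := nbhs_singleton fE It; rewrite Hs// zy Ht.
exists ('d f (t, y t) (1, 0)); first exact: (curve (fun=> y t) 0 erefl (has_velocity_cst _ It)).
rewrite (near_diff _ near_slice dfs) (congr1 (@^~ w) dfsE) -linearD /=.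
have -> : (1, 0) + (0, w) = (1, w) :> R^o * rV.
  by rewrite /GRing.add/= /add_pair/= addr0 add0r.
exact: curve.
Qed.

Lemma conformal_factor_comp F G h k : smooth_map S F -> smooth_map S G ->
  conformal_factor alpha F h -> conformal_factor alpha G k ->
  conformal_factor alpha (fun t => F t \o G t) (fun t x => h t (G t x) + k t x).
Proof.
move=> sF sG Fh Gk c c' t x cS c'S It cx c'x v /=.
have [c1 c1S c1x] := atlas_cover S (G t (cinv c x)).
pose fG y := cmap c1 (G t (cinv c y)); pose fF y := cmap c' (F t (cinv c1 y)).
have dG : differentiable fG x by exact: smooth_map_slice.
have c1y : ccod c1 (fG x) by exact: cmap_cod.
have fGK : cinv c1 (fG x) = G t (cinv c x) by rewrite /fG cmapK.
have c'y : cdom c' (F t (cinv c1 (fG x))) by rewrite fGK.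
have dF : differentiable fF (fG x) by exact: smooth_map_slice.
have nE : {near x, fF \o fG =1 (fun y => cmap c' (F t (G t (cinv c y))))}.
  have [[A B] /= [nA nB] AB] := near_chart_domain sG.1 It cx c1x.
  apply: filterS nB => y By; rewrite /= /fF /fG cmapK//.
  by have [] := AB (t, y) (conj (nbhs_singleton nA) By) It.
rewrite (near_diff _ nE (differentiable_comp dG dF)) (congr1 (@^~ v) (diff_comp dG dF)) /=.
have := Fh c1 c' t (fG x) c1S c'S It c1y c'y ('d fG x v); rewrite /= fGK => ->.
have := Gk c c1 t x cS c1S It cx c1x v; rewrite /= => ->.
by rewrite mulrA -expRD.
Qed.

Lemma conformal_factor_inv (Phi : @isotopy R M) h :
  smooth_map S (fwd Phi) -> smooth_map S (bwd Phi) ->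
  conformal_factor alpha (fwd Phi) h ->
  conformal_factor alpha (bwd Phi) (fun t x => - h t (bwd Phi t x)).
Proof.
move=> sF sG Fh c c' t x cS c'S It cx c'x v /=.
pose fG y := cmap c' (bwd Phi t (cinv c y)); pose fF y := cmap c (fwd Phi t (cinv c' y)).
have dG : differentiable fG x by exact: smooth_map_slice.
have c'y : ccod c' (fG x) by exact: cmap_cod.
have fGK : cinv c' (fG x) = bwd Phi t (cinv c x) by rewrite /fG cmapK.
have FG : fwd Phi t (bwd Phi t (cinv c x)) = cinv c x by rewrite bwdK.
have cy : cdom c (fwd Phi t (cinv c' (fG x))) by rewrite fGK FG; exact: cinv_dom.
have dF : differentiable fF (fG x) by exact: smooth_map_slice.
have nE : {near x, fF \o fG =1 id}.
  have [[A B] /= [nA nB] AB] := near_chart_domain sG.1 It cx c'x.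
  apply: filterS nB => y By.
  have [cy' c'y'] := AB (t, y) (conj (nbhs_singleton nA) By) It.
  by rewrite /= /fF /fG cmapK// bwdK// cinvK.
have dE : 'd fF (fG x) ('d fG x v) = v.
  have E1 := near_diff v nE (differentiable_comp dG dF).
  have E2 := congr1 (@^~ v) (diff_comp dG dF).
  have [_ E3] := is_diff_id x.
  exact: etrans (esym E2) (etrans (esym E1) (congr1 (@^~ v) E3)).
have FE := Fh c' c t (fG x) c'S cS It c'y cy ('d fG x v).
have E : pairing (coef alpha c (fF (fG x))) v =
    expR (h t (cinv c' (fG x))) * pairing (coef alpha c' (fG x)) ('d fG x v).
  exact: etrans (congr1 (pairing _) (esym dE)) FE.
have fFx : fF (fG x) = x by rewrite /fF fGK FG cinvK.
rewrite fFx fGK in E.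
by rewrite E mulrA -expRD addNr expR0 mul1r.
Qed.

(** The generating field of phi o psi is X + phi_* Y, and phi^* alpha = e^h alpha turns alpha(phi_*
    Y) into (e^h K) o phi^-1. *)
Lemma hamiltonian_comp (Phi Psi : @isotopy R M) H K h :
  smooth_map S (fwd Phi) -> smooth_map S (fwd Psi) ->
  hamiltonian alpha (fwd Phi) H -> hamiltonian alpha (fwd Psi) K ->
  conformal_factor alpha (fwd Phi) h ->
  hamiltonian alpha (fun t => fwd Phi t \o fwd Psi t)
    (fun t x => H t x + expR (h t (bwd Phi t x)) * K t (bwd Phi t x)).
Proof.
move=> sF sG HF HG Fh c t p cS It cp; set q := fwd Psi t p.
have [c1 c1S c1q] := atlas_cover S q.
have [w yw Kw] := HG c1 t p c1S It c1q.
pose y s := cmap c1 (fwd Psi s p).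
have c1y : ccod c1 (y t) by exact: cmap_cod.
have yK : cinv c1 (y t) = q by rewrite /y cmapK.
have cy : cdom c (fwd Phi t (cinv c1 (y t))) by rewrite yK.
have [v Fv FGv] := velocity_of_composition sF c1S cS It c1y cy yw.
exists (v + 'd (fun x => cmap c (fwd Phi t (cinv c1 x))) (y t) w).
  apply: has_velocity_near FGv => //.
  have /time_continuousP cG := sG.1.
  have n1 : nbhs q (cdom c1) by apply: open_nbhs_nbhs; split=> //; exact: cdom_open.
  have [A [B [nA nB AB]]] := cG t p It _ n1.
  apply: filterS nA => s As Is; rewrite /y cmapK//.
  exact: AB Is As (nbhs_singleton nB).
rewrite pairingD /= -/q; congr (_ + _).
  have [v' Fv' Hv'] := HF c t q cS It cp.
  by rewrite Hv' yK in Fv *; rewrite (has_velocity_unique It Fv Fv').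
rewrite fwdK//; have := Fh c1 c t (y t) c1S cS It c1y cy w.
by rewrite /= yK => ->; congr (_ * _).
Qed.

(** Differentiating phi_s (phi_s^-1 p) = p gives v + Dphi_t w = 0, and applying alpha gives H(p) +
    e^h alpha(w) = 0, with h taken at phi_t^-1 p. *)
Lemma hamiltonian_inv (Phi : @isotopy R M) H h :
  smooth_map S (fwd Phi) -> smooth_map S (bwd Phi) ->
  hamiltonian alpha (fwd Phi) H -> conformal_factor alpha (fwd Phi) h ->
  hamiltonian alpha (bwd Phi)
    (fun t x => - (expR (- h t x) * H t (fwd Phi t x))).
Proof.
move=> sF sG HF Fh c t p cS It cq; set q := bwd Phi t p in cq *.
have [c1 c1S c1p] := atlas_cover S p.
pose x1 := cmap c1 p; have c1x : ccod c1 x1 by exact: cmap_cod.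
have x1K : cinv c1 x1 = p by exact: cmapK.
have FG : fwd Phi t q = p by rewrite /q bwdK.
pose y s := cmap c (bwd Phi s p).
(* With a constant curve, this extracts the existence of a velocity of s |-> phi_s^-1 p. *)
have [w yw _] := @velocity_of_composition (bwd Phi) c1 c t (fun=> x1) 0 sG c1S cS It c1x
  (eq_ind_r (fun z => cdom c (bwd Phi t z)) cq x1K) (has_velocity_cst _ It).
rewrite /= x1K in yw.
have cy : ccod c (y t) by exact: cmap_cod.
have yK : cinv c (y t) = q by rewrite /y cmapK.
have c1y : cdom c1 (fwd Phi t (cinv c (y t))) by rewrite yK FG.
have [v Fv FGv] := velocity_of_composition sF cS c1S It cy c1y yw.
exists w => //.
have vw0 : v + 'd (fun x => cmap c1 (fwd Phi t (cinv c x))) (y t) w = 0.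
  apply: (has_velocity_unique It FGv).
  apply: (has_velocity_near It _ (has_velocity_cst x1 It)).
  have /time_continuousP cG := sG.1.
  have n1 : nbhs q (cdom c) by apply: open_nbhs_nbhs; split=> //; exact: cdom_open.
  have [A [B [nA nB AB]]] := cG t p It _ n1.
  apply: filterS nA => s As Is; rewrite /y cmapK ?bwdK//.
  exact: AB Is As (nbhs_singleton nB).
have [v' Fv' Hv'] := HF c1 t q c1S It (eq_ind_r (cdom c1) c1p FG).
rewrite yK in Fv; have vE := has_velocity_unique It Fv Fv'.
have := Fh c c1 t (y t) cS c1S It cy c1y w; rewrite /= yK FG => cE.
have := congr1 (pairing (coef alpha c1 x1)) vw0.
rewrite pairingD pairing0 cE vE => E.
have {}E : H t p = - (expR (h t q) * pairing (coef alpha c (y t)) w).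
  by rewrite -{1}FG Hv' FG; apply/eqP; rewrite -addr_eq0 E.
by rewrite E mulrN opprK mulrA -expRD addNr expR0 mul1r.
Qed.

Lemma smooth_contact_comp s s' : smooth_contact_system alpha s ->
  smooth_contact_system alpha s' -> smooth_contact_system alpha (comp_system s s').
Proof.
move=> [[sF sFi F0] [sH hH] [sh ch]] [[sG sGi G0] [sK hK] [sk ck]]; split.
- split; [exact: smooth_map_comp|exact: smooth_map_comp|].
  by rewrite /= F0 G0.
- split; last exact: hamiltonian_comp.
  apply: smooth_functionD => //; apply: smooth_functionM.
    by apply: smooth_function_exp; exact: smooth_function_comp sh sFi.
  exact: smooth_function_comp sK sFi.
split; last exact: conformal_factor_comp.
by apply: smooth_functionD => //; exact: smooth_function_comp sh sG.
Qed.

Lemma smooth_contact_inv s : smooth_contact_system alpha s ->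
  smooth_contact_system alpha (inv_system s).
Proof.
move=> [[sF sFi F0] [sH hH] [sh ch]]; split.
- split=> //=; have I0 : I01 (0 : R) by rewrite /I01/= in_itv/= lexx ler01.
  apply/funext => x; have := fwdK (flow s) I0 x.
  by rewrite F0.
- split; last exact: hamiltonian_inv.
  apply: smooth_functionN; apply: smooth_functionM.
    by apply: smooth_function_exp; exact: smooth_functionN.
  exact: smooth_function_comp sH sF.
split; last exact: conformal_factor_inv.
by apply: smooth_functionN; exact: smooth_function_comp sh sFi.
Qed.

Lemma smooth_contact_id : smooth_contact_system alpha id_system.
Proof.
split; first by split=> //; exact: smooth_map_id.
- split; first exact: smooth_function_cst.
  move=> c t p cS It cp; exists 0; last by rewrite pairing0.
  exact: (has_velocity_cst (cmap c p) It).
split; first exact: smooth_function_cst.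
move=> c c' t x cS c'S It cx c'x v /=; rewrite expR0 mul1r.
by rewrite -(coef_compat alpha cS c'S).
Qed.

End SmoothSystems.

(** * Topological contact systems *)

Section TopologicalSystems.
Context {R : realType} {n : nat} {M : ptopologicalType}.
Variables (S : smooth_structure R n.*2.+1 M) (alpha : one_form S).
Variable mu : {finite_measure set (g_sigma_algebraType (@open M)) -> \bar R}.
Variable g : riemannian_metric S.
Hypotheses (hM : closed_connected M) (mu_gt0 : (0 < mu setT)%E).
Notation dist := (riemannian_distance g).
Notation udist := (fun a b : R => `|a - b|).
Notation TC := (TCDS alpha mu g).
Implicit Types s : @dynamical_system R M.

Let cM : compact [set: M]. Proof. by case: hM. Qed.

(* The properties of a topological contact dynamical system that survive
   without reference to the approximating smooth systems. *)
Record regular_system s : Prop := RegularSystem {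
  regular_fwd : time_continuous (fwd (flow s));
  regular_bwd : time_continuous (bwd (flow s));
  regular_ham : tame (ham s);
  regular_ham_finite : (path_norm (ham s) < +oo)%E;
  regular_conf : time_continuous (conf s) }.

Lemma smooth_contact_conf s : smooth_contact_system alpha s -> time_continuous (conf s).
Proof. by move=> [_ _ [sh _]]; exact: smooth_function_continuous sh. Qed.

Lemma smooth_contact_ham s : smooth_contact_system alpha s -> time_continuous (ham s).
Proof. by move=> [_ [sH _] _]; exact: smooth_function_continuous sH. Qed.

Lemma smooth_contact_fwd s : smooth_contact_system alpha s -> time_continuous (fwd (flow s)).
Proof. by move=> [[sF _ _] _ _]; exact: smooth_map_continuous sF. Qed.

Lemma smooth_contact_bwd s : smooth_contact_system alpha s -> time_continuous (bwd (flow s)).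
Proof. by move=> [[_ sF _] _ _]; exact: smooth_map_continuous sF. Qed.

Lemma path_norm_fin (H : R -> M -> R) : time_continuous H -> (path_norm H < +oo)%E.
Proof.
move=> cH; have [B HB] := time_continuous_bounded cM cH.
exact: le_lt_trans (path_norm_le_cst HB) (ltry _).
Qed.

Lemma TCDS_regular s : TC s -> regular_system s.
Proof.
move=> [[cF cB] /(L1_C0P cM mu_gt0)[tH Hoo] [si [ssi _ _ ci _]]]; split=> //.
by apply: uniform_limit_continuous ci => i; exact: smooth_contact_conf.
Qed.

Lemma approximation_vanishing s (si : nat -> @dynamical_system R M) :
  tame (ham s) -> (forall i, smooth_contact_system alpha (si i)) ->
  norm_1oo mu (fun t x => ham s t x - ham (si i) t x) @[i --> \oo] --> 0%E ->
  vanishing (fun i => path_norm (fun t x => ham s t x - ham (si i) t x)).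
Proof.
move=> tH ssi /cvg_vanishing; apply: vanishing_le => i.
apply: (path_norm_le_norm_1oo cM mu_gt0).
by have [] := tameB g hM tH (tame_continuous g hM (smooth_contact_ham (ssi i))).
Qed.

Lemma vanishing_approximation s (si : nat -> @dynamical_system R M) :
  tame (ham s) -> (forall i, smooth_contact_system alpha (si i)) ->
  vanishing (fun i => path_norm (fun t x => ham s t x - ham (si i) t x)) ->
  norm_1oo mu (fun t x => ham s t x - ham (si i) t x) @[i --> \oo] --> 0%E.
Proof.
move=> tH ssi v.
have tHi i := tameB g hM tH (tame_continuous g hM (smooth_contact_ham (ssi i))).
apply: vanishing_cvg => [i|]; first by apply: (norm_1oo_ge0 cM mu_gt0); have [] := tHi i.
apply: vanishing_le (vanishingZ (ler0n R 3) (fun i => path_norm_ge0 _) v) => i.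
exact: norm_1oo_le_path_norm.
Qed.

Lemma TCDS_intro s (si : nat -> @dynamical_system R M) :
  time_continuous (fwd (flow s)) -> time_continuous (bwd (flow s)) ->
  tame (ham s) -> (path_norm (ham s) < +oo)%E ->
  (forall i, smooth_contact_system alpha (si i)) ->
  uniformly_to dist (fun i => fwd (flow (si i))) (fwd (flow s)) ->
  uniformly_to dist (fun i => bwd (flow (si i))) (bwd (flow s)) ->
  uniformly_to udist (fun i => conf (si i)) (conf s) ->
  vanishing (fun i => path_norm (fun t x => ham s t x - ham (si i) t x)) ->
  TC s.
Proof.
move=> cF cB tH Hoo ssi fi bi ci v; split=> //; first exact/(L1_C0P cM mu_gt0).
by exists si; split=> //; exact: vanishing_approximation.
Qed.

Lemma time_continuous_exp (h : R -> M -> R) : time_continuous h ->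
  time_continuous (fun t x => expR (h t x)).
Proof. by move=> ch; exact: time_continuous_app (@continuous_expR R) ch. Qed.

Lemma regular_comp s s' : regular_system s -> regular_system s' ->
  regular_system (comp_system s s').
Proof.
move=> [cF cFi tH Hoo ch] [cG cGi tK Koo ck].
have tw : tame (fun t x => expR (conf s t (bwd (flow s) t x)) * ham s' t (bwd (flow s) t x)).
  apply: (tame_twist g hM) => //.
  exact: time_continuous_comp (time_continuous_exp ch) cFi.
split.
- exact: time_continuous_comp.
- exact: time_continuous_comp.
- exact: tameD.
- apply: le_lt_trans (path_normD cM tH tw) _; rewrite lte_add_pinfty//.
  have [B HB] := time_continuous_bounded cM (time_continuous_exp ch).
  have B0 : 0 <= B.
    by apply: le_trans (HB 0 point _); rewrite // /I01/= in_itv/= lexx ler01.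
  apply: (@le_lt_trans _ _ (B%:E * path_norm (ham s'))%E).
    apply: (path_norm_scale cM) => // t It x; exists (bwd (flow s) t x).
    by rewrite normrM ler_wpM2r// HB.
  by rewrite lte_mul_pinfty.
by apply: time_continuousD => //; exact: time_continuous_comp ch cG.
Qed.

Lemma regular_inv s : regular_system s -> regular_system (inv_system s).
Proof.
move=> [cF cFi tH Hoo ch].
have cmh := time_continuous_exp (time_continuousN ch).
split=> //=.
- by apply: (tameN g hM); apply: (tame_twist g hM).
- have [B HB] := time_continuous_bounded cM cmh.
  have B0 : 0 <= B.
    by apply: le_trans (HB 0 point _); rewrite // /I01/= in_itv/= lexx ler01.
  apply: (@le_lt_trans _ _ (B%:E * path_norm (ham s))%E).
    apply: (path_norm_scale cM) => // t It x; exists (fwd (flow s) t x).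
    by rewrite normrN normrM ler_wpM2r// HB.
  by rewrite lte_mul_pinfty.
by apply: time_continuousN; exact: time_continuous_comp ch cFi.
Qed.

Lemma TCDS_id : TC (@id_system R M).
Proof.
have cid : time_continuous (fun _ : R => @id M).
  exact: (time_continuous_static (fun x => @cvg_id _ _)).
have c0 : time_continuous (fun (_ : R) (_ : M) => 0 : R).
  exact: (time_continuous_static (@cst_continuous _ _ 0)).
apply: (@TCDS_intro _ (fun=> @id_system R M)) => //.
- exact: tame_cst.
- exact: path_norm_fin.
- by move=> _; exact: smooth_contact_id.
- by move=> e e0; apply: nearW => i t x _; rewrite rdist_refl.
- by move=> e e0; apply: nearW => i t x _; rewrite rdist_refl.
- by move=> e e0; apply: nearW => i t x _; rewrite subrr normr0.
move=> e e0; apply: nearW => i; apply: path_norm_le_cst => t x _.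
by rewrite subrr normr0 ltW.
Qed.

Lemma TCDS_comp s s' : TC s -> TC s' -> TC (comp_system s s').
Proof.
move=> TCs TCs'; have rs := TCDS_regular TCs; have rs' := TCDS_regular TCs'.
have rc := regular_comp rs rs'.
have [_ _ [si [ssi fi bi ci Hi]]] := TCs; have [_ _ [ti [sti gi di ki Ki]]] := TCs'.
have [cF cFi tH Hoo ch] := rs; have [cG cGi tK Koo ck] := rs'.
have vH := approximation_vanishing tH ssi Hi.
have vK := approximation_vanishing tK sti Ki.
have cKi i := smooth_contact_ham (sti i); have chi i := smooth_contact_conf (ssi i).
have tKi i := tame_continuous g hM (cKi i).
have tHi i := tame_continuous g hM (smooth_contact_ham (ssi i)).
have [rc1 rc2 rc3 rc4 _] := rc.
apply: (@TCDS_intro _ (fun i => comp_system (si i) (ti i))) => //.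
- by move=> i; exact: smooth_contact_comp.
- exact: (uniformly_to_comp_map hM).
- exact: (uniformly_to_comp_map hM).
- by apply: uniformly_toD => //; exact: (uniformly_to_comp_fun hM ch ci gi).
(* The product e^h K is formed before composing with phi^-1: its approximants are continuous in
   time, as [vanishing_comp] requires, and both factors are composed at once. *)
have tE : tame (fun t x => expR (conf s t x) * ham s' t x).
  exact: (tameM g hM tK (time_continuous_exp ch)).
have cEi i : time_continuous (fun t x => expR (conf (si i) t x) * ham (ti i) t x).
  exact: time_continuousM (time_continuous_exp (chi i)) (cKi i).
have vE : vanishing (fun i => path_norm (fun t x =>
    expR (conf s t x) * ham s' t x - expR (conf (si i) t x) * ham (ti i) t x)).
  apply: (vanishing_mul g hM) => //.
  - exact: time_continuous_exp.
  - by move=> i; exact: time_continuous_exp.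
  - exact: (vanishing_exp hM).
have vC := vanishing_comp hM tE cEi cFi (fun i => smooth_contact_bwd (ssi i)) bi vE.
apply: vanishing_le (vanishingD vH vC) => i.
have := path_normD cM (tameB g hM tH (tHi i)) (tameB g hM (tame_comp g hM tE cFi)
  (tame_comp g hM (tame_continuous g hM (cEi i)) (smooth_contact_bwd (ssi i)))).
apply: le_trans; rewrite le_eqVlt; apply/orP; left; apply/eqP.
by apply: path_norm_eq => t _; apply/funext => x /=; ring.
Qed.

Lemma TCDS_inv s : TC s -> TC (inv_system s).
Proof.
move=> TCs; have rs := TCDS_regular TCs; have [ri1 ri2 ri3 ri4 _] := regular_inv rs.
have [_ _ [si [ssi fi bi ci Hi]]] := TCs.
have [cF cFi tH Hoo ch] := rs.
have vH := approximation_vanishing tH ssi Hi.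
have cHi i := smooth_contact_ham (ssi i); have chi i := smooth_contact_conf (ssi i).
apply: (@TCDS_intro _ (fun i => inv_system (si i))) => //.
- by move=> i; exact: smooth_contact_inv.
- by apply: uniformly_toN; exact: (uniformly_to_comp_fun hM ch ci bi).
have vC := vanishing_comp hM tH cHi cF (fun i => smooth_contact_fwd (ssi i)) fi vH.
have tC := tame_comp g hM tH cF.
have cCi i : time_continuous (fun t x => ham (si i) t (fwd (flow (si i)) t x)).
  exact: time_continuous_comp (cHi i) (smooth_contact_fwd (ssi i)).
have Coo : (path_norm (fun t x => ham s t (fwd (flow s) t x)) < +oo)%E.
  apply: le_lt_trans Hoo; rewrite -[leRHS]mul1e.
  by apply: (path_norm_scale cM) => // t It x; exists (fwd (flow s) t x); rewrite mul1r.
have vE := vanishing_mul g hM tC Coo (time_continuous_exp (time_continuousN ch))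
  (fun i => tame_continuous g hM (cCi i)) (fun i => time_continuous_exp (time_continuousN (chi i)))
  (vanishing_exp hM (time_continuousN ch) (uniformly_toN ci)) vC.
apply: vanishing_le vE => i; rewrite -[leRHS]mul1e.
apply: (path_norm_scale cM) => //.
  apply: (tameB g hM); first exact: (tameM g hM tC (time_continuous_exp (time_continuousN ch))).
  apply: (tameM g hM (tame_continuous g hM (cCi i))).
  exact: time_continuous_exp (time_continuousN (chi i)).
move=> t It x; exists x; rewrite mul1r -normrN /=.
by rewrite opprB opprK addrC.
Qed.

End TopologicalSystems.

(** * The left invariant metric *)

Section Size.
Context {R : realType} {n : nat} {M : ptopologicalType}.
Variables (S : smooth_structure R n.*2.+1 M) (g : riemannian_metric S).
Hypothesis hM : closed_connected M.
Notation dist := (riemannian_distance g).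
Implicit Types (Phi Psi : @isotopy R M) (s : @dynamical_system R M).

Let cM : compact [set: M]. Proof. by case: hM. Qed.

Let I0 : I01 (0 : R). Proof. by rewrite /I01/= in_itv/= lexx ler01. Qed.

Lemma sup_dist_le (phi psi : M -> M) B : (forall x, dist (phi x) (psi x) <= B) ->
  sup [set dist (phi x) (psi x) | x in [set: M]] <= B.
Proof.
move=> HB; apply: ge_sup; first by exists (dist (phi point) (psi point)); exists point.
by move=> _ [x _ <-].
Qed.

Lemma sup_dist_ge (phi psi : M -> M) x :
  dist (phi x) (psi x) <= sup [set dist (phi x) (psi x) | x in [set: M]].
Proof.
have [D _ HD] := rdist_bounded g hM.
by apply: ub_le_sup; [exists D => _ [y _ <-]|exists x].
Qed.

Lemma dbar_le Phi Psi B B' :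
  (forall t x, I01 t -> dist (fwd Phi t x) (fwd Psi t x) <= B) ->
  (forall t x, I01 t -> dist (bwd Phi t x) (bwd Psi t x) <= B') ->
  dbar g Phi Psi <= B + B'.
Proof.
move=> HB HB'; apply: ge_sup.
  by exists (dbar_homeo g (fwd Phi 0) (bwd Phi 0) (fwd Psi 0) (bwd Psi 0)); exists 0.
move=> _ [t It <-]; apply: lerD; apply: sup_dist_le => x; first exact: HB.
exact: HB'.
Qed.

Lemma dbar_homeo_le_dbar Phi Psi t : I01 t ->
  dbar_homeo g (fwd Phi t) (bwd Phi t) (fwd Psi t) (bwd Psi t) <= dbar g Phi Psi.
Proof.
move=> It; have [D _ HD] := rdist_bounded g hM.
apply: ub_le_sup; last by exists t.
by exists (D + D) => _ [r _ <-]; apply: lerD; exact: sup_dist_le.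
Qed.

Lemma dbar_fwd Phi Psi t x : I01 t -> dist (fwd Phi t x) (fwd Psi t x) <= dbar g Phi Psi.
Proof.
move=> It; apply: le_trans (dbar_homeo_le_dbar Phi Psi It).
rewrite (le_trans (sup_dist_ge (fwd Phi t) (fwd Psi t) x))// lerDl.
by rewrite (le_trans _ (sup_dist_ge _ _ point))// rdist_ge0.
Qed.

Lemma dbar_bwd Phi Psi t x : I01 t -> dist (bwd Phi t x) (bwd Psi t x) <= dbar g Phi Psi.
Proof.
move=> It; apply: le_trans (dbar_homeo_le_dbar Phi Psi It).
rewrite (le_trans (sup_dist_ge (bwd Phi t) (bwd Psi t) x))// lerDr.
by rewrite (le_trans _ (sup_dist_ge _ _ point))// rdist_ge0.
Qed.

Lemma dbar_ge0 Phi Psi : 0 <= dbar g Phi Psi.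
Proof. exact: le_trans (rdist_ge0 g hM _ _) (dbar_fwd Phi Psi point I0). Qed.

(** In d(x, phi psi x) <= d(x, psi x) + d(psi x, phi (psi x)) the last term is a displacement of phi
    at another point, so no modulus of continuity appears. The inverses are treated alike with the
    roles exchanged. *)
Lemma dbar_id_comp Phi Psi : dbar g id_isotopy (comp_isotopy Phi Psi) <=
  dbar g id_isotopy Phi + dbar g id_isotopy Psi.
Proof.
apply: ge_sup.
  by eexists; exists 0.
move=> _ [t It <-]; apply: (@le_trans _ _
  (dbar_homeo g id id (fwd Phi t) (bwd Phi t) + dbar_homeo g id id (fwd Psi t) (bwd Psi t))).
  rewrite /dbar_homeo addrACA lerD//; apply: sup_dist_le => x /=.
    rewrite addrC (le_trans (rdist_triangle g hM (fwd Psi t x) _ _))// lerD//.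
      exact: (sup_dist_ge id).
    exact: (sup_dist_ge id (fwd Phi t)).
  rewrite (le_trans (rdist_triangle g hM (bwd Phi t x) _ _))// lerD//.
    exact: (sup_dist_ge id).
  exact: (sup_dist_ge id (bwd Psi t)).
apply: lerD; first exact: (dbar_homeo_le_dbar id_isotopy Phi).
exact: (dbar_homeo_le_dbar id_isotopy Psi).
Qed.

Lemma dbar_id_inv Phi : dbar g id_isotopy (inv_isotopy Phi) = dbar g id_isotopy Phi.
Proof.
rewrite /dbar; congr sup; apply/seteqP; split=> _ [t It <-]; exists t => //;
  by rewrite /dbar_homeo /= addrC.
Qed.

Lemma sup_norm_ge (h : R -> M -> R) t x : time_continuous h -> I01 t ->
  `|h t x| <= sup_norm h.
Proof.
move=> ch It; have [B HB] := time_continuous_bounded cM ch.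
apply: ub_le_sup; first by exists B => _ [[r y] [/= Ir _] <-]; exact: HB.
by exists (t, x).
Qed.

Lemma sup_norm_le (h : R -> M -> R) B : (forall t x, I01 t -> `|h t x| <= B) ->
  sup_norm h <= B.
Proof.
move=> HB; apply: ge_sup; first by exists `|h 0 point|; exists (0, point).
by move=> _ [[r y] [/= Ir _] <-]; exact: HB.
Qed.

Lemma sup_norm_ge0 (h : R -> M -> R) : time_continuous h -> 0 <= sup_norm h.
Proof. by move=> ch; exact: le_trans (sup_norm_ge point ch I0). Qed.

Definition ham_norm s : R := fine (path_norm (ham s)).

Definition weight s : R := expR (sup_norm (conf s)) + ham_norm s.

(* The weight is submultiplicative because
   [H # F = H + e^h F o phi^-1] gives [|H # F| <= |H| + e^|h| |F|]: this is the
   multiplication rule of the affine maps [y |-> e^|h| y + |H|]. *)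
Definition system_size s : R := dbar g id_isotopy (flow s) + ln (weight s).

Lemma ham_norm_ge0 s : 0 <= ham_norm s.
Proof. by rewrite fine_ge0// path_norm_ge0. Qed.

Lemma ham_normE s : regular_system s -> path_norm (ham s) = (ham_norm s)%:E.
Proof. by move=> rs; rewrite fineK// ge0_fin_numE ?path_norm_ge0//; exact: regular_ham_finite. Qed.

Lemma weight_ge1 s : regular_system s -> 1 <= weight s.
Proof.
move=> rs; rewrite -[1]addr0 lerD ?ham_norm_ge0// -expR0 ler_expR.
exact: sup_norm_ge0 (regular_conf rs).
Qed.

Lemma size_ge0 s : regular_system s -> 0 <= system_size s.
Proof. by move=> rs; rewrite addr_ge0 ?dbar_ge0// ln_ge0// weight_ge1. Qed.

Lemma weight_comp s s' : regular_system s -> regular_system s' ->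
  weight (comp_system s s') <= weight s * weight s'.
Proof.
move=> rs rs'; have rc := regular_comp g hM rs rs'.
have [cF cFi tH Hoo ch] := rs; have [cG cGi tK Koo ck] := rs'.
set a := sup_norm (conf s); set b := sup_norm (conf s').
have ab : expR (sup_norm (conf (comp_system s s'))) <= expR a * expR b.
  rewrite -expRD ler_expR; apply: sup_norm_le => t x It.
  by rewrite (le_trans (ler_normD _ _))// lerD// sup_norm_ge.
have HK : ham_norm (comp_system s s') <= ham_norm s + expR a * ham_norm s'.
  rewrite -lee_fin -ham_normE// EFinD EFinM -!ham_normE//.
  have tw : tame (fun t x => expR (conf s t (bwd (flow s) t x)) * ham s' t (bwd (flow s) t x)).
    apply: (tame_twist g hM) => //.
    exact: time_continuous_comp (time_continuous_exp ch) cFi.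
  apply: le_trans (path_normD cM tH tw) _; rewrite leeD2l//.
  apply: (path_norm_scale cM) => //.
  move=> t It x; exists (bwd (flow s) t x).
  rewrite normrM gtr0_norm ?expR_gt0// ler_wpM2r// ler_expR.
  by rewrite (le_trans (ler_norm _))// sup_norm_ge.
have hs := ham_norm_ge0 s; have b1 : 1 <= expR b.
  by rewrite -expR0 ler_expR sup_norm_ge0.
(* The product exceeds the bound by J(H) (e^b - 1) + J(H) J(K), which is nonnegative because e^b >=
   1. *)
rewrite /weight -/a -/b mulrDl !mulrDr.
have h1 : ham_norm s <= ham_norm s * expR b by rewrite ler_peMr.
have h2 : 0 <= ham_norm s * ham_norm s' by rewrite mulr_ge0// ham_norm_ge0.
lra.
Qed.

Lemma size_comp s s' : regular_system s -> regular_system s' ->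
  system_size (comp_system s s') <= system_size s + system_size s'.
Proof.
move=> rs rs'; rewrite /system_size addrACA lerD ?dbar_id_comp//.
have w0 r : regular_system r -> 0 < weight r.
  by move=> rr; exact: lt_le_trans ltr01 (weight_ge1 rr).
rewrite -lnM ?posrE ?w0// ler_ln ?posrE ?weight_comp ?mulr_gt0 ?w0//.
exact: (regular_comp g hM).
Qed.

(** With a = |h|, the inverse has conformal norm at most a and Hamiltonian norm at most e^a J, so
    its weight is at most e^a (1 + J) <= e^a (e^a + J) <= w^2; the logarithm yields the factor 2. *)
Lemma size_inv s : regular_system s -> system_size (inv_system s) <= 2 * system_size s.
Proof.
move=> rs; have ri := regular_inv g hM rs; have [cF cFi tH Hoo ch] := rs.
have w1 := weight_ge1 rs; have w0 : 0 < weight s by exact: lt_le_trans w1.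
rewrite /system_size [dbar _ _ _]dbar_id_inv mulrDr lerD//.
  by rewrite ler_peMl ?dbar_ge0// ler1n.
rewrite mulr_natl -lnXn// ler_ln ?posrE ?exprn_gt0//; last first.
  exact: lt_le_trans (weight_ge1 ri).
set a := sup_norm (conf s).
have ab : sup_norm (conf (inv_system s)) <= a.
  by apply: sup_norm_le => t x It; rewrite /= normrN sup_norm_ge.
have HK : ham_norm (inv_system s) <= expR a * ham_norm s.
  rewrite -lee_fin -ham_normE// EFinM -ham_normE//.
  apply: (path_norm_scale cM) => //.
  move=> t It x; exists (fwd (flow s) t x).
  rewrite normrN normrM gtr0_norm ?expR_gt0// ler_wpM2r// ler_expR.
  by rewrite (le_trans (ler_norm _))// normrN sup_norm_ge.
have a1 : 1 <= expR a by rewrite -expR0 ler_expR sup_norm_ge0.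
have {}ab : expR (sup_norm (conf (inv_system s))) <= expR a by rewrite ler_expR.
have hs := ham_norm_ge0 s.
have h1 : expR a * (expR a + ham_norm s) <= weight s ^+ 2.
  rewrite expr2 /weight -/a; apply: ler_wpM2r; last by rewrite lerDl.
  by rewrite addr_ge0// expR_ge0.
have h2 : expR a <= expR a * expR a by rewrite ler_peMr// expR_ge0.
move: h1; rewrite mulrDr [weight (inv_system s)]/weight; lra.
Qed.

Lemma size_id_le0 : system_size (@id_system R M) <= 0.
Proof.
have rid : dbar g id_isotopy id_isotopy <= 0 + 0 :> R.
  by apply: dbar_le => t x _; rewrite /= rdist_refl.
have h0 : ham_norm (@id_system R M) <= 0.
  rewrite /ham_norm; have : (path_norm (ham (@id_system R M)) <= 0%:E)%E.
    by apply: path_norm_le_cst => t x _ /=; rewrite normr0.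
  move=> h; have -> : path_norm (ham (@id_system R M)) = 0%E.
    by apply/eqP; rewrite eq_le h path_norm_ge0.
  by [].
have s0 : sup_norm (conf (@id_system R M)) <= 0.
  by apply: sup_norm_le => t x _ /=; rewrite normr0.
have w : weight (@id_system R M) <= 1.
  by rewrite -[1]addr0 lerD// -expR0 ler_expR.
have := ln_le0 w; rewrite /system_size /=; rewrite addr0 in rid; lra.
Qed.

(** Both summands of the size are nonnegative, and ln w bounds |h|. Since e^|h| >= 1, a weight below
    1 + eta forces the Hamiltonian norm below eta, whence the threshold ln (1 + eta). *)
Lemma size_small_weight eta : 0 < eta -> exists2 r, 0 < r & forall s, regular_system s ->
  system_size s < r -> [/\ dbar g id_isotopy (flow s) < eta, sup_norm (conf s) < eta &
    ham_norm s < eta].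
Proof.
move=> eta0; have e0 : 0 < ln (1 + eta) by rewrite ln_gt0// ltrDl.
exists (Num.min eta (ln (1 + eta))); first by rewrite lt_min eta0.
move=> s rs; rewrite lt_min => /andP[s1 s2].
have w1 := weight_ge1 rs; have w0 : 0 < weight s by exact: lt_le_trans w1.
have l0 := ln_ge0 w1; have d0 := dbar_ge0 id_isotopy (flow s).
have hs := ham_norm_ge0 s.
have a0 : 0 <= sup_norm (conf s) := sup_norm_ge0 (regular_conf rs).
split.
- by apply: le_lt_trans s1; rewrite /system_size lerDl.
- apply: le_lt_trans s1; rewrite /system_size.
  rewrite (le_trans _ (_ : ln (weight s) <= _))//; last by rewrite lerDr.
  by rewrite -[leLHS]expRK ler_ln ?posrE ?expR_gt0// /weight lerDl.
have : weight s < 1 + eta.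
  have : ln (weight s) < ln (1 + eta) by apply: le_lt_trans s2; rewrite /system_size lerDr.
  by rewrite ltr_ln// posrE addr_gt0.
have : 1 <= expR (sup_norm (conf s)) by rewrite -expR0 ler_expR.
rewrite /weight; lra.
Qed.

Lemma small_weight_size r : 0 < r -> exists2 eta, 0 < eta & forall s, regular_system s ->
  dbar g id_isotopy (flow s) <= eta -> sup_norm (conf s) <= eta -> ham_norm s <= eta ->
  system_size s < r.
Proof.
move=> r0; have r3 : 0 < r / 3 by rewrite divr_gt0.
have /cvgrPdist_lt/(_ _ r3) := @continuous_expR R 0.
rewrite expR0 => /nbhs_ballP[del del0' Hd]; have del0 : 0 < del := del0'.
(* One third of r goes to the flow, one to e^|h| - 1 and one to the Hamiltonian, using ln w <= w -
   1; the extra halves make inequalities strict. *)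
pose eta := Num.min (del / 2) (r / 3 / 2).
have eta0 : 0 < eta by rewrite lt_min !divr_gt0.
have eta1 : eta < del by rewrite gt_min ltr_pdivrMr// mulr_natr mulr2n ltrDr del0.
have eta2 : eta < r / 3.
  by rewrite gt_min [X in _ || X]ltr_pdivrMr// mulr_natr mulr2n ltrDr r3 orbT.
exists eta => // s rs s1 s2 s3.
have e1 : expR eta < 1 + r / 3.
  have : `|1 - expR eta| < r / 3.
    by apply: Hd; rewrite -ball_normE/= sub0r normrN gtr0_norm.
  rewrite distrC => /(le_lt_trans (ler_norm _)); lra.
have w1 := weight_ge1 rs.
have wlt : weight s < 1 + (r / 3 + r / 3).
  have : expR (sup_norm (conf s)) <= expR eta by rewrite ler_expR.
  rewrite /weight; lra.
have lw : ln (weight s) <= weight s - 1.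
  have h : -1 < weight s - 1 by lra.
  by have := le_ln1Dx h; rewrite subrKC.
rewrite /system_size; have : r = r / 3 + r / 3 + r / 3 by field.
lra.
Qed.

End Size.

(** * The left length, its symmetrisation and the contact topology *)

Section ContactMetric.
Context {R : realType} {n : nat} {M : ptopologicalType}.
Variables (S : smooth_structure R n.*2.+1 M) (alpha : one_form S).
Variable mu : {finite_measure set (g_sigma_algebraType (@open M)) -> \bar R}.
Variable g : riemannian_metric S.
Hypotheses (hM : closed_connected M) (mu_gt0 : (0 < mu setT)%E).
Notation dist := (riemannian_distance g).
Notation TC := (TCDS alpha mu g).
Notation Homeo := (contact_homeo alpha mu g).
Implicit Types (s : @dynamical_system R M) (phi psi theta : M -> M).

Let cM : compact [set: M]. Proof. by case: hM. Qed.

Let I1 : I01 (1 : R). Proof. by rewrite /I01/= in_itv/= lexx ler01. Qed.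

Let reg s : TC s -> regular_system s. Proof. exact: TCDS_regular. Qed.

Lemma norm_1oo_fin s s' : regular_system s -> regular_system s' ->
  norm_1oo mu (fun t x => ham s t x - ham s' t x) \is a fin_num.
Proof.
move=> [_ _ tH Hoo _] [_ _ tK Koo _]; have tB := tameB g hM tH tK.
rewrite ge0_fin_numE; last by apply: (norm_1oo_ge0 cM mu_gt0); case: tB.
apply: le_lt_trans (norm_1oo_le_path_norm cM mu_gt0 tB) _.
rewrite lte_mul_pinfty//.
apply: le_lt_trans (path_normD cM tH (tameN g hM tK)) _.
rewrite lte_add_pinfty//; apply: le_lt_trans Koo; rewrite -[leRHS]mul1e.
by apply: (path_norm_scale cM) => // t It x; exists x; rewrite mul1r normrN.
Qed.

(** The small factor stands on the right: its flow is seen through [s], which costs the moduli of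
    continuity of the flow and conformal factor of [s]; its inverse acts last in the inverse
    product, hence directly; and the Hamiltonian changes by exactly (e^h K) o phi^-1. *)
Lemma d_alpha_comp_small s e : TC s -> 0 < e -> exists2 r, 0 < r &
  forall s', TC s' -> system_size g s' < r -> d_alpha mu g s (comp_system s s') < e.
Proof.
move=> TCs e0; have rs := reg TCs; have [cF cFi tH Hoo ch] := rs.
have e6 : 0 < e / 6 by rewrite divr_gt0.
have [d1 d10 Hd1] := modulus_map g hM cF e6.
have [d2 d20 Hd2] := modulus_fun g hM ch e6.
pose C := expR (sup_norm (conf s)); have C0 : 0 < C by exact: expR_gt0.
(* The 3 compares [norm_1oo] with [path_norm], and [C] bounds e^h. *)
have c6 : 0 < e / 6 / (3 * C) by rewrite !divr_gt0// mulr_gt0.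
pose eta := Num.min (Num.min d1 d2) (Num.min (e / 6) (e / 6 / (3 * C))).
have eta0 : 0 < eta by rewrite !lt_min d10 d20 e6 c6.
have [r r0 Hr] := size_small_weight g hM eta0.
exists r => // s' TCs' /(Hr _ (reg TCs')) [].
rewrite !lt_min => /andP[/andP[k1 k2] /andP[k3 _]] /andP[_ /andP[k4 _]] /andP[_ /andP[_ k5]].
have rs' := reg TCs'; have [cG cGi tK Koo ck] := rs'.
have rc := regular_comp g hM rs rs'.
have near_id t x : I01 t -> dist x (fwd (flow s') t x) <= dbar g id_isotopy (flow s').
  exact: (dbar_fwd g hM id_isotopy).
have near_id' t x : I01 t -> dist x (bwd (flow s') t x) <= dbar g id_isotopy (flow s').
  exact: (dbar_bwd g hM id_isotopy).
have p1 : dbar g (flow s) (flow (comp_system s s')) <= e / 6 + e / 6.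
  apply: dbar_le => t x It /=.
    by apply: ltW; apply: Hd1; rewrite ?subrr ?normr0//; exact: le_lt_trans (near_id _ _ It) k1.
  by rewrite (le_trans (near_id' _ _ It))// ltW.
have p2 : sup_norm (fun t x => conf s t x - conf (comp_system s s') t x) <= e / 6 + e / 6.
  apply: sup_norm_le => t x It /=; rewrite opprD addrA (le_trans (ler_normD _ _))// lerD//.
    by apply: ltW; apply: Hd2; rewrite ?subrr ?normr0//; exact: le_lt_trans (near_id _ _ It) k2.
  by rewrite normrN (le_trans (sup_norm_ge hM x ck It))// ltW.
have p3 : fine (norm_1oo mu (fun t x => ham s t x - ham (comp_system s s') t x)) <= e / 6.
  rewrite -lee_fin fineK ?norm_1oo_fin//.
  have tB := tameB g hM tH (regular_ham rc).
  apply: le_trans (norm_1oo_le_path_norm cM mu_gt0 tB) _.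
  apply: (@le_trans _ _ (3%:E * (C%:E * path_norm (ham s')))%E).
    apply: lee_wpmul2l; first by rewrite lee_fin.
    apply: (path_norm_scale cM) => //; first exact: ltW.
    move=> t It x; exists (bwd (flow s) t x).
    rewrite /= opprD addrA subrr add0r normrN normrM gtr0_norm ?expR_gt0//.
    rewrite ler_wpM2r// ler_expR (le_trans (ler_norm _))//.
    exact: sup_norm_ge.
  rewrite ham_normE// -!EFinM lee_fin mulrA mulrC -ler_pdivlMr ?mulr_gt0//.
  exact: ltW.
rewrite /d_alpha; have : e = e / 6 + e / 6 + (e / 6 + e / 6) + (e / 6 + e / 6) by field.
lra.
Qed.

(** The Hamiltonian of the quotient is e^-h times (K - H) o phi: both terms carry the same factor
    and argument, so the difference K - H appears directly. The flows are compared by writing x =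
    phi^-1 (phi x). *)
Lemma size_quotient_small s r : TC s -> 0 < r -> exists2 e, 0 < e &
  forall s', TC s' -> d_alpha mu g s s' < e -> system_size g (comp_system (inv_system s) s') < r.
Proof.
move=> TCs r0; have rs := reg TCs; have [cF cFi tH Hoo ch] := rs.
have [eta eta0 Heta] := small_weight_size g hM r0.
have eta2 : 0 < eta / 2 by rewrite divr_gt0.
have [d2 d20 Hd2] := modulus_fun g hM ch eta2.
have m0 : 0 < Num.min d2 (eta / 2) by rewrite lt_min d20.
(* The displacement of phi^-1 psi has to be below eta / 2 for the flow and below [d2], the modulus
   of h, for the conformal factor. *)
have [d1 d10 Hd1] := modulus_map g hM cFi m0.
pose C := expR (sup_norm (conf s)); have C0 : 0 < C by exact: expR_gt0.
pose e := Num.min (Num.min d1 (eta / 2)) (eta / C).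
exists e; first by rewrite !lt_min d10 eta2 divr_gt0.
move=> s' TCs'; rewrite !lt_min => /andP[/andP[k1 k2] k3].
have rs' := reg TCs'; have [cG cGi tK Koo ck] := rs'.
have ri := regular_inv g hM rs.
have cB : time_continuous (fun t x => conf s t x - conf s' t x).
  by apply: time_continuousD => //; exact: time_continuousN.
have db0 := dbar_ge0 g hM (flow s) (flow s').
have sn0 := sup_norm_ge0 hM cB.
have tB := tameB g hM tH tK.
have nn0 : 0 <= fine (norm_1oo mu (fun t x => ham s t x - ham s' t x)).
  by rewrite fine_ge0// (norm_1oo_ge0 cM mu_gt0)//; case: tB.
have db_le : dbar g (flow s) (flow s') <= d_alpha mu g s s' by rewrite /d_alpha; lra.
have sn_le : sup_norm (fun t x => conf s t x - conf s' t x) <= d_alpha mu g s s'.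
  by rewrite /d_alpha; lra.
have nn_le : fine (norm_1oo mu (fun t x => ham s t x - ham s' t x)) <= d_alpha mu g s s'.
  by rewrite /d_alpha; lra.
have close t x : I01 t -> dist x (bwd (flow s) t (fwd (flow s') t x)) < Num.min d2 (eta / 2).
  move=> It; rewrite -{1}(fwdK (flow s) It x); apply: Hd1; rewrite ?subrr ?normr0//.
  apply: le_lt_trans k1; exact: le_trans (dbar_fwd g hM _ _ x It) db_le.
apply: Heta; first exact: (regular_comp g hM).
- rewrite [leRHS](_ : eta = eta / 2 + eta / 2); last by field.
  apply: dbar_le => t x It /=.
    by move: (close t x It); rewrite lt_min => /andP[_ /ltW].
  rewrite -{1}(fwdK (flow s) It x); apply: ltW; apply: le_lt_trans k2.
  exact: le_trans (dbar_bwd g hM _ _ _ It) db_le.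
- apply: sup_norm_le => t x It /=.
  rewrite addrC -(subrKA (conf s t x)) (le_trans (ler_normD _ _))//.
  rewrite [leRHS](_ : eta = eta / 2 + eta / 2); last by field.
  apply: lerD; apply: ltW.
    rewrite distrC; apply: le_lt_trans k2.
    exact: le_trans (sup_norm_ge hM x cB It) sn_le.
  apply: Hd2; rewrite ?subrr ?normr0//.
  by move: (close t x It); rewrite lt_min => /andP[].
rewrite -lee_fin -ham_normE; last exact: (regular_comp g hM).
apply: (@le_trans _ _ (C%:E * path_norm (fun t x => ham s t x - ham s' t x)%R)%E).
  apply: (path_norm_scale cM) => //; first exact: ltW.
  move=> t It x; exists (fwd (flow s) t x); rewrite /= fwdK//.
  rewrite addrC -mulrBr normrM gtr0_norm ?expR_gt0// distrC ler_wpM2r// ler_expR.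
  by rewrite (le_trans (ler_norm _))// normrN sup_norm_ge.
have cHB t : I01 t -> continuous (fun x => ham s t x - ham s' t x) by case: tB => + _; apply.
apply: (@le_trans _ _ (C%:E * norm_1oo mu (fun t x => ham s t x - ham s' t x)%R)%E).
  apply: lee_wpmul2l; first by rewrite lee_fin ltW.
  exact: (path_norm_le_norm_1oo cM mu_gt0).
rewrite -[norm_1oo _ _]fineK ?norm_1oo_fin// -EFinM lee_fin mulrC -ler_pdivlMr//.
exact: ltW (le_lt_trans nn_le k3).
Qed.

(** The time-one map of [s] is phi^-1 psi, expressed without an inverse because [phi] is a bare
    function [M -> M]. *)
Definition lengths phi psi : set R :=
  [set system_size g s | s in [set s | TC s /\ phi \o ev1 s = psi]].

Definition left_length phi psi : R := inf (lengths phi psi).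

Lemma ev1_comp s s' : ev1 (comp_system s s') = ev1 s \o ev1 s'.
Proof. by []. Qed.

Lemma ev1_invK s : ev1 s \o ev1 (inv_system s) = id.
Proof. by apply/funext => x; exact: (bwdK (flow s) I1). Qed.

Lemma lengths_ge0 phi psi : lbound (lengths phi psi) 0.
Proof. by move=> _ [s [TCs _] <-]; apply: size_ge0 => //; exact: reg. Qed.

Lemma lengths_neq0 phi psi : Homeo phi -> Homeo psi -> lengths phi psi !=set0.
Proof.
move=> [s TCs <-] [s' TCs' <-].
pose q := comp_system (inv_system s) s'.
have TCq : TC q by exact: (TCDS_comp hM mu_gt0 (TCDS_inv hM mu_gt0 TCs) TCs').
have qE : ev1 s \o ev1 q = ev1 s' by rewrite ev1_comp compA ev1_invK.
exact: (ex_intro _ (system_size g q) (ex_intro2 _ _ q (conj TCq qE) erefl)).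
Qed.

Lemma left_length_ge0 phi psi : Homeo phi -> Homeo psi -> 0 <= left_length phi psi.
Proof.
move=> hphi hpsi; apply: lb_le_inf; first exact: lengths_neq0.
exact: lengths_ge0.
Qed.

Lemma left_length_le phi psi s : TC s -> phi \o ev1 s = psi ->
  left_length phi psi <= system_size g s.
Proof.
move=> TCs E; apply: ge_inf; last by exists s.
by exists 0; exact: lengths_ge0.
Qed.

Lemma left_length_lt phi psi r : Homeo phi -> Homeo psi -> left_length phi psi < r ->
  exists s, [/\ TC s, phi \o ev1 s = psi & system_size g s < r].
Proof.
move=> hphi hpsi h; have hi : has_inf (lengths phi psi).
  by split; [exact: lengths_neq0|exists 0; exact: lengths_ge0].
have h' : 0 < r - left_length phi psi by rewrite subr_gt0.
have [_ [s [TCs E] <-]] := inf_adherent h' hi.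
by rewrite subrKC => lt; exists s.
Qed.

Lemma left_length_id phi : Homeo phi -> left_length phi phi = 0.
Proof.
move=> hphi; apply/eqP; rewrite eq_le left_length_ge0// andbT.
apply: le_trans (size_id_le0 g hM); apply: left_length_le; first exact: TCDS_id.
by [].
Qed.

Lemma left_length_triangle phi psi theta : Homeo phi -> Homeo psi -> Homeo theta ->
  left_length phi theta <= left_length phi psi + left_length psi theta.
Proof.
move=> h1 h2 h3; apply/ler_addgt0Pr => e e0; have e2 : 0 < e / 2 by rewrite divr_gt0.
have [s [TCs sE slt]] : exists s, [/\ TC s, phi \o ev1 s = psi &
    system_size g s < left_length phi psi + e / 2].
  by apply: left_length_lt => //; rewrite ltrDl.
have [s' [TCs' s'E s'lt]] : exists s, [/\ TC s, psi \o ev1 s = theta &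
    system_size g s < left_length psi theta + e / 2].
  by apply: left_length_lt => //; rewrite ltrDl.
apply: (@le_trans _ _ (system_size g (comp_system s s'))).
  by apply: left_length_le; [exact: TCDS_comp|rewrite ev1_comp compA sE].
apply: le_trans (size_comp g hM (reg TCs) (reg TCs')) _.
have : e = e / 2 + e / 2 by field.
lra.
Qed.

(** Injectivity of [phi] makes all competing systems share one time-one map. Systems of arbitrarily
    small size bound its displacement, which is therefore 0. *)
Lemma left_length_eq0 phi psi : Homeo phi -> Homeo psi -> left_length phi psi = 0 ->
  phi = psi.
Proof.
move=> hphi hpsi E0; have [s0 TCs0 phiE] := hphi.
have phi_inj : injective phi by rewrite -phiE; exact: can_inj (fwdK (flow s0) I1).
have ev1_fix s x : phi \o ev1 s = psi -> forall s', phi \o ev1 s' = psi -> ev1 s x = ev1 s' x.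
  move=> sE s' s'E; apply: phi_inj.
  by have := congr1 (@^~ x) sE; have := congr1 (@^~ x) s'E => /= -> ->.
have lt1 : left_length phi psi < 1 by rewrite E0.
have [s [TCs sE _]] := left_length_lt hphi hpsi lt1.
rewrite -sE; apply/funext => x /=; congr (phi _); apply: (rdist_eq0 (g := g)) => // e e0.
have [r r0 Hr] := size_small_weight g hM e0.
have ltr : left_length phi psi < r by rewrite E0.
have [s' [TCs' s'E s'lt]] := left_length_lt hphi hpsi ltr.
rewrite (ev1_fix s x sE s' s'E); have [h _ _] := Hr s' (reg TCs') s'lt.
exact: le_lt_trans (dbar_fwd g hM id_isotopy (flow s') x I1) h.
Qed.

Lemma left_length_invariant theta phi psi : Homeo theta ->
  left_length (theta \o phi) (theta \o psi) = left_length phi psi.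
Proof.
move=> [s0 TCs0 thetaE].
have theta_inj : injective theta by rewrite -thetaE; exact: can_inj (fwdK (flow s0) I1).
rewrite /left_length; congr inf; apply/seteqP; split=> _ [s [TCs E] <-]; exists s => //; split=> //.
  apply/funext => x; apply: theta_inj; exact: (congr1 (@^~ x) E).
by rewrite -compA E.
Qed.

Definition contact_dist phi psi : R := left_length phi psi + left_length psi phi.

Lemma contact_dist_metric : metric_on Homeo contact_dist.
Proof.
split=> [a b Aa Ab|a b Aa Ab|a b Aa Ab|a b c Aa Ab Ac].
- by rewrite addr_ge0// left_length_ge0.
- split=> [|->]; last by rewrite /contact_dist left_length_id// addr0.
  move=> E; apply: left_length_eq0 => //.
  have := left_length_ge0 Aa Ab; have := left_length_ge0 Ab Aa.
  by move: E; rewrite /contact_dist; lra.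
- by rewrite /contact_dist addrC.
have := left_length_triangle Aa Ab Ac; have := left_length_triangle Ac Ab Aa.
rewrite /contact_dist; lra.
Qed.

Lemma contact_dist_left_invariant : left_invariant Homeo contact_dist.
Proof. by move=> f a b Af Aa Ab; rewrite /contact_dist !left_length_invariant. Qed.

Lemma contact_dist_open V :
  contact_open alpha mu g V <-> metric_open Homeo contact_dist V.
Proof.
split=> [[VA [_ Vopen]]|[VA Vopen]]; split=> //.
  (* One lift s of a is enough: a point near a for the left length lifts to a product s s' with s'
     of small size, hence close to s in [d_alpha]. *)
  move=> a Va; have [s TCs sE] := VA a Va.
  have [e e0 He] := Vopen s (conj TCs (eq_ind_r V Va sE)).
  have [r r0 Hr] := d_alpha_comp_small TCs e0.
  exists r => // b Ab abr.
  have [s' [TCs' s'E s'lt]] : exists s', [/\ TC s', a \o ev1 s' = b & system_size g s' < r].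
    apply: left_length_lt => //; first exact: VA.
    by apply: le_lt_trans abr; rewrite lerDl left_length_ge0//; exact: VA.
  have [_] := He (comp_system s s') (TCDS_comp hM mu_gt0 TCs TCs') (Hr s' TCs' s'lt).
  by rewrite /preimage /= ev1_comp sE s'E.
split=> [s []//|s [TCs Vs]].
(* A third, because N(q) + N(q^-1) <= 3 N(q) for q = s^-1 b. *)
have [e e0 He] := Vopen (ev1 s) Vs; have e3 : 0 < e / 3 by rewrite divr_gt0.
have [r r0 Hr] := size_quotient_small TCs e3.
exists r => // b TCb sb; split=> //; apply: He; first by exists b.
have TCi := TCDS_inv hM mu_gt0 TCs; have TCq := TCDS_comp hM mu_gt0 TCi TCb.
have q := Hr b TCb sb.
have h1 : left_length (ev1 s) (ev1 b) <= system_size g (comp_system (inv_system s) b).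
  by apply: left_length_le => //; rewrite ev1_comp compA ev1_invK.
have h2 : left_length (ev1 b) (ev1 s) <= system_size g (inv_system (comp_system (inv_system s) b)).
  apply: left_length_le; first exact: TCDS_inv.
  apply/funext => x; exact: (bwdK (flow b) I1).
have h3 := size_inv g hM (reg TCq).
rewrite /contact_dist; have : e = 3 * (e / 3) by field.
lra.
Qed.

End ContactMetric.

Theorem corollary6p3 (R : realType) (n : nat) (M : ptopologicalType)
    (S : smooth_structure R n.*2.+1 M) (hM : closed_connected M)
    (alpha : one_form S) (halpha : contact_form alpha)
    (mu : {finite_measure set (g_sigma_algebraType (@open M)) -> \bar R})
    (hmu : volume_measure alpha mu)
    (g : riemannian_metric S) :
  exists delta : (M -> M) -> (M -> M) -> R,
    [/\ metric_on (contact_homeo alpha mu g) delta,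
        left_invariant (contact_homeo alpha mu g) delta &
        forall V : set (M -> M),
          contact_open alpha mu g V <->
          metric_open (contact_homeo alpha mu g) delta V].
Proof.
have mu_gt0 := volume_gt0 halpha hmu.
exists (contact_dist alpha mu g); split.
- exact: contact_dist_metric.
- exact: contact_dist_left_invariant.
- exact: contact_dist_open.
Qed.
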